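(* Let $C \subset \mathbb{P}^2$ be a smooth plane curve of degree $d=6$ over $K$. Then $\delta'[3]=0, 1, 2, 3, 4, 8$ or $12$. Furthermore, the following hold. (1) $\delta'[3]=12$ if and only if $C$ is projectively equivalent to the curve defined by $$X^6+Y^6+Z^6-10(X^3Y^3+Y^3Z^3+Z^3X^3)=0.$$ (2) $\delta'[3]=8$ if and only if $C$ is projectively equivalent to the curve defined by $$X^6+20X^3Y^3-8Y^6+Z^6=0.$$ (3) $\delta'[3]=4$ if and only if $C$ is projectively equivalent to the curve defined by $$Z^6+a(X^3Y+Y^4)Z^2+(X^6+20X^3Y^3-8Y^6)=0$$ for some $a \in K \setminus \{0\}$, and $C$ is not projectively equivalent to the curve defined by $X^6+Y^6+Z^6-10(X^3Y^3+Y^3Z^3+Z^3X^3)=0$.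
   Context: $K$ is an algebraically closed field of characteristic zero and $(X:Y:Z)$ are homogeneous coordinates on $\mathbb{P}^2$. For a point $P \in \mathbb{P}^2$, $\pi_P : C \dashrightarrow \mathbb{P}^1$ denotes the projection from $P$, $Q \mapsto \overline{PQ}$, and $G[P]$ denotes the group of all birational transformations $\sigma$ of $C$ preserving the fibers of $\pi_P$ (i.e. $\pi_P\circ\sigma=\pi_P$). A point $P$ is called quasi-Galois if $|G[P]| \ge 2$. $\delta'[m]$ denotes the number of quasi-Galois points $P \in \mathbb{P}^2 \setminus C$ with $|G[P]|=m$. Two plane curves are projectively equivalent if a linear transformation of $\mathbb{P}^2$ maps one onto the other. *)

(* Defs.v *)
From mathcomp Require Import all_boot all_order all_algebra.
From mathcomp Require Export mpoly.

Set Implicit Arguments.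
Unset Strict Implicit.
Unset Printing Implicit Defensive.

Import GRing.Theory.

Local Open Scope ring_scope.

(* A has exactly n elements up to the equivalence relation E. *)
Definition card_mod (T : Type) (E : T -> T -> Prop) (A : T -> Prop) (n : nat)
    : Prop :=
  exists e : 'I_n -> T,
    [/\ forall i, A (e i),
        forall i j, E (e i) (e j) -> i = j
      & forall x, A x -> exists i, E x (e i)].

(* A point of the projective plane is given by a nonzero vector of homogeneous
   coordinates; two such vectors give the same point when they span the same
   line of K^3. *)
Definition same_pt (K : fieldType) (v w : 'rV[K]_3) : Prop :=
  <[v]>%VS = <[w]>%VS.

(* The projective line through v and w (for distinct points), as a plane of
   K^3. *)
Definition line_through (K : fieldType) (v w : 'rV[K]_3) : {vspace 'rV[K]_3} :=
  (<[v]> + <[w]>)%VS.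

(* A plane curve is given by a form F in three variables. *)
Definition on_curve (K : fieldType) (F : {mpoly K[3]}) (v : 'rV[K]_3) : Prop :=
  v != 0 /\ F.@[v 0] = 0.

Definition smooth_curve (K : fieldType) (F : {mpoly K[3]}) : Prop :=
  forall v : 'rV[K]_3, on_curve F v -> exists i : 'I_3, (F^`M(i)).@[v 0] != 0.

Definition projectively_equivalent (K : fieldType) (F G : {mpoly K[3]}) : Prop :=
  exists2 M : 'M[K]_3, M \in unitmx
    & forall v : 'rV[K]_3, on_curve F v <-> on_curve G (v *m M).

(* Rational self-maps of the curve C : F = 0, represented by triples of forms
   of equal degree.  The representative f is considered at the points v of C
   where it is defined, i.e. where eval_map f v != 0. *)
Definition ratmap (K : fieldType) : Type := 'I_3 -> {mpoly K[3]}.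

Definition eval_map (K : fieldType) (f : ratmap K) (v : 'rV[K]_3) : 'rV[K]_3 :=
  \row_i (f i).@[v 0].

Definition is_ratmap (K : fieldType) (F : {mpoly K[3]}) (f : ratmap K) : Prop :=
  [/\ exists e : nat, forall i, f i \is e.-homog,
      exists2 v, on_curve F v & eval_map f v != 0
    & forall v, on_curve F v -> eval_map f v != 0 -> on_curve F (eval_map f v)].

(* For C irreducible, two representatives define the same rational map iff they
   agree wherever both are defined. *)
Definition ratmap_eq (K : fieldType) (F : {mpoly K[3]}) (f g : ratmap K) : Prop :=
  forall v, on_curve F v -> eval_map f v != 0 -> eval_map g v != 0 ->
    same_pt (eval_map f v) (eval_map g v).

(* The composite g o f is a well-defined rational map and equals the identity
   of C. *)
Definition comp_is_id (K : fieldType) (F : {mpoly K[3]}) (g f : ratmap K) : Prop :=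
  (exists v, [/\ on_curve F v, eval_map f v != 0
               & eval_map g (eval_map f v) != 0])
  /\ (forall v, on_curve F v -> eval_map f v != 0 ->
        eval_map g (eval_map f v) != 0 ->
        same_pt (eval_map g (eval_map f v)) v).

Definition birational (K : fieldType) (F : {mpoly K[3]}) (f : ratmap K) : Prop :=
  is_ratmap F f
  /\ exists g, [/\ is_ratmap F g, comp_is_id F g f & comp_is_id F f g].

(* pi_P o f = pi_P, where pi_P sends Q <> P to the line PQ. *)
Definition preserves_fibers (K : fieldType) (F : {mpoly K[3]}) (P : 'rV[K]_3)
    (f : ratmap K) : Prop :=
  forall v, on_curve F v -> eval_map f v != 0 ->
    ~ same_pt v P -> ~ same_pt (eval_map f v) P ->
    line_through P (eval_map f v) = line_through P v.

(* Membership in G[P], on representatives. *)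
Definition in_G (K : fieldType) (F : {mpoly K[3]}) (P : 'rV[K]_3)
    (f : ratmap K) : Prop :=
  birational F f /\ preserves_fibers F P f.

Definition card_G (K : fieldType) (F : {mpoly K[3]}) (P : 'rV[K]_3) (m : nat)
    : Prop :=
  card_mod (ratmap_eq F) (in_G F P) m.

(* |G[P]| >= 2. *)
Definition quasi_galois (K : fieldType) (F : {mpoly K[3]}) (P : 'rV[K]_3) : Prop :=
  exists f g, [/\ in_G F P f, in_G F P g & ~ ratmap_eq F f g].

(* delta'[m] = n. *)
Definition delta' (K : fieldType) (F : {mpoly K[3]}) (m n : nat) : Prop :=
  card_mod (@same_pt K)
    (fun P => [/\ P != 0, ~ on_curve F P, quasi_galois F P & card_G F P m]) n.

Definition curve12 (K : fieldType) : {mpoly K[3]} :=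
  let X : {mpoly K[3]} := 'X_0 in
  let Y : {mpoly K[3]} := 'X_1 in
  let Z : {mpoly K[3]} := 'X_2 in
  X ^+ 6 + Y ^+ 6 + Z ^+ 6
    - 10%:R * (X ^+ 3 * Y ^+ 3 + Y ^+ 3 * Z ^+ 3 + Z ^+ 3 * X ^+ 3).

Definition curve8 (K : fieldType) : {mpoly K[3]} :=
  let X : {mpoly K[3]} := 'X_0 in
  let Y : {mpoly K[3]} := 'X_1 in
  let Z : {mpoly K[3]} := 'X_2 in
  X ^+ 6 + 20%:R * X ^+ 3 * Y ^+ 3 - 8%:R * Y ^+ 6 + Z ^+ 6.

Definition curve4 (K : fieldType) (a : K) : {mpoly K[3]} :=
  let X : {mpoly K[3]} := 'X_0 in
  let Y : {mpoly K[3]} := 'X_1 in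
  let Z : {mpoly K[3]} := 'X_2 in
  Z ^+ 6 + a *: ((X ^+ 3 * Y + Y ^+ 4) * Z ^+ 2)
    + (X ^+ 6 + 20%:R * X ^+ 3 * Y ^+ 3 - 8%:R * Y ^+ 6).

(* Main.v *)
From Stdlib Require Import Classical_Prop.
Require Import Defs.
From mathcomp Require Import all_boot all_order all_algebra.
From mathcomp Require Import separable ring zify.

(** Write C for the curve F = 0, of degree d, and let P be a point off C.

    The first half shows that G[P] consists of homologies.  In coordinates
    where P = (0, 0, 1), F is monic of degree d in the last variable, so C has
    two affine charts which are finite over a line, with rings K[x][z] / (p).
    Smoothness makes p squarefree, so that these rings satisfy the
    Nullstellensatz ([vanish_dvdp]), and integrally closed ([normality]).  A
    map f in G[P] sends v to v + mu P with mu a rational function on C; the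
    equation of C is an integral equation for the last coordinate of f v, so
    this coordinate is a polynomial in each chart, and comparing the two
    charts bounds its degree by one ([degree_bound], [integral_linear]).
    Hence f is linear ([fiber_map_linear]): it is the homology
    v |-> v + (a - 1) lambda_P(v) P for some scalar a, where
    lambda_P = dF_P / (d F(P)) is the normalized polar form of P
    ([homology_form]).  So |G[P]| is the number of scalars a whose homology
    multiplies F by a^d ([card_GP]).

    Now let d = 6 and let w be a primitive cube root of unity.  |G[P]| = 3
    means that w is such a scalar and -1 is not ([card3P]).  That w is one says
    that on each line through P the form F is a quadratic polynomial in u^3
    ([center3_line]).  For two such centers P and Q with lambda_P(Q) = 1, put
    kappa = lambda_Q(P).  Restricting F to the line PQ forces kappa to be 1/3,
    2/3 or 1 ([pair_line]), and smoothness excludes 1 ([no_parallel_axes]).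
    In the two other cases the restriction is the form of an octahedron and F
    is, up to coordinates, the member of parameter a of the pencil
      z^6 + a (x^3 y + y^4) z^2 + (x^6 + 20 x^3 y^3 - 8 y^6),
    with a = 0 when kappa = 2/3 ([pair_in_pencil]).  If lambda_P(Q) = 0 for all
    pairs of distinct centers, the centers are linearly independent, and there
    are at most three ([few_commuting]).

    It remains to find the centers of the members of the pencil.  The four
    roots of y (x^3 + y^3), the vertices of a tetrahedron inscribed in the line
    z = 0, are always centers.  If a = 0 the four vertices of the dual
    tetrahedron, the roots of x (x^3 - 8 y^3), are centers too, and the only
    other point with a homology of order three is (0, 0, 1), whose group has
    order six.  If a != 0, a center off the line z = 0 is on the axis of exactly
    one of the first four ([tetrahedral_incidence]); this leaves two candidates
    for each of them, and they are centers if and only if a^3 = 18000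
    ([center3_offline], [cube18000]).  So the number is 8, 12 or 4
    ([delta'_pencil]).  Finally, projective equivalence of F with another
    sextic means that F is a multiple of it after a change of coordinates
    ([pe_formP]), and the curve with twelve centers is the member with
    a^3 = 18000, up to coordinates ([pe_curve12]). *)

Set Implicit Arguments.
Unset Strict Implicit.
Unset Printing Implicit Defensive.

Import GRing.Theory.

Local Open Scope ring_scope.

(** * Bivariate polynomials *)

Section Bivariate.
Variable K : closedFieldType.
Implicit Types (p q G H : {poly {poly K}}) (d e : {poly K}) (x z : K).

Definition at_x x G : {poly K} := map_poly (horner_eval x) G.
Definition ev2 G x z : K := (at_x x G).[z].

(** The partial derivative in the first variable; the one in the second
    variable is [G^`()]. *)
Definition dx G : {poly {poly K}} := map_poly (@deriv K) G.

Lemma at_xD x G H : at_x x (G + H) = at_x x G + at_x x H.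
Proof. exact: rmorphD. Qed.
Lemma at_xB x G H : at_x x (G - H) = at_x x G - at_x x H.
Proof. exact: rmorphB. Qed.
Lemma at_xM x G H : at_x x (G * H) = at_x x G * at_x x H.
Proof. exact: rmorphM. Qed.
Lemma at_xX x G n : at_x x (G ^+ n) = at_x x G ^+ n.
Proof. exact: rmorphXn. Qed.
Lemma at_xC x d : at_x x d%:P = d.[x]%:P.
Proof. by rewrite /at_x map_polyC. Qed.
Lemma at_x_sum x (I : Type) (r : seq I) P (f : I -> {poly {poly K}}) :
  at_x x (\sum_(i <- r | P i) f i) = \sum_(i <- r | P i) at_x x (f i).
Proof. exact: rmorph_sum. Qed.
Lemma at_x_lift x (g : {poly K}) : at_x x (map_poly polyC g) = g.
Proof.
rewrite /at_x -map_poly_comp; apply: map_poly_id => c _ /=.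
by rewrite /horner_eval hornerC.
Qed.
Lemma at_x_deriv x G : at_x x G^`() = (at_x x G)^`().
Proof. by rewrite /at_x deriv_map. Qed.

Lemma ev2D G H x z : ev2 (G + H) x z = ev2 G x z + ev2 H x z.
Proof. by rewrite /ev2 at_xD hornerD. Qed.
Lemma ev2B G H x z : ev2 (G - H) x z = ev2 G x z - ev2 H x z.
Proof. by rewrite /ev2 at_xB hornerD hornerN. Qed.
Lemma ev2M G H x z : ev2 (G * H) x z = ev2 G x z * ev2 H x z.
Proof. by rewrite /ev2 at_xM hornerM. Qed.
Lemma ev2X G n x z : ev2 (G ^+ n) x z = ev2 G x z ^+ n.
Proof. by rewrite /ev2 at_xX horner_exp. Qed.
Lemma ev2C d x z : ev2 d%:P x z = d.[x].
Proof. by rewrite /ev2 at_xC hornerC. Qed.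
Lemma ev2_sum (I : Type) (r : seq I) P (f : I -> {poly {poly K}}) x z :
  ev2 (\sum_(i <- r | P i) f i) x z = \sum_(i <- r | P i) ev2 (f i) x z.
Proof. by rewrite /ev2 at_x_sum horner_sum. Qed.
Lemma ev2_0 x z : ev2 0 x z = 0.
Proof. by rewrite /ev2 /at_x rmorph0 horner0. Qed.
Lemma ev2Z (d : {poly K}) G x z : ev2 (d *: G) x z = d.[x] * ev2 G x z.
Proof. by rewrite -mul_polyC ev2M ev2C. Qed.
Lemma ev2_varz x z : ev2 'X x z = z.
Proof. by rewrite /ev2 /at_x map_polyX hornerX. Qed.
Lemma ev2_horner G x z : ev2 G x z = G.[z%:P].[x].
Proof.
by rewrite /ev2 /at_x -{1}(hornerC z x) -[z%:P.[x]]/(horner_eval x z%:P) horner_map.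
Qed.

Lemma dxD G H : dx (G + H) = dx G + dx H.
Proof. exact: raddfD. Qed.
Lemma dxM G H : dx (G * H) = dx G * H + G * dx H.
Proof.
apply/polyP=> n; rewrite coefD coef_map !coefM raddf_sum -big_split /=.
by apply: eq_bigr => i _; rewrite derivM !coef_map.
Qed.
Lemma dxC d : dx d%:P = d^`()%:P.
Proof. by rewrite /dx map_polyC. Qed.
Lemma dx_lift (g : {poly K}) : dx (map_poly polyC g) = 0.
Proof. by apply/polyP=> n; rewrite !coef_map /= coef0 derivC. Qed.

Definition smooth2 p :=
  forall x z, ev2 p x z = 0 -> ev2 (dx p) x z = 0 -> ev2 p^`() x z = 0 -> False.

Lemma at_x_eq0 x G : at_x x G = 0 -> exists G', G = ('X - x%:P)%:P * G'.
Proof.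
move=> h; exists (map_poly (fun d => d %/ ('X - x%:P)) G).
apply/polyP => i; rewrite coefCM coef_map_id0 ?div0p //.
have hx : ('X - x%:P) %| G`_i.
  by rewrite dvdp_XsubCl /root -[_.[_]]/(horner_eval x G`_i) -coef_map -/(at_x x G) h coef0.
by rewrite mulrC divpK.
Qed.

Lemma at_x_split x G :
  exists G', G = map_poly polyC (at_x x G) + ('X - x%:P)%:P * G'.
Proof.
have [|G' hG] := @at_x_eq0 x (G - map_poly polyC (at_x x G)).
  by rewrite at_xB at_x_lift subrr.
by exists G'; rewrite -hG addrCA subrr addr0.
Qed.

Lemma poly_eq0_cofin d e : e != 0 -> (forall x, e.[x] != 0 -> d.[x] = 0) -> d = 0.
Proof.
move=> e0 h; apply/eqP; apply: contraT => d0.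
have /closed_nonrootP[x] : d * e != 0 by rewrite mulf_neq0.
rewrite rootE hornerM; have [->|ex] := eqVneq e.[x] 0; first by rewrite mulr0 eqxx.
by rewrite h // mul0r eqxx.
Qed.

Lemma at_x_eq0_cofin G e : e != 0 ->
  (forall x, e.[x] != 0 -> at_x x G = 0) -> G = 0.
Proof.
move=> e0 h; apply/polyP=> i; rewrite coef0; apply: (poly_eq0_cofin e0) => x ex.
by rewrite -[LHS]/(horner_eval x G`_i) -coef_map -/(at_x x G) h // coef0.
Qed.

Section Monic.
Variable p : {poly {poly K}}.
Hypothesis p_monic : p \is monic.

Lemma mdvdP G : reflect (exists q, G = q * p) (p %| G).
Proof. exact: Pdiv.IdomainMonic.dvdpP. Qed.

Lemma at_x_monic x : at_x x p \is monic.
Proof. exact: monic_map. Qed.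

Lemma size_at_x x : size (at_x x p) = size p.
Proof. by rewrite size_map_poly_id0 // (monicP p_monic) rmorph1 oner_eq0. Qed.

Lemma dvd_small G : p %| G -> (size G < size p)%N -> G = 0.
Proof.
move=> h lt; apply/eqP; apply: contraT => G0.
by have := dvdp_leq G0 h; rewrite leqNgt lt.
Qed.

Lemma mdiv G : exists q r, G = q * p + r /\ (size r < size p)%N.
Proof.
exists (G %/ p), (G %% p); split; first exact: Pdiv.IdomainMonic.divp_eq.
by rewrite ltn_modp monic_neq0.
Qed.

(** As [p] is monic, the quotient by [p] is a free module over K[x], hence
    torsion-free. *)
Lemma cancel_const d G : d != 0 -> p %| d%:P * G -> p %| G.
Proof.
move=> d0 h; have [q [r [eG lt]]] := mdiv G.
suff r0 : r = 0 by rewrite eG r0 addr0 dvdp_mull.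
have : p %| d%:P * r.
  have -> : d%:P * r = d%:P * G - d%:P * q * p by rewrite eG; ring.
  by rewrite dvdp_subr // dvdp_mull.
move/dvd_small; rewrite size_Cmul // => /(_ lt)/eqP.
by rewrite mulf_eq0 polyC_eq0 (negPf d0) => /eqP.
Qed.

(** As [p] is not identically zero on the horizontal line of height [z], a
    relation [(Z - z) G = q p] forces [Z - z] to divide [q]. *)
Lemma cancel_XsubC z G : p.[z%:P] != 0 -> p %| ('X - z%:P%:P) * G -> p %| G.
Proof.
move=> pz /mdvdP[q eq]; have := congr1 (horner^~ z%:P) eq.
rewrite /= !hornerM !hornerE subrr mul0r => /esym/eqP.
rewrite mulf_eq0 (negPf pz) orbF => /factor_theorem[q' eq'].
apply/mdvdP; exists q'; apply: (@mulfI _ ('X - z%:P%:P)).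
  by rewrite polyXsubC_eq0.
by rewrite eq eq'; ring.
Qed.

Lemma cancel_XsubCn z n G : p.[z%:P] != 0 -> p %| ('X - z%:P%:P) ^+ n * G -> p %| G.
Proof.
move=> pz; elim: n => [|n IH]; first by rewrite expr0 mul1r.
by rewrite exprS -mulrA => /(cancel_XsubC pz)/IH.
Qed.

End Monic.

End Bivariate.

(** * Zeros of a smooth monic bivariate polynomial *)

Section Nullstellensatz.
Variable K : closedFieldType.
Hypothesis charK0 : [pchar K] =i pred0.
Implicit Types (p q G H : {poly {poly K}}) (d e : {poly K}) (x z : K).

Lemma natK_neq0 n : (n.+1%:R : K) != 0.
Proof. by rewrite (pcharf0P K).1. Qed.

Lemma deriv_neq0 H : (1 < size H)%N -> H^`() != 0.
Proof.
move=> H1; apply/eqP => /polyP/(_ (size H).-2).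
rewrite coef_deriv coef0 -mulr_natr -[_.-2.+1]/((size H).-1.-1.+1).
rewrite prednK -?lead_coefE; last by case: (size H) H1 => [|[]].
move/eqP; rewrite mulf_eq0 lead_coef_eq0 -size_poly_eq0 -polyC_natr polyC_eq0.
case: (size H) H1 => [|[|n]] //= _.
by rewrite (negPf (natK_neq0 _)).
Qed.

Lemma coprimep_const G H : coprimep G H ->
  exists u v, exists2 d : {poly K}, d != 0 & d%:P = u * G + v * H.
Proof.
case/Bezout_coprimepP=> -[u v] /= /eqp_size; rewrite size_poly1 => /eqP/size_poly1P[d d0 e].
by exists u, v, d.
Qed.

Lemma exists_nonroot d : d != 0 -> exists x, d.[x] != 0.
Proof. by case/closed_nonrootP=> x; exists x. Qed.

(** Smoothness makes [p] squarefree over K(x).  Otherwise let [H] be a common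
    factor of [p] and its derivative, of minimal degree; then [H] is coprime to
    its own derivative.  Write [c p = G H].  At a general zero of [H] the
    derivative [G H'] of [c p] vanishes and [H'] does not, so [G = 0] there,
    and all derivatives of [p] vanish. *)
Lemma smooth_coprime_deriv p : p \is monic -> smooth2 p -> coprimep p p^`().
Proof.
move=> mon sm.
suff no n H : (size H <= n)%N -> (1 < size H)%N -> H %| p -> H %| p^`() -> False.
  rewrite coprimep_def; have: gcdp p p^`() != 0 by rewrite gcdp_eq0 (negPf (monic_neq0 mon)).
  rewrite -size_poly_gt0; case E: (size _) => [|[|m]] // _; exfalso.
  by apply: (no _ _ (leqnn _)) (dvdp_gcdl p p^`()) (dvdp_gcdr _ _); rewrite E.
elim: n H => [|n IH] H le gt1 Hp Hp'; first by rewrite leqn0 in le; rewrite (eqP le) in gt1.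
have H0 : H != 0 by rewrite -size_poly_gt0 (ltn_trans _ gt1).
have H'0 := deriv_neq0 gt1.
have lc0 : lead_coef H != 0 by rewrite lead_coef_eq0.
have [big|small] := ltnP 1 (size (gcdp H H^`())).
  apply: (IH (gcdp H H^`())) => //.
  - have := leq_gcdpr H H'0; have := lt_size_deriv H0; have := le; move=> h1 h2 h3; rewrite -ltnS; exact: leq_trans (leq_ltn_trans h3 h2) h1.
  - exact: dvdp_trans (dvdp_gcdl _ _) Hp.
  - exact: dvdp_trans (dvdp_gcdl _ _) Hp'.
have : coprimep H H^`().
  rewrite coprimep_def eqn_leq small size_poly_gt0 gcdp_eq0 negb_and H0.
  by [].
case/coprimep_const=> u [v [e e0 eE]].
have [[c G] /= c0 eG] := Pdiv.WeakIdomain.dvdpP _ _ Hp.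
have [[c' G'] /= c'0 eG'] := Pdiv.WeakIdomain.dvdpP _ _ Hp'.
have [x] := exists_nonroot (mulf_neq0 (mulf_neq0 e0 c0) (mulf_neq0 c'0 lc0)).
rewrite !hornerM !mulf_eq0 !negb_or => /andP[/andP[ex cx] /andP[c'x lx]].
have sHx : size (at_x x H) = size H by rewrite size_map_poly_id0.
have /closed_rootP[z /eqP Hz] : size (at_x x H) != 1%N by rewrite sHx neq_ltn gt1 orbT.
have {}Hz : ev2 H x z = 0 by [].
have pz : ev2 p x z = 0.
  have := congr1 (fun G => ev2 G x z) eG; rewrite ev2Z ev2M Hz mulr0 => /eqP.
  by rewrite mulf_eq0 (negPf cx) => /eqP.
have p'z : ev2 p^`() x z = 0.
  have := congr1 (fun G => ev2 G x z) eG'; rewrite ev2Z ev2M Hz mulr0 => /eqP.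
  by rewrite mulf_eq0 (negPf c'x) => /eqP.
have H'z : ev2 H^`() x z != 0.
  apply/eqP => h; have := congr1 (fun G => ev2 G x z) eE.
  by rewrite ev2D !ev2M Hz h !mulr0 addr0 ev2C => /eqP; rewrite (negPf ex).
have Gz : ev2 G x z = 0.
  have := congr1 (fun G => ev2 G^`() x z) eG.
  rewrite derivZ derivM ev2Z ev2D !ev2M p'z Hz !(mulr0, addr0, add0r) => /esym/eqP.
  by rewrite mulf_eq0 (negPf H'z) orbF => /eqP.
apply: (sm x z) => //.
have := congr1 (fun G => ev2 (dx G) x z) eG.
rewrite -mul_polyC !dxM !ev2D !ev2M pz Hz Gz !(mulr0, mul0r, addr0, add0r) ev2C => /eqP.
by rewrite mulf_eq0 (negPf cx) => /eqP.
Qed.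

(** A Bezout relation between [p] and its derivative specializes at every [x]
    where its right-hand side does not vanish. *)
Lemma at_x_separable p : p \is monic -> smooth2 p -> 
  exists2 d, d != 0 & forall x, d.[x] != 0 -> coprimep (at_x x p) (at_x x p)^`().
Proof.
move=> mon sm; have [u [v [d d0 e]]] := coprimep_const (smooth_coprime_deriv mon sm).
exists d => // x dx0; apply/Bezout_coprimepP; exists (at_x x u, at_x x v) => /=.
rewrite -at_x_deriv -!at_xM -at_xD -e at_xC polyC_eqp1 //.
Qed.

(** Nullstellensatz for the affine curve [p = 0], with a finite number of
    vertical lines [e = 0] left out.  The remainder [r] of [G] modulo [p] has
    smaller degree than [p]; for general [x] the polynomial [p(x, -)] has
    distinct roots, at which [r(x, -)] vanishes, so [r(x, -) = 0]. *)
Lemma vanish_dvdp p G e : p \is monic -> smooth2 p -> e != 0 ->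
  (forall x z, e.[x] != 0 -> ev2 p x z = 0 -> ev2 G x z = 0) -> p %| G.
Proof.
move=> mon sm e0 h; have [q [r [eG lt]]] := mdiv mon G.
suff r0 : r = 0 by rewrite eG r0 addr0 dvdp_mull.
have [d d0 sep] := at_x_separable mon sm.
apply: (at_x_eq0_cofin (mulf_neq0 d0 e0)) => x.
rewrite hornerM mulf_eq0 negb_or => /andP[dx0 ex0].
have [rs ers] := closed_field_poly_normal (at_x x p).
rewrite (monicP (at_x_monic mon x)) scale1r in ers.
have urs : uniq rs by rewrite -separable_prod_XsubC -ers unlock; exact: sep.
apply/eqP; apply: contraT => rx0.
suff : (size rs < size (at_x x r))%N.
  move/leq_trans/(_ (size_poly _ _)); rewrite ltnNge.
  have := size_prod_XsubC rs id; rewrite /= -ers size_at_x // => sz.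
  by rewrite sz ltnS in lt; rewrite lt.
apply: max_poly_roots => //; apply/allP => z zrs.
have pz : ev2 p x z = 0 by apply/eqP; rewrite /ev2 ers -rootE root_prod_XsubC.
have := h x z ex0 pz; rewrite eG ev2D ev2M pz mulr0 add0r => rz.
exact/eqP.
Qed.

End Nullstellensatz.

(** * Normality of a smooth affine curve *)

Section Normality.
Variable K : closedFieldType.
Implicit Types (p q G H : {poly {poly K}}) (d e : {poly K}) (x z : K).

Lemma exp_split n (i : 'I_n) (a : {poly {poly K}}) : a ^+ n = a ^+ i * a ^+ (n - i).
Proof. by rewrite -exprD subnKC // ltnW. Qed.

Lemma modM p (a b c d : {poly {poly K}}) : p %| a - b -> p %| c - d -> p %| a * c - b * d.
Proof.
move=> h1 h2; have -> : a * c - b * d = (a - b) * c + b * (c - d) by ring.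
by rewrite dvdp_add ?(dvdp_mulr _ h1) ?(dvdp_mull _ h2).
Qed.
Lemma modX p (a b : {poly {poly K}}) n : p %| a - b -> p %| a ^+ n - b ^+ n.
Proof.
by move=> h; elim: n => [|n IH]; rewrite ?expr0 ?subrr ?dvdp0 // !exprS modM.
Qed.
Lemma modD p (a b c d : {poly {poly K}}) : p %| a - b -> p %| c - d -> p %| (a + c) - (b + d).
Proof. by move=> h1 h2; rewrite opprD addrACA dvdp_add. Qed.
Lemma mod_sum p n (f g : 'I_n -> {poly {poly K}}) :
  (forall i, p %| f i - g i) -> p %| \sum_i f i - \sum_i g i.
Proof.
move=> h; rewrite -sumrB; elim/big_ind: _ => [|a b|i _]; rewrite ?dvdp0 //.
exact: dvdp_add.
Qed.
Lemma mod_trans p (a b : {poly {poly K}}) : p %| a - b -> p %| a -> p %| b.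
Proof. by move=> h1 h2; rewrite -(dvdp_subr b h2). Qed.

Section Step.
Variable p : {poly {poly K}}.
Hypotheses (mon : p \is monic) (sm : smooth2 p).

(** If [p] were zero on the horizontal line through the point, its
    [x]-derivative would vanish there. *)
Lemma smooth_horner_neq0 x z : ev2 p x z = 0 -> ev2 (dx p) x z != 0 ->
  p.[z%:P] != 0.
Proof.
move=> pz; apply: contraNneq => /eqP/factor_theorem[q ->].
have -> : 'X - z%:P%:P = map_poly polyC ('X - z%:P) :> {poly {poly K}}.
  by rewrite rmorphB /= map_polyX map_polyC.
rewrite dxM dx_lift mulr0 addr0 ev2M.
have -> : ev2 (map_poly polyC ('X - z%:P)) x z = 0.
  by rewrite /ev2 at_x_lift !hornerE subrr.
by rewrite mulr0.
Qed.

(** The hypothesis says that [s / X], with [X = x - x0], is integral over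
    K[x][z] / (p).  On the line [X = 0] write [p = g h] and [s = g t] with [g]
    the gcd.  If [h] has a root [z], the integral equation gives [g(z) = 0] as
    well, so [z] is a double root, the [z]-derivative of [p] vanishes at [(x0,
    z)], and the [x]-derivative does not.  So in [p = g h + X E] the factor [E]
    is nonzero at this point.  Modulo [p] one has [E s = g W] and [E X = - g
    h]: multiplying the integral equation by [E^n] and cancelling the factors
    [Z - z] of [g] gives a relation whose value at the point is a nonzero
    multiple of [W^n], and [W] is nonzero there. *)
Lemma normality_step n (b : nat -> {poly {poly K}}) s x :
  p %| s ^+ n + \sum_(i < n) b i * s ^+ i * ('X - x%:P)%:P ^+ (n - i) ->
  exists s', p %| s - ('X - x%:P)%:P * s'.
Proof.
set X := ('X - x%:P)%:P => hs.
set pb := at_x x p; set sb := at_x x s.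
have Xx : at_x x X = 0 by rewrite at_xC hornerXsubC subrr.
have pbsb : pb %| sb ^+ n.
  have [q eq] := mdvdP mon _ hs; have := congr1 (at_x x) eq.
  rewrite at_xD at_xM at_x_sum big1 => [|i _].
    by rewrite addr0 at_xX => ->; rewrite dvdp_mull.
  by rewrite at_xM at_xX Xx expr0n subn_eq0 leqNgt ltn_ord mulr0.
have [s1 es] := at_x_split x s; have [E eE] := at_x_split x p.
rewrite -/pb -/sb -/X in es eE.
suff /dvdpP[q0 eq0] : pb %| sb.
  exists (s1 - map_poly polyC q0 * E); apply/(mdvdP mon); exists (map_poly polyC q0).
  by rewrite es eq0 [in RHS]eE rmorphM /=; ring.
apply: contraT => ndvd; exfalso.
have pb0 : pb != 0 by rewrite monic_neq0 ?at_x_monic.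
set g := gcdp pb sb; have g0 : g != 0 by rewrite gcdp_eq0 negb_and pb0.
pose h := pb %/ g; pose t := sb %/ g.
have eh : pb = h * g by rewrite divpK // dvdp_gcdl.
have et : sb = t * g by rewrite divpK // dvdp_gcdr.
have cop : coprimep h t by apply: coprimep_div_gcd; rewrite pb0.
have /closed_rootP[z hz] : size h != 1%N.
  apply: contra ndvd => /size_poly1P[c c0 ec].
  by rewrite eh et ec mul_polyC dvdpZl // dvdp_mull.
have tz : t.[z] != 0 by exact: coprimep_root hz.
have {}hz : h.[z] = 0 by apply/eqP.
have pz : pb.[z] = 0 by rewrite eh hornerM hz mul0r.
have gz : g.[z] = 0.
  have /dvdpP[r er] := pbsb; have := congr1 (horner^~ z) er.
  rewrite /= hornerM pz mulr0 horner_exp => /eqP; rewrite expf_eq0 => /andP[_].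
  by rewrite et hornerM mulf_eq0 (negPf tz) => /eqP.
have p'z : ev2 p^`() x z = 0.
  by rewrite /ev2 at_x_deriv -/pb eh derivM hornerD !hornerM gz hz !(mulr0, mul0r) addr0.
have dxp : ev2 (dx p) x z != 0 by apply/eqP => dx0; exact: (sm pz dx0 p'z).
have Ez : ev2 E x z != 0.
  apply: contraNneq dxp => E0; rewrite eE dxD dx_lift add0r dxM dxC ev2D !ev2M E0.
  by rewrite [ev2 X x z]/ev2 Xx horner0 mulr0 mul0r addr0.
have pz0 := smooth_horner_neq0 pz dxp.
have [k [g1]] := multiplicity_XsubC g z; rewrite g0 /= => g1z eg.
pose L := map_poly (@polyC K).
pose W := L t * E - s1 * L h.
have mod_s : p %| s * E - L g * W.
  apply/(mdvdP mon); exists s1; rewrite es [in RHS]eE et eh /W !rmorphM -/L /=; ring.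
have mod_X : p %| X * E - L g * (- L h).
  apply/(mdvdP mon); exists 1; rewrite [in RHS]eE eh rmorphM -/L /=; ring.
have : p %| (L g * W) ^+ n + \sum_(i < n) b i * (L g * W) ^+ i * (L g * - L h) ^+ (n - i).
  have hs' : p %| (s * E) ^+ n + \sum_(i < n) b i * (s * E) ^+ i * (X * E) ^+ (n - i).
    have -> : (s * E) ^+ n + \sum_(i < n) b i * (s * E) ^+ i * (X * E) ^+ (n - i)
      = E ^+ n * (s ^+ n + \sum_(i < n) b i * s ^+ i * X ^+ (n - i)).
      rewrite mulrDr exprMn [_ * E ^+ n]mulrC mulr_sumr; congr (_ + _).
      apply: eq_bigr => i _; rewrite !exprMn (exp_split i E); ring.
    by rewrite dvdp_mull.
  apply: mod_trans hs'; apply: modD; first exact: modX.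
  apply: mod_sum => i; apply: modM; last exact: modX.
  apply: modM; first by rewrite subrr dvdp0.
  exact: modX.
have -> : (L g * W) ^+ n + \sum_(i < n) b i * (L g * W) ^+ i * (L g * - L h) ^+ (n - i)
  = ('X - z%:P%:P) ^+ (k * n) *
    (L g1 ^+ n * (W ^+ n + \sum_(i < n) b i * W ^+ i * (- L h) ^+ (n - i))).
  have -> : ('X - z%:P%:P) = L ('X - z%:P) :> {poly {poly K}}.
    by rewrite /L rmorphB /= map_polyX map_polyC.
  rewrite exprM mulrA -exprMn -rmorphXn -rmorphM /= [_ * g1]mulrC -eg -/(L g).
  move: W (L g) (L h) {mod_s mod_X} => w a c.
  rewrite mulrDr exprMn mulr_sumr; congr (_ + _).
  apply: eq_bigr => i _; rewrite !exprMn (exp_split i a); ring.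
move/(cancel_XsubCn mon pz0) => /(mdvdP mon)[q /(congr1 (fun G => ev2 G x z))].
have -> : ev2 (q * p) x z = 0 by rewrite ev2M -/(ev2 p x z) [ev2 p x z]pz mulr0.
have evL (f : {poly K}) : ev2 (L f) x z = f.[z] by rewrite /ev2 at_x_lift.
rewrite ev2M ev2X evL ev2D ev2_sum big1 => [|i _]; last first.
  have h0 : ev2 (- L h) x z = 0 by rewrite -mulN1r ev2M evL hz mulr0.
  by rewrite ev2M [ev2 (_ ^+ (n - i)) _ _]ev2X h0 expr0n subn_eq0 leqNgt ltn_ord mulr0.
rewrite addr0 ev2X ev2B !ev2M !evL hz mulr0 subr0 => /eqP.
rewrite mulf_eq0 !expf_eq0 mulf_eq0 (negPf tz) (negPf Ez) andbF orbF.
by rewrite -rootE (negPf g1z) andbF.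
Qed.

(** Integral closedness of K[x][z] / (p), by induction on the degree of the
    denominator [d]. *)
Theorem normality n (b : nat -> {poly {poly K}}) s d : d != 0 ->
  p %| s ^+ n + \sum_(i < n) b i * s ^+ i * d%:P ^+ (n - i) ->
  exists t, p %| s - d%:P * t.
Proof.
have [m] := ubnP (size d); elim: m => // m IH in b s d * => lt d0 hs.
have [/eqP/size_poly1P[c c0 ec]|/closed_rootP[x]] := eqVneq (size d) 1%N.
  exists (c^-1%:P%:P * s); rewrite ec mulrA -!polyCM divff // mul1r subrr dvdp0 //.
case/factor_theorem=> d' ed; set X := 'X - x%:P in ed.
have d'0 : d' != 0 by apply: contraNneq d0 => e; rewrite ed e mul0r.
have X0 : X != 0 by rewrite polyXsubC_eq0.
have [s' hs'] : exists s', p %| s - X%:P * s'.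
  apply: (@normality_step n (fun i => b i * d'%:P ^+ (n - i))).
  suff <- : \sum_(i < n) b i * s ^+ i * d%:P ^+ (n - i) =
    \sum_(i < n) b i * d'%:P ^+ (n - i) * s ^+ i * X%:P ^+ (n - i) by [].
  by apply: eq_bigr => i _; rewrite ed polyCM exprMn; ring.
have {}hs : p %| s' ^+ n + \sum_(i < n) b i * s' ^+ i * d'%:P ^+ (n - i).
  apply: (@cancel_const _ _ mon (X ^+ n)); first by rewrite expf_neq0.
  suff -> : (X ^+ n)%:P * (s' ^+ n + \sum_(i < n) b i * s' ^+ i * d'%:P ^+ (n - i))
    = (X%:P * s') ^+ n + \sum_(i < n) b i * (X%:P * s') ^+ i * d%:P ^+ (n - i).
    apply: mod_trans hs; apply: modD; first exact: modX.
    apply: mod_sum => i; apply: modM; last by rewrite subrr dvdp0.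
    apply: modM; first by rewrite subrr dvdp0.
    exact: modX.
  rewrite mulrDr rmorphXn exprMn mulr_sumr; congr (_ + _).
  apply: eq_bigr => i _; rewrite ed polyCM !exprMn.
  rewrite (exp_split i X%:P); ring.
have [|t ht] := IH b s' d' _ d'0 hs.
  by rewrite -ltnS (leq_trans _ lt) // ed size_Mmonic ?monicXsubC // size_XsubC addn2.
exists t; have -> : s - d%:P * t = (s - X%:P * s') + X%:P * (s' - d'%:P * t).
  by rewrite ed polyCM; ring.
by rewrite dvdp_add // dvdp_mull.
Qed.

End Step.
End Normality.

(** * Substitution in multivariate polynomials *)

Section Subst.
Variables (n : nat) (K : comNzRingType).

(** Induction over the construction of a polynomial, suited to statements on
    ring morphisms and derivations. *)
Lemma mpoly_closed (Q : {mpoly K[n]} -> Prop) :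
  (forall c, Q c%:MP) -> (forall i, Q 'X_i) ->
  (forall p q, Q p -> Q q -> Q (p + q)) -> (forall p q, Q p -> Q q -> Q (p * q)) ->
  forall p, Q p.
Proof.
move=> QC QX QD QM; elim/mpolyind => [|c m p _ _ IH]; first by rewrite -mpolyC0.
apply: (QD _ _ _ IH); rewrite -mul_mpolyC; apply: (QM) => //.
rewrite mpolyXE_id; apply: (big_ind Q) => [||i _]; [by rewrite -mpolyC1|exact: (QM)|].
by elim: (m i) => [|k IHk]; rewrite ?expr0 -?mpolyC1 // exprS; apply: (QM).
Qed.

Section Target.
Variables (S : comNzRingType) (f : {rmorphism K -> S}).
Implicit Types (h : 'I_n -> S).

Lemma mmap_comp (T : comNzRingType) (g : {rmorphism S -> T}) (f' : {rmorphism K -> T}) h (h' : 'I_n -> T)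
    (F : {mpoly K[n]}) :
  (forall c, g (f c) = f' c) -> (forall i, g (h i) = h' i) -> g (mmap f h F) = mmap f' h' F.
Proof.
move=> ef eh; elim/mpoly_closed: F => [c|i|p q Ep Eq|p q Ep Eq].
- by rewrite !mmapC ef.
- by rewrite !mmapX !mmap1U eh.
- by rewrite !rmorphD Ep Eq.
- by rewrite !rmorphM Ep Eq.
Qed.

Lemma mmap_ext h h' (F : {mpoly K[n]}) : h =1 h' -> mmap f h F = mmap f h' F.
Proof. by move=> e; rewrite /mmap; apply: eq_bigr => m _; rewrite (mmap1_eq _ e). Qed.

(** The chain rule, for all derivations that kill the coefficients. *)
Lemma mmap_derivation (D : {additive S -> S}) h (F : {mpoly K[n]}) :
  (forall a b, D (a * b) = D a * b + a * D b) -> (forall c, D (f c) = 0) ->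
  D (mmap f h F) = \sum_i mmap f h F^`M(i) * D (h i).
Proof.
move=> DM DC; elim/mpoly_closed: F => [c|j|p q Ep Eq|p q Ep Eq].
- by rewrite mmapC DC big1 // => i _; rewrite mderivC mmap0 mul0r.
- rewrite mmapX mmap1U (bigD1 j) //= big1 => [|i ij]; last first.
    by rewrite mderivX mnm1E eq_sym (negPf ij) scale0r mmap0 mul0r.
  have e0 : (U_(j) - U_(j))%MM = 0%MM :> 'X_{1..n}.
    by apply/mnmP=> k; rewrite mnmBE subnn mnm0E.
  by rewrite mderivX mnm1E eqxx scale1r e0 mmapX mmap11 mul1r addr0.
- rewrite rmorphD raddfD Ep Eq -big_split /=; apply: eq_bigr => i _.
  by rewrite mderivD rmorphD mulrDl.
- rewrite rmorphM DM Ep Eq mulr_suml mulr_sumr -big_split /=; apply: eq_bigr => i _.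
  by rewrite mderivM rmorphD !rmorphM; ring.
Qed.

Lemma mmap_homog d (F : {mpoly K[n]}) h (c : S) : F \is d.-homog ->
  mmap f (fun i => c * h i) F = c ^+ d * mmap f h F.
Proof.
move=> hF; rewrite /mmap mulr_sumr; apply: eq_big_seq => m mF.
rewrite /mmap1 [in RHS]mulrCA; congr (_ * _).
under eq_bigr do rewrite exprMn.
rewrite big_split /= -expr_sum; congr (c ^+ _ * _).
by rewrite -mdegE (dhomog_mf hF mF).
Qed.

(** This keeps track of leading terms without asking that they be nonzero,
    which makes it stable under products. *)
Definition topc d (q : {poly S}) c := (size q <= d.+1)%N /\ q`_d = c.

Lemma topcM d e p q a b : topc d p a -> topc e q b -> topc (d + e) (p * q) (a * b).
Proof.
move=> [sp <-] [sq <-]; split.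
  apply: leq_trans (size_polyMleq _ _) _.
  by rewrite -subn1 leq_subLR add1n (leq_trans (leq_add sp sq)) // addnS.
rewrite coefM (bigD1 (inord d)) //= inordK ?ltnS ?leq_addr // addKn.
rewrite big1 ?addr0 // => i; rewrite -val_eqE /= inordK ?ltnS ?leq_addr // => ne.
have [lt|gt|e0] := ltngtP i d; last by rewrite e0 eqxx in ne.
  rewrite [q`_ _]nth_default ?mulr0 // (leq_trans sq) //.
  by rewrite -addnBAC ?(ltnW lt) // -[e.+1]add1n leq_add2r subn_gt0.
by rewrite nth_default ?mul0r // (leq_trans sp).
Qed.

Lemma topcX d p a k : topc d p a -> topc (d * k) (p ^+ k) (a ^+ k).
Proof.
move=> h; elim: k => [|k IH].
  by rewrite muln0 !expr0; split; rewrite ?size_poly1 ?coef1.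
by rewrite mulnS !exprS; apply: topcM.
Qed.

Lemma topc_mmap1 (a b : 'I_n -> S) (m : 'X_{1..n}) :
  topc (mdeg m) (mmap1 (fun i => (a i)%:P + (b i)%:P * 'X) m) (mmap1 b m).
Proof.
rewrite mdegE /mmap1; apply: (big_ind3 topc) => [||i _].
- by split; rewrite ?size_poly1 ?coef1.
- by move=> ? ? ? ? ? ?; apply: topcM.
rewrite -[X in topc X]mul1n; apply: topcX; split.
  apply: leq_trans (size_polyD _ _) _; rewrite geq_max.
  rewrite (leq_trans (size_polyC_leq1 _)) // mul_polyC (leq_trans (size_scale_leq _ _)) //.
  by rewrite size_polyX.
by rewrite coefD coefC coefCM coefX mulr1 add0r.
Qed.

(** Restricting a form to the line [a + b X] gives a polynomial whose leading
    coefficient is the value of the form at [b]. *)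
Lemma topc_mmap d (F : {mpoly K[n]}) (a b : 'I_n -> S) : F \is d.-homog ->
  topc d (mmap (polyC \o f) (fun i => (a i)%:P + (b i)%:P * 'X) F) (mmap f b F).
Proof.
move=> hF; have ht m : m \in msupp F -> topc d
   ((polyC \o f) F@_m * mmap1 (fun i => (a i)%:P + (b i)%:P * 'X) m) (f F@_m * mmap1 b m).
  move=> mF; have -> : d = (0 + mdeg m)%N by rewrite add0n -(dhomog_mf hF mF).
  apply: topcM (topc_mmap1 _ _ _).
  by split; rewrite /= ?coefC // size_polyC_leq1.
rewrite /mmap big_seq [X in topc _ _ X]big_seq.
apply: (big_ind2 (topc d)) => //.
- by split; rewrite ?size_poly0 ?coef0.
- move=> p1 a1 p2 a2 [s1 <-] [s2 <-]; split; last by rewrite coefD.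
  by rewrite (leq_trans (size_polyD _ _)) // geq_max s1.
Qed.

End Target.
End Subst.

(** * Coordinates and differentials in three variables *)

Notation i0 := (0 : 'I_3).
Notation i1 := (1 : 'I_3).
Notation i2 := (2%:R : 'I_3).

Lemma ord3_ind (Q : 'I_3 -> Prop) : Q i0 -> Q i1 -> Q i2 -> forall i, Q i.
Proof.
move=> q0 q1 q2 [[|[|[|//]]] h].
- by rewrite (_ : Ordinal h = i0) //; apply: val_inj.
- by rewrite (_ : Ordinal h = i1) //; apply: val_inj.
- by rewrite (_ : Ordinal h = i2) //; apply: val_inj.
Qed.

Lemma sum3 (V : nmodType) (f : 'I_3 -> V) : \sum_i f i = f i0 + f i1 + f i2.
Proof.
rewrite !big_ord_recl big_ord0 addr0 addrA.
by congr (f _ + f _ + f _); apply: val_inj.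
Qed.

(** The default value of [nth] is the last coordinate, which makes the three
    coordinates compute. *)
Definition pt (R : Type) (x y z : R) : 'rV[R]_3 := \row_i nth z [:: x; y] i.

Section Pt.
Variable R : comNzRingType.
Implicit Types (x y z : R) (M : 'M[R]_3).

Lemma pt0 x y z : pt x y z 0 i0 = x. Proof. by rewrite mxE. Qed.
Lemma pt1 x y z : pt x y z 0 i1 = y. Proof. by rewrite mxE. Qed.
Lemma pt2 x y z : pt x y z 0 i2 = z. Proof. by rewrite mxE. Qed.
Lemma pt_eta (v : 'rV[R]_3) : v = pt (v 0 i0) (v 0 i1) (v 0 i2).
Proof. by apply/rowP; apply: ord3_ind; rewrite ?pt0 ?pt1 ?pt2. Qed.
Lemma pt_add x y z x' y' z' : pt x y z + pt x' y' z' = pt (x + x') (y + y') (z + z').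
Proof. by rewrite [LHS]pt_eta !mxE. Qed.
Lemma pt_scale c x y z : c *: pt x y z = pt (c * x) (c * y) (c * z).
Proof. by rewrite [LHS]pt_eta !mxE. Qed.
Lemma pt_mulmx x y z M :
  pt x y z *m M = x *: row i0 M + y *: row i1 M + z *: row i2 M.
Proof. by apply/rowP => i; rewrite !mxE sum3 pt0 pt1 pt2. Qed.
Lemma pt_mulmxE x y z M i : (pt x y z *m M) 0 i = x * M i0 i + y * M i1 i + z * M i2 i.
Proof. by rewrite pt_mulmx !mxE. Qed.
Lemma pt001 M : pt 0 0 1 *m M = row i2 M.
Proof. by rewrite pt_mulmx !scale0r !add0r scale1r. Qed.
Lemma pt010 M : pt 0 1 0 *m M = row i1 M.
Proof. by rewrite pt_mulmx !scale0r add0r addr0 scale1r. Qed.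
Lemma pt100 M : pt 1 0 0 *m M = row i0 M.
Proof. by rewrite pt_mulmx !scale0r !addr0 scale1r. Qed.
End Pt.

Lemma coord_ex (K : fieldType) (M : 'M[K]_3) v : M \in unitmx ->
  exists x y z, v = pt x y z *m M.
Proof.
move=> Mu; exists ((v *m invmx M) 0 i0), ((v *m invmx M) 0 i1), ((v *m invmx M) 0 i2).
by rewrite -pt_eta mulmxKV.
Qed.

Lemma mulmx_unit_eq0 (K : fieldType) (M : 'M[K]_3) (v : 'rV_3) : M \in unitmx ->
  (v *m M == 0) = (v == 0).
Proof.
move=> Mu; apply/eqP/eqP=> [h|->]; last by rewrite mul0mx.
by rewrite -(mulmxK Mu v) h mul0mx.
Qed.

Lemma pt_eq0 (K : fieldType) (x y z : K) : (pt x y z == 0) = [&& x == 0, y == 0 & z == 0].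
Proof.
apply/eqP/and3P => [h|[/eqP-> /eqP-> /eqP->]].
  have := pt0 x y z; have := pt1 x y z; have := pt2 x y z.
  by rewrite h !mxE => <- <- <-.
by rewrite [RHS]pt_eta !mxE.
Qed.

Section Diff.
Variables (K : comNzRingType).
Implicit Types (F : {mpoly K[3]}) (v w : 'rV[K]_3).

(** The differential of [F] at [v], applied to the tangent vector [w]. *)
Definition dform F v w : K := \sum_i (F^`M(i)).@[v 0] * w 0 i.

Lemma dformD F v w w' : dform F v (w + w') = dform F v w + dform F v w'.
Proof. by rewrite -big_split /=; apply: eq_bigr => i _; rewrite mxE mulrDr. Qed.
Lemma dformZ F v c w : dform F v (c *: w) = c * dform F v w.
Proof. by rewrite mulr_sumr; apply: eq_bigr => i _; rewrite mxE mulrCA. Qed.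

Definition line v w F : {poly K} :=
  mmap polyC (fun i => (v 0 i)%:P + (w 0 i)%:P * 'X) F.

Lemma line_horner v w F t : (line v w F).[t] = F.@[(v + t *: w) 0].
Proof.
rewrite -[LHS]/(horner_eval t (line v w F)) /line /meval.
apply: mmap_comp => [c|i] /=; rewrite /horner_eval ?hornerC //.
by rewrite !mxE !hornerE mulrC.
Qed.

Lemma line_deriv v w F t : (line v w F)^`().[t] = dform F (v + t *: w) w.
Proof.
rewrite /line (@mmap_derivation _ _ _ _ (@deriv K)); [|exact: derivM|exact: derivC].
rewrite horner_sum; apply: eq_bigr => i _; rewrite -[mmap _ _ _]/(line v w _) hornerM line_horner.
by rewrite /= derivD derivM !derivC derivX mul0r !add0r mulr1 hornerC.
Qed.

Lemma line_top d v w F : F \is d.-homog ->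
  (size (line v w F) <= d.+1)%N /\ (line v w F)`_d = F.@[w 0].
Proof.
move=> hF; have := @topc_mmap _ _ _ (idfun : {rmorphism K -> K}) d F (v 0) (w 0) hF.
by [].
Qed.

Lemma meval_homog d F c v : F \is d.-homog -> F.@[(c *: v) 0] = c ^+ d * F.@[v 0].
Proof.
move=> hF; rewrite /meval -(@mmap_homog _ _ _ (idfun : {rmorphism K -> K}) _ _ _ _ hF).
by apply: mmap_ext => i; rewrite mxE.
Qed.

(** Euler's relation, read off from [F ((1 + t) v) = (1 + t)^d F v]. *)
Lemma euler d F v : F \is d.-homog -> dform F v v = d%:R * F.@[v 0].
Proof.
move=> hF; have := line_deriv v v F 0; rewrite scale0r addr0 => <-.
have -> : line v v F = (1 + 'X) ^+ d * (F.@[v 0])%:P.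
  have -> : (F.@[v 0])%:P = mmap polyC (fun i => (v 0 i)%:P) F.
    by rewrite /meval; apply: mmap_comp.
  rewrite -(mmap_homog _ _ _ hF); apply: mmap_ext => i /=.
  by rewrite mulrDl mul1r mulrC.
rewrite derivM derivC mulr0 addr0 deriv_exp derivD derivC derivX add0r mul1r.
by rewrite hornerM hornerC hornerMn horner_exp !hornerE expr1n.
Qed.

End Diff.

(** * Affine charts of a plane curve *)

Section Chart.
Variable K : closedFieldType.
Implicit Types (F G : {mpoly K[3]}) (M : 'M[K]_3) (X Y : {poly K}) (x y z : K).

(** The form [F] at the point of coordinates [(X, Y, z)] in the basis of rows
    of [M], where [X] and [Y] are polynomials in a first variable and [z] is
    the second variable.  The two affine charts are given by [(x, 1)] and [(1,
    x)]. *)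
Definition chart X Y M F : {poly {poly K}} :=
  mmap (polyC \o polyC) (fun i => (X * (M i0 i)%:P + Y * (M i1 i)%:P)%:P
                                  + (M i2 i)%:P%:P * 'X) F.

Lemma ev_chart X Y M F x z : ev2 (chart X Y M F) x z = F.@[(pt X.[x] Y.[x] z *m M) 0].
Proof.
rewrite -[LHS]/((horner_eval z \o map_poly (horner_eval x)) (chart X Y M F)).
rewrite /chart /meval; apply: mmap_comp => [c|i] /=.
  by rewrite -[LHS]/(ev2 c%:P%:P x z) ev2C hornerC.
rewrite -[horner_eval z _]/(ev2 _ x z) ev2D ev2M !ev2C ev2_varz !hornerE pt_mulmxE.
by rewrite [z * _]mulrC.
Qed.

Lemma chart_top d X Y M F : F \is d.-homog ->
  (size (chart X Y M F) <= d.+1)%N /\ (chart X Y M F)`_d = (F.@[(row i2 M) 0])%:P.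
Proof.
move=> hF.
have [h1 h2] := @topc_mmap _ _ _ (polyC : {rmorphism K -> {poly K}}) d F
   (fun i => X * (M i0 i)%:P + Y * (M i1 i)%:P) (fun i => (M i2 i)%:P) hF.
split => //; rewrite [LHS]h2 /meval; symmetry.
by apply: mmap_comp => // i; rewrite mxE.
Qed.

Lemma ev_chart_dz X Y M F x z :
  ev2 (chart X Y M F)^`() x z = dform F (pt X.[x] Y.[x] z *m M) (row i2 M).
Proof.
rewrite /chart (@mmap_derivation _ _ _ _ (@deriv _)); [|exact: derivM|by move=> c; exact: derivC].
rewrite ev2_sum; apply: eq_bigr => i _; rewrite -[mmap _ _ _]/(chart X Y M _) ev2M ev_chart.
by rewrite /= derivD derivM !derivC derivX mul0r !add0r mulr1 ev2C hornerC mxE.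
Qed.

Lemma ev_chart_dx X Y M F x z :
  ev2 (dx (chart X Y M F)) x z =
  dform F (pt X.[x] Y.[x] z *m M) (X^`().[x] *: row i0 M + Y^`().[x] *: row i1 M).
Proof.
pose D : {additive {poly {poly K}} -> {poly {poly K}}} := map_poly (@deriv K).
rewrite -[dx _]/(D (chart X Y M F)) /chart (@mmap_derivation _ _ _ _ D); [|exact: dxM|]; last first.
  by move=> c; rewrite -[D _]/(dx _) dxC derivC.
rewrite ev2_sum; apply: eq_bigr => i _; rewrite -[mmap _ _ _]/(chart X Y M _) ev2M ev_chart.
have dX : dx 'X = 0 :> {poly {poly K}} by rewrite -(dx_lift 'X) map_polyX.
rewrite -[D _]/(dx _) dxD dxM !dxC derivC dX polyC0 mul0r mulr0 !addr0 ev2C.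
by rewrite derivD !derivM !derivC !mulr0 !addr0 !hornerE !mxE.
Qed.

Section Smooth.
Variables (d : nat) (F : {mpoly K[3]}) (M : 'M[K]_3).
Hypotheses (hF : F \is d.-homog) (smF : smooth_curve F) (Mu : M \in unitmx).

(** At a smooth point the differential is nonzero, so it is nonzero on some
    vector of any basis. *)
Lemma dform_basis_eq0 (v : 'rV[K]_3) : v != 0 -> F.@[v 0] = 0 ->
  ~ [/\ dform F v (row i0 M) = 0, dform F v (row i1 M) = 0 & dform F v (row i2 M) = 0].
Proof.
move=> v0 Fv [h0 h1 h2]; have [i] := smF (conj v0 Fv); apply/negP; rewrite negbK.
have <- : dform F v (delta_mx 0 i) = (F^`M(i)).@[v 0].
  rewrite /dform (bigD1 i) //= mxE !eqxx mulr1 big1 ?addr0 // => j ji.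
  by rewrite mxE (negPf ji) andbF mulr0.
have [x [y [z ->]]] := coord_ex (delta_mx 0 i) Mu.
by rewrite pt_mulmx !dformD !dformZ h0 h1 h2 !mulr0 !addr0.
Qed.

(** The chart gives two of the three partial derivatives in the basis [M]; the
    third one follows from Euler's relation. *)
Lemma smooth_chart1 : smooth2 (chart 'X 1 M F).
Proof.
move=> x z; rewrite ev_chart ev_chart_dx ev_chart_dz !derivE horner0 scale0r addr0 !hornerE scale1r.
set v := pt x 1 z *m M => Fv h0 h2.
apply: (@dform_basis_eq0 v) => //; first by rewrite mulmx_unit_eq0 // pt_eq0 oner_eq0 andbF.
split => //; have := euler v hF; rewrite Fv mulr0 {2}/v pt_mulmx !dformD !dformZ h0 h2.
by rewrite !mulr0 addr0 add0r mul1r.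
Qed.

Lemma smooth_chart2 : smooth2 (chart 1 'X M F).
Proof.
move=> x z; rewrite ev_chart ev_chart_dx ev_chart_dz !derivE horner0 scale0r add0r !hornerE scale1r.
set v := pt 1 x z *m M => Fv h0 h2.
apply: (@dform_basis_eq0 v) => //; first by rewrite mulmx_unit_eq0 // pt_eq0 oner_eq0.
split => //; have := euler v hF; rewrite Fv mulr0 {2}/v pt_mulmx !dformD !dformZ h0 h2.
by rewrite !mulr0 !addr0 mul1r.
Qed.

Hypothesis FP1 : F.@[(row i2 M) 0] = 1.

Lemma monic_chart X Y : chart X Y M F \is monic /\ size (chart X Y M F) = d.+1.
Proof.
have [h1 h2] := chart_top X Y M hF; rewrite FP1 in h2.
have sz : size (chart X Y M F) = d.+1.
  apply/eqP; rewrite eqn_leq h1 /= ltnNge; apply/negP => h.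
  by move/eqP: h2; rewrite nth_default // eq_sym oner_eq0.
by split=> //; rewrite monicE lead_coefE sz h2.
Qed.

End Smooth.

End Chart.

(** * Functions without poles: the degree bound *)

Section Homogenize.
Variable K : closedFieldType.
Implicit Types t : {poly {poly K}}.

(** The polynomial [y^N t(1/y, z/y)], which expresses the function [t] of the
    first chart in the second one. *)
Definition flip N (t : {poly {poly K}}) : {poly {poly K}} :=
  \poly_(i < size t) \poly_(j < (N - i).+1) t`_i`_(N - i - j).

Lemma coef_flip N t i j : (forall i j, t`_i`_j != 0 -> (i + j <= N)%N) ->
  (i + j <= N)%N -> (flip N t)`_i`_j = t`_i`_(N - i - j).
Proof.
move=> deg le; rewrite coef_poly; case: ltnP => h.
  by rewrite coef_poly ltnS leq_subRL ?le // (leq_trans _ le) ?leq_addr.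
by rewrite [t`_i]nth_default // !coef0.
Qed.

Lemma ev_flip N t y z : y != 0 -> (forall i j, t`_i`_j != 0 -> (i + j <= N)%N) ->
  ev2 (flip N t) y z = y ^+ N * ev2 t y^-1 (z / y).
Proof.
move=> y0 deg; rewrite !ev2_horner /flip horner_poly horner_sum.
rewrite (horner_coef t) horner_sum mulr_sumr; apply: eq_bigr => i _.
rewrite !hornerM -!rmorphXn /= !hornerC exprMn.
have [hi|hi] := leqP i N; last first.
  have -> : t`_i = 0.
    apply/polyP => j; rewrite coef0; apply/eqP; apply: contraT => /deg; lia.
  rewrite (_ : \poly_(j < _) _ = 0) ?horner0 ?mul0r ?mulr0 //.
  by apply/polyP=> j; rewrite coef_poly !coef0 if_same.
suff -> : (\poly_(j < (N - i).+1) t`_i`_(N - i - j)).[y] = y ^+ (N - i) * (t`_i).[y^-1].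
  have -> : y ^+ N = y ^+ (N - i) * y ^+ i by rewrite -exprD subnK.
  by rewrite exprVn; field; rewrite expf_neq0.
rewrite horner_poly (reindex_inj rev_ord_inj) /=.
rewrite (@horner_coef_wide _ (N - i).+1); last first.
  apply/leq_sizeP => j hj; apply/eqP; apply: contraT => /deg; move: (nat_of_ord i) hi hj => k; lia.
rewrite mulr_sumr; apply: eq_bigr => j _; rewrite subSS.
have hj : (j <= N - i)%N by rewrite -ltnS.
have -> : y ^+ (N - i) = y ^+ (N - i - j) * y ^+ j by rewrite -exprD subnK.
by rewrite subKn // exprVn; field; rewrite expf_neq0.
Qed.
End Homogenize.

Section Curve.
Variable K : closedFieldType.
Hypothesis charK0 : [pchar K] =i pred0.
Variables (d : nat) (F : {mpoly K[3]}) (M : 'M[K]_3).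
Hypotheses (hF : F \is d.-homog) (smF : smooth_curve F) (Mu : M \in unitmx).
Hypothesis FP1 : F.@[(row i2 M) 0] = 1.
Implicit Types (G : {mpoly K[3]}) (x y z : K) (t : {poly {poly K}}).

Definition p1 := chart 'X 1 M F.
Definition p2 := chart 1 'X M F.

Lemma p1_monic : p1 \is monic. Proof. exact: (monic_chart hF FP1 _ _).1. Qed.
Lemma p2_monic : p2 \is monic. Proof. exact: (monic_chart hF FP1 _ _).1. Qed.
Lemma size_p1 : size p1 = d.+1. Proof. exact: (monic_chart hF FP1 _ _).2. Qed.
Lemma size_p2 : size p2 = d.+1. Proof. exact: (monic_chart hF FP1 _ _).2. Qed.
Lemma p1_smooth : smooth2 p1. Proof. exact: smooth_chart1 hF smF Mu. Qed.
Lemma p2_smooth : smooth2 p2. Proof. exact: smooth_chart2 hF smF Mu. Qed.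

Lemma ev_p1 x z : ev2 p1 x z = F.@[(pt x 1 z *m M) 0].
Proof. by rewrite ev_chart hornerX hornerC. Qed.
Lemma ev_p2 y z : ev2 p2 y z = F.@[(pt 1 y z *m M) 0].
Proof. by rewrite ev_chart hornerX hornerC. Qed.

Lemma vanish1 H (e : {poly K}) : e != 0 ->
  (forall x z, e.[x] != 0 -> F.@[(pt x 1 z *m M) 0] = 0 -> ev2 H x z = 0) -> p1 %| H.
Proof.
move=> e0 h; apply: (vanish_dvdp charK0 p1_monic p1_smooth e0) => x z ex.
by rewrite ev_p1; exact: h.
Qed.

Lemma vanish2 H (e : {poly K}) : e != 0 ->
  (forall y z, e.[y] != 0 -> F.@[(pt 1 y z *m M) 0] = 0 -> ev2 H y z = 0) -> p2 %| H.
Proof.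
move=> e0 h; apply: (vanish_dvdp charK0 p2_monic p2_smooth e0) => x z ex.
by rewrite ev_p2; exact: h.
Qed.

Lemma dvd_ev1 H x z : p1 %| H -> F.@[(pt x 1 z *m M) 0] = 0 -> ev2 H x z = 0.
Proof. by case/(mdvdP p1_monic) => q ->; rewrite ev2M ev_p1 => ->; rewrite mulr0. Qed.

Lemma dvd_ev2 H y z : p2 %| H -> F.@[(pt 1 y z *m M) 0] = 0 -> ev2 H y z = 0.
Proof. by case/(mdvdP p2_monic) => q ->; rewrite ev2M ev_p2 => ->; rewrite mulr0. Qed.

Lemma homog_pt1 e G a b c : G \is e.-homog -> b != 0 ->
  G.@[(pt a b c *m M) 0] = b ^+ e * G.@[(pt (a / b) 1 (c / b) *m M) 0].
Proof.
move=> hG b0; rewrite -(meval_homog _ _ hG) scalemxAl pt_scale mulr1.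
by rewrite ![b * _]mulrC !divfK.
Qed.

Lemma homog_pt2 e G a b c : G \is e.-homog -> a != 0 ->
  G.@[(pt a b c *m M) 0] = a ^+ e * G.@[(pt 1 (b / a) (c / a) *m M) 0].
Proof.
move=> hG b0; rewrite -(meval_homog _ _ hG) scalemxAl pt_scale mulr1.
by rewrite ![a * _]mulrC !divfK.
Qed.

(** The line left out by the chart meets the curve in finitely many points,
    since it passes through the point [row i2 M] off the curve; in the second
    chart these lie on [y = 0], and [vanish_dvdp] allows to leave this line
    out. *)
Lemma density e G : G \is e.-homog ->
  (forall x z, F.@[(pt x 1 z *m M) 0] = 0 -> G.@[(pt x 1 z *m M) 0] = 0) ->
  forall v, on_curve F v -> G.@[v 0] = 0.
Proof.
move=> hG h v; have [x [y [z ->]]] := coord_ex v Mu.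
move=> [v0 Fv]; have aff a b c : b != 0 -> F.@[(pt a b c *m M) 0] = 0 -> G.@[(pt a b c *m M) 0] = 0.
  move=> b0; rewrite (homog_pt1 _ _ hF b0) (homog_pt1 _ _ hG b0) => /eqP.
  by rewrite mulf_eq0 expf_eq0 (negPf b0) andbF => /eqP/h ->; rewrite mulr0.
have [y0|y0] := eqVneq y 0; last exact: aff.
have x0 : x != 0.
  apply: contraTneq v0 => x0; rewrite negbK mulmx_unit_eq0 // x0 y0 pt_eq0 eqxx /=.
  have e0 : pt 0 0 z = z *: pt 0 0 1 by rewrite pt_scale !mulr0 mulr1.
  move/eqP: Fv; rewrite x0 y0 e0 -scalemxAl (meval_homog _ _ hF) pt001 FP1 mulr1.
  by rewrite expf_eq0 => /andP[].
rewrite y0 in Fv *; have dG : p2 %| chart 1 'X M G.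
  apply: (@vanish2 _ 'X); first by rewrite polyX_eq0.
  by move=> b c; rewrite hornerX => b0 Fb; rewrite ev_chart hornerX hornerC; apply: aff.
rewrite (homog_pt2 _ _ hG x0) mul0r; move: Fv; rewrite (homog_pt2 _ _ hF x0) mul0r => /eqP.
rewrite mulf_eq0 expf_eq0 (negPf x0) andbF /= => /eqP Fv.
by have := dvd_ev2 dG Fv; rewrite ev_chart hornerX hornerC => ->; rewrite mulr0.
Qed.

(** The integral equation says that [y^r t] is integral over the second chart;
    by [normality] it is a polynomial there.  Hence [flip N t] is divisible by
    [y^(N - r)] modulo [p2], and exactly so because both sides have degree less
    than [d] in [z].  This means that no monomial of [t] has total degree more
    than [r]. *)
Lemma degree_bound r n N t (b : nat -> {poly {poly K}}) : (size t <= d)%N -> (r <= N)%N ->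
  (forall i j, t`_i`_j != 0 -> (i + j <= N)%N) ->
  (forall y z, y != 0 -> F.@[(pt 1 y z *m M) 0] = 0 ->
     ev2 (flip N t ^+ n + \sum_(i < n) b i * flip N t ^+ i * ('X ^+ (N - r))%:P ^+ (n - i)) y z = 0) ->
  forall i j, t`_i`_j != 0 -> (i + j <= r)%N.
Proof.
move=> st rN deg h.
have X0 : 'X ^+ (N - r) != 0 :> {poly K} by rewrite expf_neq0 // polyX_eq0.
have sf : (size (flip N t) <= d)%N by rewrite (leq_trans (size_poly _ _)).
have /(normality p2_monic p2_smooth X0) : p2 %| flip N t ^+ n + \sum_(i < n) b i * flip N t ^+ i * ('X ^+ (N - r))%:P ^+ (n - i).
  apply: (@vanish2 _ 'X); first by rewrite polyX_eq0.
  by move=> y z; rewrite hornerX; apply: h.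
case=> s; have [q [u [eu su]]] := mdiv p2_monic s => hs.
have e1 : flip N t = ('X ^+ (N - r))%:P * u.
  apply/eqP; rewrite -subr_eq0; apply/eqP; apply: (dvd_small (p := p2)).
    have -> : flip N t - ('X ^+ (N - r))%:P * u =
       (flip N t - ('X ^+ (N - r))%:P * s) + ('X ^+ (N - r))%:P * q * p2 by rewrite eu; ring.
    by rewrite dvdp_add // dvdp_mull.
  rewrite size_p2 ltnS in su; rewrite size_p2 ltnS (leq_trans (size_polyD _ _)) // geq_max size_polyN sf /=.
  by rewrite size_Cmul.
move=> i j tij; have le := deg _ _ tij.
rewrite leqNgt; apply/negP => gt.
have := congr1 (fun p : {poly {poly K}} => p`_i`_(N - i - j)) e1.
rewrite /= coef_flip //; last by move: le; lia.
rewrite (_ : (N - i - (N - i - j) = j)%N); last by move: le; lia.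
rewrite coefCM coefXnM ifT; last by move: le gt; lia.
by move/eqP; rewrite (negPf tij).
Qed.

Lemma exists_degree t r : exists2 N, (r <= N)%N & forall i j, t`_i`_j != 0 -> (i + j <= N)%N.
Proof.
exists (r + (size t + \max_(i < size t) size (nth 0%R t i)))%N; first exact: leq_addr.
move=> i j h; rewrite (leq_trans _ (leq_addl _ _)) //.
have hi : (i < size t)%N.
  by rewrite ltnNge; apply: contra h => /(nth_default 0) ->; rewrite coef0.
have hj : (j < size (nth 0%R t i))%N by rewrite ltnNge; apply: contra h => /(nth_default 0) ->.
rewrite leq_add ?(ltnW hi) // (leq_trans (ltnW hj)) //.
exact: (leq_bigmax (Ordinal hi)).
Qed.

Lemma affine_swap y z : y != 0 -> F.@[(pt 1 y z *m M) 0] = 0 ->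
  F.@[(pt y^-1 1 (z / y) *m M) 0] = 0.
Proof.
move=> y0; rewrite (homog_pt1 _ _ hF y0) div1r => /eqP.
by rewrite mulf_eq0 expf_eq0 (negPf y0) andbF => /eqP.
Qed.

Lemma const_poly2 t : (forall i j, t`_i`_j != 0 -> (i + j <= 0)%N) -> t = (t`_0`_0)%:P%:P.
Proof.
move=> h; apply/polyP => i; apply/polyP => j; rewrite coefC.
have z : (0 < i + j)%N -> t`_i`_j = 0.
  by move=> lt; apply/eqP; apply: contraT => /h; rewrite leqNgt lt.
case: i z => [|i] z /=; last by rewrite z // coef0.
by rewrite coefC; case: j z => [|j] z //=; rewrite z.
Qed.

Lemma linear_poly2 t : (forall i j, t`_i`_j != 0 -> (i + j <= 1)%N) ->
  exists a b c, t = (b *: 'X + c%:P)%:P + a%:P%:P * 'X.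
Proof.
move=> h; exists t`_1`_0, t`_0`_1, t`_0`_0.
have z i j : (1 < i + j)%N -> t`_i`_j = 0.
  by move=> lt; apply/eqP; apply: contraT => /h; rewrite leqNgt lt.
apply/polyP => -[|[|i]]; apply/polyP => j; rewrite coefD coefC coefCM coefX /=.
- rewrite mulr0 addr0 coefD coefZ coefX coefC.
  by case: j => [|[|j]]; rewrite /= ?mulr0 ?mulr1 ?add0r ?addr0 // z.
- by rewrite add0r mulr1 coefC; case: j => [|j] //=; rewrite z.
- by rewrite add0r mulr0 coef0 z.
Qed.

(** An idempotent satisfies the integral equation [t^2 - t = 0] in both charts,
    so it has no pole, and [degree_bound] applies with [r = 0]. *)
Lemma idempotent_const t : (size t <= d)%N -> p1 %| t ^+ 2 - t -> exists c, t = c%:P%:P.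
Proof.
move=> st idt; have [N _ deg] := exists_degree t 0.
exists (t`_0`_0); apply: const_poly2.
apply: (@degree_bound 0 2 N t (fun i => if i == 1%N then -1 else 0) st (leq0n _) deg) => y z y0 Fv.
have := dvd_ev1 idt (affine_swap y0 Fv); rewrite ev2B ev2X => e.
rewrite !big_ord_recl big_ord0 /= mul0r mul0r add0r addr0 mulN1r expr1 subn0 mulNr.
rewrite ev2B ev2X ev2M ev2X ev2C hornerXn ev_flip // expr1.
move: (ev2 t _ _) e => a e; have -> : (y ^+ N * a) ^+ 2 - y ^+ N * a * y ^+ N =
  (y ^+ N) ^+ 2 * (a ^+ 2 - a) by ring.
by rewrite e mulr0.
Qed.

(** The equation of the curve, read as an integral equation for the last
    coordinate [w]. *)
Lemma form_expansion u y w : u != 0 ->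
  F.@[(pt u (u * y) w *m M) 0] =
  w ^+ d + \sum_(i < d) (p2`_i).[y] * w ^+ i * u ^+ (d - i).
Proof.
move=> u0; rewrite (homog_pt2 _ _ hF u0) mulrAC divff // mul1r -ev_p2 ev2_horner.
rewrite (@horner_coef_wide _ d.+1 p2) ?size_p2 // big_ord_recr /= hornerD horner_sum.
have [_ ->] := chart_top 1 'X M hF; rewrite FP1 mul1r -rmorphXn /= hornerC.
rewrite mulrDr addrC exprMn exprVn mulrCA divff ?expf_neq0 // mulr1 mulr_sumr; congr (_ + _).
apply: eq_bigr => i _; rewrite hornerM -rmorphXn /= hornerC exprMn exprVn.
have -> : u ^+ d = u ^+ (d - i) * u ^+ i by rewrite -exprD subnK // ltnW.
by field; rewrite expf_neq0.
Qed.

(** If [(x, 1, t)] lies on the curve whenever [(x, 1, z)] does, the equation of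
    the curve is an integral equation for [t], homogeneous of weight one;
    [degree_bound] then applies with [r = 1]. *)
Lemma integral_linear t : (size t <= d)%N ->
  (forall x z, F.@[(pt x 1 z *m M) 0] = 0 -> F.@[(pt x 1 (ev2 t x z) *m M) 0] = 0) ->
  exists a b c, t = (b *: 'X + c%:P)%:P + a%:P%:P * 'X.
Proof.
move=> st ht; have [N N1 deg] := exists_degree t 1.
apply: linear_poly2.
apply: (@degree_bound 1 d N t (fun i => (p2`_i)%:P) st N1 deg) => y z y0 Fv.
have u0 : y ^+ (N - 1) != 0 by rewrite expf_neq0.
have := form_expansion y (ev2 (flip N t) y z) u0.
have -> : ev2 (flip N t) y z ^+ d +
    \sum_(i < d) (p2`_i).[y] * ev2 (flip N t) y z ^+ i * (y ^+ (N - 1)) ^+ (d - i) =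
  ev2 (flip N t ^+ d + \sum_(i < d) (p2`_i)%:P * flip N t ^+ i * ('X^(N - 1))%:P ^+ (d - i)) y z.
  rewrite ev2D ev2X ev2_sum; congr (_ + _); apply: eq_bigr => i _.
  by rewrite !ev2M !ev2X !ev2C hornerXn.
move=> <-; rewrite ev_flip //.
have eN : y ^+ N = y ^+ (N - 1) * y by rewrite -exprSr subn1 prednK.
rewrite eN.
have -> : pt (y ^+ (N - 1)) (y ^+ (N - 1) * y) (y ^+ (N - 1) * y * ev2 t y^-1 (z / y)) =
  (y ^+ (N - 1) * y) *: pt y^-1 1 (ev2 t y^-1 (z / y)).
  by rewrite pt_scale mulr1 mulfK.
by rewrite -scalemxAl (meval_homog _ _ hF) (ht _ _ (affine_swap y0 Fv)) mulr0.
Qed.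

End Curve.

(** * Bases, and integrality of the curve *)

Section Basis.
Variable K : fieldType.
Implicit Types (v w A B P : 'rV[K]_3).

Definition mx3 A B P : 'M[K]_3 := \matrix_(i, j) (nth P [:: A; B] i) 0 j.

Lemma mx3_row0 A B P : row i0 (mx3 A B P) = A.
Proof. by apply/rowP => j; rewrite !mxE. Qed.
Lemma mx3_row1 A B P : row i1 (mx3 A B P) = B.
Proof. by apply/rowP => j; rewrite !mxE. Qed.
Lemma mx3_row2 A B P : row i2 (mx3 A B P) = P.
Proof. by apply/rowP => j; rewrite !mxE. Qed.
Lemma pt_mx3 A B P x y z : pt x y z *m mx3 A B P = x *: A + y *: B + z *: P.
Proof. by rewrite pt_mulmx mx3_row0 mx3_row1 mx3_row2. Qed.

Lemma mx3_unit A B P :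
  (forall x y z, x *: A + y *: B + z *: P = 0 -> [/\ x = 0, y = 0 & z = 0]) ->
  mx3 A B P \in unitmx.
Proof.
move=> h; rewrite -row_free_unit -kermx_eq0; apply/eqP/row_matrixP => i.
rewrite row0; have : row i (kermx (mx3 A B P)) *m mx3 A B P = 0.
  by rewrite -row_mul mulmx_ker row0.
move: (row i _) => v; rewrite [v in v *m _]pt_eta pt_mx3 => /h[x0 y0 z0].
by rewrite [LHS]pt_eta x0 y0 z0 [LHS]pt_eta [RHS]pt_eta !mxE.
Qed.

Lemma basis_ex B P : P != 0 -> ~ (exists k, B = k *: P) ->
  exists M : 'M[K]_3, [/\ M \in unitmx, row i1 M = B & row i2 M = P].
Proof.
move=> P0 nB; pose N := col_mx B P.
have BN : (B <= N)%MS by rewrite -addsmxE addsmxSl.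
have PN : (P <= N)%MS by rewrite -addsmxE addsmxSr.
have [i hi] : exists i, ~~ (row i (1%:M : 'M[K]_3) <= N)%MS.
  apply/existsP; apply: contraT; rewrite negb_exists => /forallP h.
  have /mxrankS : ((1%:M : 'M[K]_3) <= N)%MS.
    by apply/row_subP => i; have := h i; rewrite negbK.
  by rewrite mxrank1 leqNgt ltnS rank_leq_row.
exists (mx3 (row i 1%:M) B P); rewrite mx3_row1 mx3_row2; split=> //.
apply: mx3_unit => x y z e.
have x0 : x = 0.
  apply/eqP; apply: contraR hi => x0.
  have -> : row i (1%:M : 'M[K]_3) = (- x^-1) *: (y *: B + z *: P).
    apply: (scalerI x0); rewrite scalerA mulrN divff // scaleN1r.
    by apply/eqP; rewrite -addr_eq0 addrA e.
  by rewrite scalemx_sub // addmx_sub // scalemx_sub.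
rewrite x0 scale0r add0r in e.
have y0 : y = 0.
  apply/eqP; apply: contraT => y0; case: nB; exists (- y^-1 * z).
  apply: (scalerI y0); rewrite scalerA mulrA mulrN divff // mulN1r scaleNr.
  by apply/eqP; rewrite -addr_eq0 e.
rewrite y0 scale0r add0r in e; split=> //; apply/eqP.
by move/eqP: e; rewrite scaler_eq0 (negPf P0) orbF.
Qed.

(** A point off the curve is taken as third basis vector, so that [F] becomes
    monic in the third coordinate. *)
Lemma basis1_ex P : P != 0 -> exists M : 'M[K]_3, M \in unitmx /\ row i2 M = P.
Proof.
move=> P0; suff [B nB] : exists B, ~ exists k, B = k *: P.
  by have [M [? _ ?]] := basis_ex P0 nB; exists M.
have [h|h] := eqVneq (P 0 i0) 0.
  exists (pt 1 0 0) => -[k /(congr1 (fun v : 'rV[K]_3 => v 0 i0))].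
  by rewrite !mxE h mulr0 => /eqP; rewrite oner_eq0.
exists (pt 0 0 1 + pt 0 1 0) => -[k e].
have := congr1 (fun v : 'rV[K]_3 => v 0 i0) e; rewrite pt_add pt0 addr0 mxE => /esym/eqP.
rewrite mulf_eq0 (negPf h) orbF => /eqP k0.
have := congr1 (fun v : 'rV[K]_3 => v 0 i2) e; rewrite pt_add pt2 addr0 mxE k0 mul0r => /eqP.
by rewrite oner_eq0.
Qed.

Lemma same_ptP v w : v != 0 -> reflect (exists2 k, k != 0 & w = k *: v) (<[v]>%VS == <[w]>%VS).
Proof.
move=> v0; apply: (iffP eqP) => [e|[k k0 ->]].
  have /vlineP[k ek] : w \in <[v]>%VS by rewrite e memv_line.
  exists k => //; apply: contraNneq v0 => k0.
  have : v \in <[w]>%VS by rewrite -e memv_line.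
  by rewrite ek k0 scale0r => /vlineP[c ->]; rewrite scaler0.
apply: subv_anti; rewrite -!memvE memvZ ?memv_line // andbT.
by apply/vlineP; exists k^-1; rewrite scalerA mulVf // scale1r.
Qed.
End Basis.

Section Domain.
Variable K : closedFieldType.
Hypothesis charK0 : [pchar K] =i pred0.
Variables (d : nat) (F : {mpoly K[3]}) (M : 'M[K]_3).
Hypotheses (hF : F \is d.-homog) (smF : smooth_curve F) (Mu : M \in unitmx).
Hypothesis FP1 : F.@[(row i2 M) 0] = 1.
Hypothesis d_gt0 : (0 < d)%N.
Implicit Types (G : {mpoly K[3]}) (x y z : K) (t : {poly {poly K}}).
Local Notation p1 := (p1 F M).
Let p1m := p1_monic hF FP1.
Let p1s := p1_smooth hF smF Mu.

(** The affine curve is integral.  Let [H] be the gcd of [p1] and [g1], and [G]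
    the cofactor.  They are coprime since [p1] is squarefree, and a Bezout
    relation [u G + v H = e] makes [v H / e] an idempotent function.  By
    [normality] it is a polynomial, by [idempotent_const] a constant, so 0 or
    1; then [H] or [G] is constant. *)
Lemma p1_prime g1 g2 : p1 %| g1 * g2 -> (p1 %| g1) || (p1 %| g2).
Proof.
move=> h12; set H := gcdp p1 g1.
have [[c G] /= c0 eG] := Pdiv.WeakIdomain.dvdpP _ _ (dvdp_gcdl p1 g1).
have [[c1 k] /= c10 ek] := Pdiv.WeakIdomain.dvdpP _ _ (dvdp_gcdr p1 g1).
rewrite -/H in eG ek.
have copGH : coprimep G H.
  have /coprimepP cop := smooth_coprime_deriv charK0 p1m p1s.
  apply/coprimepP => D DG DH; apply: cop.
    by rewrite -(dvdpZr _ _ c0) eG dvdp_mull.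
  by rewrite -(dvdpZr _ _ c0) -derivZ eG derivM dvdp_add ?(dvdp_mull _ DH) ?(dvdp_mulr _ DG).
have [u [v [e e0 ee]]] := coprimep_const copGH.
rewrite -!mul_polyC in eG ek.
have ce0 : c * e != 0 by rewrite mulf_neq0.
have const_unit (A B : {poly {poly K}}) : (c * e)%:P = A * B ->
    exists2 a : {poly K}, a != 0 & A = a%:P.
  move=> eAB; apply/size_poly1P.
  have AB0 : A * B != 0 by rewrite -eAB polyC_eq0.
  have [A0 B0] : A != 0 /\ B != 0 by move: AB0; rewrite mulf_eq0 negb_or => /andP.
  have := congr1 (fun g : {poly {poly K}} => size g) eAB; rewrite /= size_polyC ce0 size_mul //.
  by move: A0 B0; rewrite -!size_poly_gt0; case: (size A) (size B) => [|[|a]] [|b] //=; rewrite addnS.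
pose bb (i : nat) : {poly {poly K}} := if i == 1%N then -1 else 0.
have : p1 %| (v * H) ^+ 2 + \sum_(i < 2) bb i * (v * H) ^+ i * e%:P ^+ (2 - i).
  apply/(mdvdP p1m); exists (- (u * v * c%:P)).
  rewrite !big_ord_recl big_ord0 /= mul0r mul0r add0r addr0 mulN1r expr1 subn1 expr1 ee.
  transitivity (- (u * v * (G * H))); first by ring.
  by rewrite -eG; ring.
case/(normality p1m p1s (b := bb) e0) => t; have [q [t' [et st]]] := mdiv p1m t => ht.
have {}ht : p1 %| v * H - e%:P * t'.
  have -> : v * H - e%:P * t' = (v * H - e%:P * t) + e%:P * q * p1 by rewrite et; ring.
  by rewrite dvdp_add // dvdp_mull.
rewrite (size_p1 hF FP1) ltnS in st.
have idt : p1 %| t' ^+ 2 - t'.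
  apply: (cancel_const (d := e ^+ 2) p1m); first by rewrite expf_neq0.
  have -> : (e ^+ 2)%:P * (t' ^+ 2 - t') =
    (v * H) ^+ 2 - e%:P * (v * H) - ((v * H) ^+ 2 - (e%:P * t') ^+ 2)
    + e%:P * (v * H - e%:P * t') by rewrite rmorphXn /=; ring.
  rewrite dvdp_add ?(dvdp_mull _ ht) // dvdp_sub ?modX //.
  apply/(mdvdP p1m); exists (- (u * v * c%:P)); rewrite ee.
  transitivity (- (u * v * (G * H))); first by ring.
  by rewrite -eG; ring.
have [kap ekap] := idempotent_const charK0 hF smF Mu FP1 st idt.
have : kap ^+ 2 - kap = 0.
  apply/eqP; have := dvd_small idt; rewrite ekap -!rmorphXn -!rmorphB (size_p1 hF FP1) // => h.
  have /eqP := h (leq_ltn_trans (size_polyC_leq1 _) (d_gt0 : 1 < d.+1)%N).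
  by rewrite !polyC_eq0.
have -> : kap ^+ 2 - kap = kap * (kap - 1) by ring.
move/eqP; rewrite mulf_eq0 subr_eq0 => /orP[/eqP k0|/eqP k1].
  have [w ew] := mdvdP p1m _ ht; rewrite ekap k0 !polyC0 mulr0 subr0 in ew.
  have [] := const_unit G (u * c%:P + w * H).
    rewrite polyCM ee; transitivity (c%:P * u * G + c%:P * (v * H)); first by ring.
    rewrite ew; transitivity (c%:P * u * G + w * (c%:P * p1)); first by ring.
    by rewrite eG; ring.
  move=> gam gam0 eg; apply/orP; left.
  apply: (cancel_const (d := gam * c1) p1m); first by rewrite mulf_neq0.
  have -> : (gam * c1)%:P * g1 = gam%:P * (c1%:P * g1) by rewrite polyCM; ring.
  rewrite ek; have -> : gam%:P * (k * H) = k * (gam%:P * H) by ring.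
  by rewrite -eg -eG !dvdp_mull.
have [w ew] := mdvdP p1m _ ht; rewrite ekap k1 !polyC1 mulr1 ee in ew.
have [] := const_unit H (c%:P * v - w * G).
  rewrite polyCM ee; transitivity (c%:P * v * H - c%:P * (v * H - (u * G + v * H))); first by ring.
  rewrite ew; transitivity (c%:P * v * H - w * (c%:P * p1)); first by ring.
  by rewrite eG; ring.
move=> eta eta0 eH; apply/orP; right.
have : coprimep p1 g1.
  by rewrite coprimep_def -/H eH size_polyC eta0.
case/coprimep_const => a [b [f f0 ef]].
apply: (cancel_const p1m f0).
have -> : f%:P * g2 = a * g2 * p1 + b * (g1 * g2) by rewrite ef; ring.
by rewrite dvdp_add ?(dvdp_mull _ h12) ?dvdp_mull.
Qed.

Lemma curve_domain e1 e2 G1 G2 : G1 \is e1.-homog -> G2 \is e2.-homog ->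
  (forall v, on_curve F v -> G1.@[v 0] * G2.@[v 0] = 0) ->
  (forall v, on_curve F v -> G1.@[v 0] = 0) \/ (forall v, on_curve F v -> G2.@[v 0] = 0).
Proof.
move=> h1 h2 h12.
have : p1 %| chart 'X 1 M G1 * chart 'X 1 M G2.
  apply: (vanish1 charK0 hF smF Mu FP1 (oner_neq0 _)) => x z _ Fv.
  rewrite ev2M !ev_chart hornerX hornerC h12 //; split=> //.
  by rewrite mulmx_unit_eq0 // pt_eq0 oner_eq0 andbF.
case/p1_prime/orP => h; [left|right]; apply: (density charK0 hF smF Mu FP1) => //.
- exact: h1.
- by move=> x z /(dvd_ev1 hF FP1 h); rewrite ev_chart hornerX hornerC.
- exact: h2.
- by move=> x z /(dvd_ev1 hF FP1 h); rewrite ev_chart hornerX hornerC.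
Qed.

End Domain.

(** * Forms on the curve *)

Section LinearForm.
Variable K : comNzRingType.
Definition lf (m : 'cV[K]_3) (v : 'rV[K]_3) : K := (v *m m) 0 0.
Lemma lfD m v w : lf m (v + w) = lf m v + lf m w.
Proof. by rewrite /lf mulmxDl mxE. Qed.
Lemma lfZ m c v : lf m (c *: v) = c * lf m v.
Proof. by rewrite /lf -scalemxAl mxE. Qed.
Lemma lf_rank1 m v P : v *m (1%:M + m *m P) = v + lf m v *: P.
Proof.
rewrite mulmxDr mulmx1 mulmxA; congr (_ + _).
by rewrite [v *m m]mx11_scalar mul_scalar_mx.
Qed.
End LinearForm.

Section Curve.
Variable K : closedFieldType.
Hypothesis charK0 : [pchar K] =i pred0.
Variables (d : nat) (F : {mpoly K[3]}) (M : 'M[K]_3).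
Hypotheses (hF : F \is d.-homog) (smF : smooth_curve F) (Mu : M \in unitmx).
Hypothesis FP1 : F.@[(row i2 M) 0] = 1.
Hypothesis d_gt0 : (0 < d)%N.
Implicit Types (G : {mpoly K[3]}) (x y z : K) (t : {poly {poly K}}).
Local Notation p1 := (p1 F M).
Let p1m := p1_monic hF FP1.
Let size_p1E := size_p1 hF FP1.
Let ev_p1E x z : ev2 p1 x z = F.@[(pt x 1 z *m M) 0]. Proof. exact: ev_p1. Qed.

(** By [vanish1] the form [G] is a multiple of [F] in the first chart, and the
    degrees in [z] make the factor a constant.  This gives the identity for [y
    != 0], and for all points since both sides are polynomials on lines. *)
Lemma form_ratio_chart G (M' : 'M[K]_3) : G \is d.-homog ->
  (forall x z, F.@[(pt x 1 z *m M) 0] = 0 -> G.@[(pt x 1 z *m M *m M') 0] = 0) ->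
  forall v : 'rV[K]_3, G.@[(v *m M') 0] = G.@[(row i2 M *m M') 0] * F.@[v 0].
Proof.
move=> hG h; pose c := G.@[(row i2 M *m M') 0].
have [sG cG] := chart_top 'X 1 (M *m M') hG.
have ev x z : ev2 (chart 'X 1 (M *m M') G) x z = G.@[(pt x 1 z *m M *m M') 0].
  by rewrite ev_chart hornerX hornerC mulmxA.
have : p1 %| chart 'X 1 (M *m M') G.
  by apply: (vanish1 charK0 hF smF Mu FP1 (oner_neq0 _)) => x z _ Fv; rewrite ev h.
case/(mdvdP p1m) => q eq.
have eqc : chart 'X 1 (M *m M') G = c%:P%:P * p1.
  apply/eqP; rewrite -subr_eq0; apply/eqP/(dvd_small (p := p1)).
    by rewrite eq -mulrBl dvdp_mull.
  rewrite size_p1E ltnS; apply/leq_sizeP => j; rewrite leq_eqVlt => /orP[/eqP <-|dj].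
    have := cG; have [_ cF] := chart_top 'X 1 M hF; rewrite coefB coefCM cF FP1 => ->.
    by rewrite mulr1 row_mul subrr.
  by rewrite coefB coefCM (nth_default _ (leq_trans sG dj)) nth_default ?size_p1E // mulr0 subrr.
have aff a b e : b != 0 -> G.@[(pt a b e *m M *m M') 0] = c * F.@[(pt a b e *m M) 0].
  move=> b0; have -> : pt a b e = b *: pt (a / b) 1 (e / b).
    by rewrite pt_scale mulr1 ![b * _]mulrC !divfK.
  rewrite -!scalemxAl (meval_homog _ _ hF) (meval_homog _ _ hG) -ev eqc ev2M !ev2C hornerC ev_p1E.
  by rewrite mulrCA.
move=> v; rewrite -/c; have [x [y [z ->]]] := coord_ex v Mu.
pose w := pt 0 1 0 *m M.
pose L : {poly K} := line (pt x 0 z *m M *m M') (w *m M') G - c%:P * line (pt x 0 z *m M) w F.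
have L0 : L = 0.
  apply: (@poly_eq0_cofin _ _ 'X); first by rewrite polyX_eq0.
  move=> s; rewrite hornerX => s0.
  rewrite /L hornerD hornerN hornerM hornerC !line_horner !scalemxAl -!mulmxDl.
  by rewrite pt_scale pt_add !mulr0 !addr0 add0r mulr1 aff // subrr.
have := congr1 (horner^~ y) L0.
rewrite /= /L hornerD hornerN hornerM hornerC !line_horner !scalemxAl -!mulmxDl.
rewrite pt_scale pt_add !mulr0 !addr0 add0r mulr1 horner0.
by move/eqP; rewrite subr_eq0 => /eqP.
Qed.

(** The analogue of [form_expansion] for the first chart; it also holds for [u
    = 0], where both sides are [w^d]. *)
Lemma form_expansion1 u x w :
  F.@[(pt (u * x) u w *m M) 0] =
  w ^+ d + \sum_(i < d) (p1`_i).[x] * w ^+ i * u ^+ (d - i).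
Proof.
have [->|u0] := eqVneq u 0.
  have -> : pt (0 * x) 0 w = w *: pt 0 0 1 by rewrite pt_scale !mulr0 mul0r mulr1.
  rewrite -scalemxAl (meval_homog _ _ hF) pt001 FP1 mulr1 big1 ?addr0 // => i _.
  by rewrite expr0n subn_eq0 leqNgt ltn_ord mulr0.
rewrite (homog_pt1 _ _ _ hF u0) mulrAC divff // mul1r -ev_p1E ev2_horner.
rewrite (@horner_coef_wide _ d.+1 p1) ?size_p1E // big_ord_recr /= hornerD horner_sum.
have [_ ->] := chart_top 'X 1 M hF; rewrite FP1 mul1r -rmorphXn /= hornerC.
rewrite mulrDr addrC exprMn exprVn mulrCA divff ?expf_neq0 // mulr1 mulr_sumr; congr (_ + _).
apply: eq_bigr => i _; rewrite hornerM -rmorphXn /= hornerC exprMn exprVn.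
have -> : u ^+ d = u ^+ (d - i) * u ^+ i by rewrite -exprD subnK // ltnW.
by field; rewrite expf_neq0.
Qed.

Lemma coprime_of_ndvd g : ~~ (p1 %| g) -> coprimep p1 g.
Proof.
move=> nd; set H := gcdp p1 g.
have [[c G] /= c0 eG] := Pdiv.WeakIdomain.dvdpP _ _ (dvdp_gcdl p1 g).
have [[c1 k] /= c10 ek] := Pdiv.WeakIdomain.dvdpP _ _ (dvdp_gcdr p1 g).
rewrite -/H in eG ek.
have : p1 %| G * H by rewrite -eG -mul_polyC dvdp_mull.
case/(p1_prime charK0 hF smF Mu FP1 d_gt0)/orP => [h|h].
  have GH0 : G * H != 0.
    by rewrite -eG -mul_polyC mulf_neq0 ?polyC_eq0 ?(monic_neq0 p1m).
  have [G0 H0] : G != 0 /\ H != 0 by move: GH0; rewrite mulf_eq0 negb_or => /andP.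
  have := congr1 (fun g : {poly {poly K}} => size g) eG; rewrite /= -mul_polyC size_Cmul // size_mul //.
  have := dvdp_leq G0 h; rewrite coprimep_def -/H size_p1E.
  by move: H0; rewrite -size_poly_gt0; lia.
case/negP: nd; apply: (cancel_const p1m c10).
by rewrite mul_polyC ek dvdp_mull.
Qed.

End Curve.

(** * Maps preserving the lines through a point are linear *)

Section Linear.
Variable K : closedFieldType.
Hypothesis charK0 : [pchar K] =i pred0.

Lemma parallel (v w : 'rV[K]_3) : v != 0 -> w != 0 ->
  (forall i j, v 0 i * w 0 j = v 0 j * w 0 i) -> exists2 k, k != 0 & v = k *: w.
Proof.
move=> v0 w0 h; have [i wi] : exists i, w 0 i != 0.
  apply/existsP; apply: contraNT w0; rewrite negb_exists => /forallP wi.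
  by apply/eqP/rowP => i; apply/eqP; rewrite mxE; have := wi i; rewrite negbK.
have e : v = (v 0 i / w 0 i) *: w.
  by apply/rowP => j; rewrite mxE; apply: (mulIf wi); rewrite mulrAC divfK // h.
by exists (v 0 i / w 0 i) => //; apply: contraNneq v0 => k0; rewrite e k0 scale0r.
Qed.

Section Normalized.
Variables (d : nat) (F : {mpoly K[3]}) (P : 'rV[K]_3).
Hypotheses (hF : F \is d.-homog) (smF : smooth_curve F) (FP1 : F.@[P 0] = 1) (d_gt1 : (1 < d)%N).
Let d_gt0 : (0 < d)%N := ltnW d_gt1.

Lemma evalZP k : F.@[(k *: P) 0] = k ^+ d.
Proof. by rewrite (meval_homog _ _ hF) FP1 mulr1. Qed.

Lemma curve_not_center v : on_curve F v -> ~ exists k, v = k *: P.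
Proof.
move=> [v0 Fv] [k e]; move/eqP: Fv; rewrite e evalZP expf_eq0 d_gt0 /= => /eqP k0.
by move: v0; rewrite e k0 scale0r eqxx.
Qed.

Lemma center_neq0 : P != 0.
Proof.
apply/eqP => P0; have := evalZP 0; rewrite scale0r -P0 FP1 expr0n.
by rewrite gtn_eqF // => /eqP; rewrite oner_eq0.
Qed.

(** In a basis whose last vectors are a point [v0] of the curve and [P], the
    map sends [(x, 1, z)] to [(x, 1, t)] for a rational function [t], which is
    integral because the image lies on the curve.  So [t] is a polynomial
    modulo [p1], and [integral_linear] gives [t = a z + b x + c], which is the
    linear map [v + m(v) P].  If [a] were 0, the polynomial [p1] would have a
    root in K[x], which contradicts irreducibility because [d > 1]. *)
Lemma fiber_map_linear (e : nat) (f : ratmap K) v0 :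
  (forall i, f i \is e.-homog) -> on_curve F v0 -> eval_map f v0 != 0 ->
  (forall v, on_curve F v -> eval_map f v != 0 -> on_curve F (eval_map f v)) ->
  (forall v, on_curve F v -> eval_map f v != 0 -> exists a b, eval_map f v = a *: P + b *: v) ->
  exists m : 'cV[K]_3, [/\ 1 + lf m P != 0,
    forall v, F.@[(v + lf m v *: P) 0] = (1 + lf m P) ^+ d * F.@[v 0]
    & forall v, on_curve F v -> eval_map f v != 0 ->
        exists2 k, k != 0 & eval_map f v = k *: (v + lf m v *: P)].
Proof.
move=> hf Cv0 fv0 fC fib.
have [M [Mu MB MP]] := basis_ex center_neq0 (curve_not_center Cv0).
have FM : F.@[(row i2 M) 0] = 1 by rewrite MP.
set p1 := p1 F M.
have p1m : p1 \is monic := p1_monic hF FM.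
have p1s : smooth2 p1 := p1_smooth hF smF Mu.
have sp1 : size p1 = d.+1 := size_p1 hF FM.
have Caff x z : F.@[(pt x 1 z *m M) 0] = 0 -> on_curve F (pt x 1 z *m M).
  by split=> //; rewrite mulmx_unit_eq0 // pt_eq0 oner_eq0 andbF.
have evp1 x z : ev2 p1 x z = F.@[(pt x 1 z *m M) 0] by exact: ev_p1.
(* The coordinates of the image in the basis [M]. *)
pose ga j : {mpoly K[3]} := \sum_i (invmx M) i j *: f i.
have fE v : eval_map f v = pt (ga i0).@[v 0] (ga i1).@[v 0] (ga i2).@[v 0] *m M.
  rewrite -[LHS](mulmxKV Mu); congr (_ *m M); rewrite [LHS]pt_eta.
  by congr pt; rewrite mxE raddf_sum; apply: eq_bigr => i _; rewrite /= mevalZ mxE mulrC.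
have fib' v x y z : v = pt x y z *m M -> on_curve F v ->
    exists b, (ga i0).@[v 0] = b * x /\ (ga i1).@[v 0] = b * y.
  move=> ev Cv; have [f0|f0] := eqVneq (eval_map f v) 0.
    exists 0; rewrite !mul0r; move/eqP: f0; rewrite fE mulmx_unit_eq0 // pt_eq0.
    by case/and3P => /eqP-> /eqP->.
  have [a [b]] := fib v Cv f0; rewrite -MP -pt001 ev -ev fE ev !scalemxAl -mulmxDl !pt_scale pt_add.
  move/(congr1 (mulmx^~ (invmx M))); rewrite !(mulmxK Mu) => h; exists b.
  have h0 := congr1 (fun v : 'rV[K]_3 => v 0 i0) h.
  have h1 := congr1 (fun v : 'rV[K]_3 => v 0 i1) h.
  by move: h0 h1; rewrite /= !pt0 !pt1 !mulr0 !add0r.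
have Fga x z : F.@[(pt x 1 z *m M) 0] = 0 ->
    F.@[(pt ((ga i1).@[(pt x 1 z *m M) 0] * x) (ga i1).@[(pt x 1 z *m M) 0]
            (ga i2).@[(pt x 1 z *m M) 0] *m M) 0] = 0.
  move=> Fv; set v := pt x 1 z *m M; have Cv : on_curve F v := Caff _ _ Fv.
  have [b [e0 e1]] := fib' v x 1 z erefl Cv.
  have -> : (ga i1).@[v 0] * x = (ga i0).@[v 0] by rewrite e0 e1 mulr1.
  rewrite -fE; have [->|f0] := eqVneq (eval_map f v) 0; last by case: (fC v Cv f0).
  by have := evalZP 0; rewrite scale0r expr0n gtn_eqF.
pose g j := chart 'X 1 M (ga j).
have evg j x z : ev2 (g j) x z = (ga j).@[(pt x 1 z *m M) 0].
  by rewrite ev_chart hornerX hornerC.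
(* Otherwise the image of [v0] would have its first two coordinates zero, and
   the curve does not pass through [P]. *)
have ndvd : ~~ (p1 %| g i1).
  apply/negP => h; case/negP: fv0; rewrite -MB -pt010.
  have Fv0 : F.@[(pt 0 1 0 *m M) 0] = 0 by rewrite pt010 MB; case: Cv0.
  have := dvd_ev1 hF FM h Fv0; rewrite evg => e1.
  have [b [e0 e1']] := fib' _ 0 1 0 erefl (Caff _ _ Fv0).
  have := Fga _ _ Fv0; rewrite e1 mul0r.
  have -> (c : K) : pt 0 0 c = c *: pt 0 0 1 by rewrite pt_scale !mulr0 mulr1.
  rewrite -scalemxAl pt001 MP evalZP => /eqP; rewrite expf_eq0 d_gt0 /= => /eqP e2.
  by rewrite fE e0 e1 e2 mulr0 mulmx_unit_eq0 // pt_eq0 !eqxx.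
(* On the curve [w] is [dd / g i1], so [w * g i2] is [dd] times the third
   affine coordinate of the image. *)
have [u [w [dd dd0 edd]]] := coprimep_const (coprime_of_ndvd charK0 hF smF Mu FM d_gt0 ndvd).
have wg1 x z : F.@[(pt x 1 z *m M) 0] = 0 -> ev2 w x z * ev2 (g i1) x z = dd.[x].
  move=> Fv; have := congr1 (fun h => ev2 h x z) edd.
  by rewrite ev2C ev2D !ev2M -/p1 evp1 Fv mulr0 add0r => ->.
pose bb i : {poly {poly K}} := (p1`_i)%:P.
have : p1 %| (w * g i2) ^+ d + \sum_(i < d) bb i * (w * g i2) ^+ i * dd%:P ^+ (d - i).
  apply: (vanish1 charK0 hF smF Mu FM (oner_neq0 _)) => x z _ Fv.
  have := form_expansion1 hF FM (ev2 w x z * ev2 (g i1) x z) x (ev2 (w * g i2) x z).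
  rewrite -/p1 {1 2}ev2M !evg -mulrA.
  have -> (c a b' c' : K) : pt (c * a) (c * b') (c * c') = c *: pt a b' c' by rewrite pt_scale.
  rewrite -scalemxAl (meval_homog _ _ hF) Fga // mulr0 -!evg wg1 // => h.
  rewrite [RHS]h ev2D ev2X ev2_sum; congr (_ + _); [by rewrite ev2M|apply: eq_bigr => i _].
  by rewrite !(ev2M, ev2X, ev2C).
case/(normality p1m p1s dd0) => t0; have [q [t [et st]]] := mdiv p1m t0 => ht.
rewrite sp1 ltnS in st.
have {}ht x z : F.@[(pt x 1 z *m M) 0] = 0 -> ev2 w x z * ev2 (g i2) x z = dd.[x] * ev2 t x z.
  move=> Fv; have := dvd_ev1 hF FM ht Fv; rewrite et ev2B ev2M ev2M ev2C ev2D ev2M evp1 Fv mulr0 add0r.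
  by move/eqP; rewrite subr_eq0 => /eqP.
have p1t : p1 %| t ^+ d + \sum_(i < d) bb i * t ^+ i.
  apply: (vanish1 charK0 hF smF Mu FM dd0) => x z ddx Fv.
  have := form_expansion1 hF FM 1 x (ev2 t x z); rewrite -/p1 mul1r => e1.
  have -> : ev2 (t ^+ d + \sum_(i < d) bb i * t ^+ i) x z = F.@[(pt x 1 (ev2 t x z) *m M) 0].
    rewrite e1 ev2D ev2X ev2_sum; congr (_ + _); apply: eq_bigr => i _.
    by rewrite ev2M ev2X ev2C expr1n mulr1.
  have g10 : ev2 (g i1) x z != 0.
    by apply: contraNneq ddx => g0; rewrite -(wg1 _ _ Fv) g0 mulr0.
  have g2t : ev2 (g i2) x z = ev2 (g i1) x z * ev2 t x z.
    by apply: (mulfI ddx); rewrite mulrCA -(ht _ _ Fv) -{1}(wg1 _ _ Fv); ring.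
  have := Fga _ _ Fv; rewrite -!evg g2t.
  have -> (c a b' : K) : pt (c * a) c (c * b') = c *: pt a 1 b' by rewrite pt_scale mulr1.
  by rewrite -scalemxAl (meval_homog _ _ hF) => /eqP; rewrite mulf_eq0 expf_eq0 (negPf g10) andbF => /eqP.
have Ft x z : F.@[(pt x 1 z *m M) 0] = 0 -> F.@[(pt x 1 (ev2 t x z) *m M) 0] = 0.
  move=> Fv; have := dvd_ev1 hF FM p1t Fv; have := form_expansion1 hF FM 1 x (ev2 t x z).
  rewrite -/p1 mul1r => ->; rewrite ev2D ev2X ev2_sum => h; rewrite -[RHS]h; congr (_ + _).
  by apply: eq_bigr => i _; rewrite ev2M ev2X ev2C expr1n mulr1.
have g2t x z : F.@[(pt x 1 z *m M) 0] = 0 ->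
    (ga i2).@[(pt x 1 z *m M) 0] = (ga i1).@[(pt x 1 z *m M) 0] * ev2 t x z.
  move=> Fv; have : p1 %| g i2 - g i1 * t.
    apply: (vanish1 charK0 hF smF Mu FM dd0) => x' z' ddx Fv'.
    rewrite ev2B ev2M; apply/eqP; rewrite subr_eq0; apply/eqP.
    by apply: (mulfI ddx); rewrite mulrCA -(ht _ _ Fv') -{1}(wg1 _ _ Fv'); ring.
  move/(dvd_ev1 hF FM)/(_ Fv); rewrite ev2B ev2M !evg => /eqP.
  by rewrite subr_eq0 => /eqP.
have [a [b [c et']]] := integral_linear charK0 hF smF Mu FM st Ft.
have evt x z : ev2 t x z = a * z + (b * x + c).
  by rewrite et' ev2D ev2M !ev2C ev2_varz hornerD hornerZ hornerX !hornerC addrC.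
(* The polynomial [t] would be a root of [p1] in K[x]. *)
have a0 : a != 0.
  apply/eqP => a0; pose tt := b *: 'X + c%:P.
  have rt : root p1 tt.
    have hp (s : {poly K}) : s%:P ^+ d + \sum_(i < d) bb i * s%:P ^+ i = (p1.[s])%:P.
      rewrite (@horner_coef_wide _ d.+1 p1) ?sp1 // big_ord_recr polyCD addrC /=.
      have -> : p1`_d = 1 by have [_ ->] := chart_top 'X 1 M hF; rewrite FM.
      rewrite mul1r -rmorphXn; congr (_ + _).
      rewrite (rmorph_sum (@polyC _)); apply: eq_bigr => i _.
      by rewrite /= polyCM -rmorphXn.
    have e2 : (t ^+ d + \sum_(i < d) bb i * t ^+ i) = (p1.[tt])%:P.
      by rewrite -hp et' a0 !polyC0 mul0r addr0.
    have := dvd_small p1t; rewrite e2 => h.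
    have /h/eqP : (size (p1.[tt])%:P < size p1)%N by rewrite sp1 (leq_ltn_trans (size_polyC_leq1 _)).
    by rewrite polyC_eq0.
  have [q' eq'] := factor_theorem _ _ rt.
  have q'0 : q' != 0 by apply: contraTneq p1m => q0; rewrite eq' q0 mul0r monicE lead_coef0 eq_sym oner_eq0.
  have : p1 %| q' * ('X - tt%:P) by rewrite -eq'.
  case/(p1_prime charK0 hF smF Mu FM d_gt0)/orP => h.
    have := dvdp_leq q'0 h; rewrite -/p1 {1}eq' size_Mmonic ?monicXsubC // size_XsubC addn2 /=.
    by rewrite ltnn.
  have := dvdp_leq (negbT (polyXsubC_eq0 tt)) h; rewrite -/p1 sp1 size_XsubC ltnS.
  by rewrite leqNgt d_gt1.
pose m : 'cV[K]_3 := invmx M *m (pt b c (a - 1))^T.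
have lfm x y z : lf m (pt x y z *m M) = b * x + c * y + (a - 1) * z.
  rewrite /lf /m mulmxA mulmxK // mxE sum3 !mxE /= mulrC [y * _]mulrC [z * _]mulrC //.
have lfP : 1 + lf m P = a by rewrite -MP -pt001 lfm !mulr0 !add0r mulr1 addrCA subrr addr0.
have LM v : v *m (1%:M + m *m P) = v + lf m v *: P := lf_rank1 m v P.
have Lpt x z : pt x 1 z *m M *m (1%:M + m *m P) = pt x 1 (ev2 t x z) *m M.
  rewrite LM lfm evt mulr1 -MP -(pt001 M) scalemxAl -mulmxDl pt_scale pt_add !mulr0 !addr0 mulr1.
  by congr (pt _ _ _ *m M); ring.
have L0 v : on_curve F v -> v + lf m v *: P != 0.
  move=> Cv; apply/eqP => /eqP; rewrite addr_eq0 -scaleNr => /eqP h.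
  by apply: (curve_not_center Cv); exists (- lf m v).
exists m; rewrite lfP; split=> //.
  move=> v; rewrite -LM (@form_ratio_chart _ charK0 d F M hF smF Mu FM F _ hF); last first.
    by move=> x z Fv; rewrite Lpt Ft.
  rewrite MP LM; congr (_ * _).
  by rewrite -{1}[P]scale1r -scalerDl lfP evalZP.
move=> v Cv fv; apply: parallel => //; first exact: L0.
pose L j : {mpoly K[3]} := \sum_k (1%:M + m *m P) k j *: 'X_k.
have hL j : L j \is 1.-homog.
  apply: rpred_sum => k _; apply: rpredZ.
  by rewrite dhomogX; apply/eqP; exact: mdeg1.
have evL (w' : 'rV[K]_3) j : (L j).@[w' 0] = (w' + lf m w' *: P) 0 j.
  rewrite -LM mxE raddf_sum; apply: eq_bigr => k _.
  by rewrite /= mevalZ mevalXU mulrC.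
move=> i j; pose G := f i * L j - f j * L i.
have hG : G \is (e + 1).-homog by rewrite rpredB // dhomogM.
have := @density _ charK0 d F M hF smF Mu FM _ G hG _ v Cv.
rewrite /G mevalB !mevalM !evL /eval_map !mxE => h; apply/eqP; rewrite -subr_eq0 h // => x z Fv.
rewrite mevalB !mevalM !evL.
have ef k : (f k).@[(pt x 1 z *m M) 0] = (eval_map f (pt x 1 z *m M)) 0 k by rewrite mxE.
have [b' [e0 e1]] := fib' _ x 1 z erefl (Caff _ _ Fv).
rewrite !ef fE e0 g2t // e1 mulr1 -LM Lpt.
have -> : pt (b' * x) b' (b' * ev2 t x z) = b' *: pt x 1 (ev2 t x z) by rewrite pt_scale mulr1.
by rewrite -scalemxAl !mxE; ring.
Qed.

End Normalized.
End Linear.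

(** * The group of a point off the curve *)

Section Homologies.
Variable K : closedFieldType.
Hypothesis charK0 : [pchar K] =i pred0.
Variables (d : nat) (F : {mpoly K[3]}).
Hypotheses (hF : F \is d.-homog) (smF : smooth_curve F) (d_gt1 : (1 < d)%N).
Let d_gt0 : (0 < d)%N := ltnW d_gt1.
Let dK0 : (d%:R : K) != 0. Proof. by rewrite -(prednK d_gt0) natK_neq0. Qed.

Lemma on_curveZ c : c != 0 -> forall v, on_curve (c *: F) v <-> on_curve F v.
Proof.
move=> c0 v; rewrite /on_curve mevalZ; split=> -[v0 Fv]; split=> //.
  by move/eqP: Fv; rewrite mulf_eq0 (negPf c0) => /eqP.
by rewrite Fv mulr0.
Qed.

Lemma smooth_curveZ c : c != 0 -> smooth_curve (c *: F).
Proof.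
move=> c0 v /(on_curveZ c0) /smF [i hi]; exists i.
by rewrite mderivZ mevalZ mulf_neq0.
Qed.

Section Center.
Variable P : 'rV[K]_3.
Hypothesis FP : F.@[P 0] != 0.

Let F1 := (F.@[P 0])^-1 *: F.
Let c0 : (F.@[P 0])^-1 != 0. Proof. by rewrite invr_eq0. Qed.
Let hF1 : F1 \is d.-homog. Proof. exact: rpredZ. Qed.
Let smF1 : smooth_curve F1. Proof. exact: smooth_curveZ. Qed.
Let F1P : F1.@[P 0] = 1. Proof. by rewrite mevalZ mulVf. Qed.
Let C1 v : on_curve F1 v <-> on_curve F v. Proof. exact: on_curveZ. Qed.

Lemma off_curve_neq0 : P != 0. Proof. exact: (center_neq0 hF1 F1P d_gt1). Qed.
Lemma on_curve_not_center v : on_curve F v -> ~ exists k, v = k *: P.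
Proof. by move=> /C1; apply: (curve_not_center hF1 F1P d_gt1). Qed.

(** A form of degree [d] vanishing on the curve is a multiple of its equation;
    the factor is found at [P]. *)
Lemma form_ratio G (M' : 'M[K]_3) : G \is d.-homog ->
  (forall v, on_curve F v -> G.@[(v *m M') 0] = 0) ->
  forall v : 'rV[K]_3, F.@[P 0] * G.@[(v *m M') 0] = G.@[(P *m M') 0] * F.@[v 0].
Proof.
move=> hG h v; have [M [Mu MP]] := basis1_ex off_curve_neq0.
have F1M : F1.@[(row i2 M) 0] = 1 by rewrite MP.
rewrite (form_ratio_chart charK0 hF1 smF1 Mu F1M hG); last first.
  move=> x z Fv; apply: h; apply/C1; split=> //.
  by rewrite mulmx_unit_eq0 // pt_eq0 oner_eq0 andbF.
by rewrite MP mulrCA /F1 mevalZ mulVKf.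
Qed.

Lemma curve_domain_gen e1 e2 G1 G2 : G1 \is e1.-homog -> G2 \is e2.-homog ->
  (forall v, on_curve F v -> G1.@[v 0] * G2.@[v 0] = 0) ->
  (forall v, on_curve F v -> G1.@[v 0] = 0) \/ (forall v, on_curve F v -> G2.@[v 0] = 0).
Proof.
move=> h1 h2 h; have [M [Mu MP]] := basis1_ex off_curve_neq0.
have F1M : F1.@[(row i2 M) 0] = 1 by rewrite MP.
have [|h'|h'] := curve_domain charK0 hF1 smF1 Mu F1M d_gt0 h1 h2.
- by move=> v /C1; apply: h.
- by left=> v /C1; apply: h'.
- by right=> v /C1; apply: h'.
Qed.

Lemma curve_point : exists v, on_curve F v.
Proof.
have [M [Mu MP]] := basis1_ex off_curve_neq0.
have F1M : F1.@[(row i2 M) 0] = 1 by rewrite MP.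
have /closed_rootP[z /eqP Hz] : size (at_x 0 (p1 F1 M)) != 1%N.
  by rewrite (size_at_x (p1_monic hF1 F1M)) (size_p1 hF1 F1M) eqSS -lt0n.
exists (pt 0 1 z *m M); apply/C1; split; last by rewrite -ev_p1.
by rewrite mulmx_unit_eq0 // pt_eq0 oner_eq0 andbF.
Qed.

(** Row vectors are points and column vectors are linear forms; this one is the
    polar form of [P], normalized to take the value 1 at [P].  Its kernel is
    the axis of the homologies of center [P]. *)
Definition pol : 'cV[K]_3 := \col_i ((F^`M(i)).@[P 0] / (d%:R * F.@[P 0])).

Lemma lf_pol v : lf pol v = dform F P v / (d%:R * F.@[P 0]).
Proof.
by rewrite /lf mxE mulr_suml; apply: eq_bigr => i _; rewrite mxE mulrA [v 0 i * _]mulrC.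
Qed.

Lemma lf_polP : lf pol P = 1.
Proof. by rewrite lf_pol (euler _ hF) divff // mulf_neq0. Qed.

Definition homol a v : 'rV[K]_3 := v + ((a - 1) * lf pol v) *: P.
Definition homology a := forall v, F.@[(homol a v) 0] = a ^+ d * F.@[v 0].

(** The map [v |-> v + m(v) P] multiplies [P] by [a] and [F] by [a^d].
    Comparing the first derivatives of [F] at [P] in the direction of any [v]
    and of its image shows that [m] is proportional to the polar form of [P].
    *)
Lemma homology_form (m : 'cV[K]_3) a : a != 0 -> lf m P = a - 1 ->
  (forall v, F.@[(v + lf m v *: P) 0] = a ^+ d * F.@[v 0]) ->
  forall v, lf m v = (a - 1) * lf pol v.
Proof.
move=> a0 mP h w.
(* Up to the scalar [a], the map sends the line [P + t w] to the line [P + t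
   w']. *)
pose w' := a^-1 *: (w + lf m w *: P).
have e : line P w' F = line P w F.
  apply/eqP; rewrite -subr_eq0; apply/eqP; apply: (@poly_eq0_cofin _ _ 1); first exact: oner_neq0.
  move=> t _; rewrite hornerD hornerN !line_horner; apply/eqP; rewrite subr_eq0; apply/eqP.
  apply: (@mulfI _ (a ^+ d)); first by rewrite expf_neq0.
  rewrite -[RHS]h -[LHS](meval_homog _ _ hF).
  have -> // : a *: (P + t *: w') = P + t *: w + lf m (P + t *: w) *: P.
  by apply/rowP => j; rewrite lfD lfZ mP /w' !mxE; field.
have := congr1 (fun p : {poly K} => p^`().[0]) e.
rewrite /= !line_deriv !scale0r !addr0 /w' dformZ dformD dformZ (euler _ hF) lf_pol => e1.
have FPd : d%:R * F.@[P 0] != 0 by rewrite mulf_neq0.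
apply: (mulIf FPd); rewrite -mulrA divfK //.
have -> : lf m w * (d%:R * F.@[P 0]) = a * (a^-1 * (dform F P w + lf m w * (d%:R * F.@[P 0]))) - dform F P w.
  by rewrite mulVKf // addrAC subrr add0r.
by rewrite e1; ring.
Qed.

Lemma homolM a b v : homol a (homol b v) = homol (a * b) v.
Proof.
rewrite /homol lfD lfZ lf_polP; apply/rowP => j; rewrite !mxE; ring.
Qed.

Lemma homol1 v : homol 1 v = v.
Proof. by rewrite /homol subrr mul0r scale0r addr0. Qed.

Lemma homologyM a b : homology a -> homology b -> homology (a * b).
Proof. by move=> ha hb v; rewrite -homolM ha hb exprMn mulrA. Qed.

Lemma homologyV a : a != 0 -> homology a -> homology a^-1.
Proof.
move=> a0 ha v; apply: (@mulfI _ (a ^+ d)); first by rewrite expf_neq0.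
by rewrite -ha homolM divff // homol1 mulrA -exprMn divff // expr1n mul1r.
Qed.

Lemma homol_neq0 a v : on_curve F v -> homol a v != 0.
Proof.
move=> Cv; apply/eqP => /eqP; rewrite addr_eq0 -scaleNr => /eqP h.
by apply: (on_curve_not_center Cv); eexists; exact: h.
Qed.

Lemma homology_curve a v : homology a -> on_curve F v -> on_curve F (homol a v).
Proof.
move=> ha Cv; split; first exact: homol_neq0.
by rewrite ha; case: Cv => _ ->; rewrite mulr0.
Qed.

(** The homology of scalar [a], as a triple of linear forms. *)
Definition hmap a : ratmap K := fun j => \sum_k (1%:M + ((a - 1) *: pol) *m P) k j *: 'X_k.

Lemma hmap_homog a j : hmap a j \is 1.-homog.
Proof.
apply: rpred_sum => k _; apply: rpredZ.
by rewrite dhomogX; apply/eqP; exact: mdeg1.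
Qed.

Lemma eval_hmap a v : eval_map (hmap a) v = homol a v.
Proof.
rewrite /homol.
have -> : (a - 1) * lf pol v = lf ((a - 1) *: pol) v by rewrite /lf -scalemxAr [RHS]mxE.
rewrite -lf_rank1; apply/rowP => j; rewrite [LHS]mxE [RHS]mxE raddf_sum; apply: eq_bigr => k _.
by rewrite /= mevalZ mevalXU mulrC.
Qed.

Lemma hmap_is_ratmap a : homology a -> is_ratmap F (hmap a).
Proof.
move=> ha; split; first by exists 1%N; exact: hmap_homog.
  by have [v Cv] := curve_point; exists v => //; rewrite eval_hmap homol_neq0.
by move=> v Cv _; rewrite eval_hmap; apply: homology_curve.
Qed.

Lemma hmap_comp_id a : a != 0 -> homology a -> comp_is_id F (hmap a^-1) (hmap a).
Proof.
move=> a0 ha; split.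
  have [v Cv] := curve_point; exists v; rewrite !eval_hmap; split=> //; first exact: homol_neq0.
  exact/homol_neq0/homology_curve.
by move=> v Cv _ _; rewrite !eval_hmap homolM mulVf // homol1.
Qed.

Lemma line_through_homol a v : line_through P (homol a v) = line_through P v.
Proof.
have sub w c : (line_through P (w + c *: P) <= line_through P w)%VS.
  rewrite subv_add addvSl /= -memvE memvD ?memvZ //.
    exact: (subvP (addvSr _ _) _ (memv_line w)).
  exact: (subvP (addvSl _ _) _ (memv_line P)).
apply: subv_anti; rewrite sub /=.
have := sub (homol a v) (- ((a - 1) * lf pol v)).
by rewrite /homol scaleNr addrK.
Qed.

Lemma hmap_in_G a : a != 0 -> homology a -> in_G F P (hmap a).
Proof.
move=> a0 ha; have ha' := homologyV a0 ha; split; last first.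
  by move=> v Cv _ _ _; rewrite eval_hmap line_through_homol.
split; first exact: hmap_is_ratmap.
exists (hmap a^-1); split; [exact: hmap_is_ratmap|exact: hmap_comp_id|].
by have := hmap_comp_id (invr_neq0 a0) ha'; rewrite invrK.
Qed.

(** This is [fiber_map_linear] for the equation of value 1 at [P], combined
    with [homology_form]. *)
Lemma in_G_homology f : in_G F P f -> exists a, [/\ a != 0, homology a
  & forall v, on_curve F v -> eval_map f v != 0 ->
      exists2 k, k != 0 & eval_map f v = k *: homol a v].
Proof.
move=> [[[[e hf] [v0 Cv0 fv0] fC] _] fib].
have [|||m [m0 hm fm]] := fiber_map_linear charK0 hF1 smF1 F1P d_gt1 hf _ fv0.
- exact/C1.
- by move=> v /C1 Cv fv; apply/C1; apply: fC.
- move=> v /C1 Cv fv; have Cfv := fC v Cv fv.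
  have nsame w : on_curve F w -> ~ same_pt w P.
    move=> Cw /eqP/(same_ptP _ (proj1 Cw)) [k k0 e1]; apply: (on_curve_not_center Cw); exists k^-1.
    by rewrite e1 scalerA mulVf // scale1r.
  have lt := fib v Cv fv (nsame _ Cv) (nsame _ Cfv).
  have : eval_map f v \in line_through P v.
    by rewrite -lt; exact: (subvP (addvSr _ _) _ (memv_line _)).
  case/memv_addP => p /vlineP[a ->] [q /vlineP[b ->] ->].
  by exists a, b.
have hm' v : F.@[(v + lf m v *: P) 0] = (1 + lf m P) ^+ d * F.@[v 0].
  by have := hm v; rewrite !mevalZ mulrCA => /(mulfI c0).
have mP : lf m P = 1 + lf m P - 1 by rewrite addrAC subrr add0r.
have hp := homology_form m0 mP hm'.
exists (1 + lf m P).
have hl v : homol (1 + lf m P) v = v + lf m v *: P by rewrite /homol -hp.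
split=> //; first by move=> v; rewrite hl hm'.
by move=> v /C1 Cv fv; rewrite hl; apply: fm.
Qed.

(** The polar form is a nonzero linear form, of degree less than [d], so it
    does not vanish on the curve. *)
Lemma polar_not_vanish : exists2 v, on_curve F v & lf pol v != 0.
Proof.
pose L : {mpoly K[3]} := \sum_k pol k 0 *: 'X_k.
have evL (v : 'rV[K]_3) : L.@[v 0] = lf pol v.
  by rewrite raddf_sum /lf mxE; apply: eq_bigr => k _; rewrite /= mevalZ mevalXU mulrC.
have hL : L \is 1.-homog.
  apply: rpred_sum => k _; apply: rpredZ.
  by rewrite dhomogX; apply/eqP; exact: mdeg1.
have [M [Mu MP]] := basis1_ex off_curve_neq0.
have F1M : F1.@[(row i2 M) 0] = 1 by rewrite MP.
have ev x z : ev2 (chart 'X 1 M L) x z = lf pol (pt x 1 z *m M).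
  by rewrite ev_chart hornerX hornerC evL.
have [/eqP|nz] := eqVneq (chart 'X 1 M L) 0.
  move/eqP => h; have := lf_polP.
  have l0 z : lf pol (pt 0 1 z *m M) = 0 by rewrite -ev h ev2_0.
  have := l0 1; have := l0 0; rewrite !pt_mulmx MP !scale0r addr0 add0r !scale1r lfD => -> .
  by rewrite add0r => -> /esym/eqP; rewrite oner_eq0.
have : ~~ (p1 F1 M %| chart 'X 1 M L).
  apply: contraNN nz => h; apply/eqP; apply: (dvd_small h).
  by rewrite (size_p1 hF1 F1M) (leq_ltn_trans (proj1 (chart_top 'X 1 M hL))).
move/negP=> nd; apply: NNPP => h; apply: nd; apply: (vanish1 charK0 hF1 smF1 Mu F1M (oner_neq0 _)) => x z _ Fv.
rewrite ev; apply/eqP; apply: contraT => l0; case: h; exists (pt x 1 z *m M) => //.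
by apply/C1; split=> //; rewrite mulmx_unit_eq0 // pt_eq0 oner_eq0 andbF.
Qed.

(** Off the axis the images [v + (a - 1) lambda(v) P] are distinct points for
    distinct [a]. *)
Lemma homol_inj a b v k : on_curve F v -> lf pol v != 0 -> homol a v = k *: homol b v -> a = b.
Proof.
move=> Cv lv; rewrite /homol scalerDr scalerA => e.
have [k1|k1] := eqVneq k 1.
  move: e; rewrite k1 scale1r mul1r => /addrI/eqP.
  rewrite -subr_eq0 -scalerBl scaler_eq0 (negPf off_curve_neq0) orbF -mulrBl.
  by rewrite mulf_eq0 (negPf lv) orbF opprB addrA subrK subr_eq0 => /eqP.
case: (on_curve_not_center Cv).
exists ((1 - k)^-1 * (k * ((b - 1) * lf pol v) - (a - 1) * lf pol v)).
have k1' : 1 - k != 0 by rewrite subr_eq0 eq_sym.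
apply/rowP => j; have := congr1 (fun u : 'rV[K]_3 => u 0 j) e; rewrite !mxE => ej.
apply: (mulfI k1'); rewrite -mulrA mulVKf //; apply/eqP; rewrite -subr_eq0.
move/eqP: ej; rewrite -subr_eq0 => /eqP ej; rewrite -[X in _ == X]ej; apply/eqP; ring.
Qed.

Lemma same_pt_scale (v w : 'rV[K]_3) : v != 0 -> w != 0 ->
  same_pt v w <-> exists2 k, k != 0 & w = k *: v.
Proof.
move=> v0 w0; split; first by move=> /eqP/(same_ptP _ v0).
by move=> h; apply/eqP/(same_ptP _ v0).
Qed.

(** Equality of rational maps is tested on points where both are defined; this
    relation to a homology is stable under it. *)
Definition acts_as (f : ratmap K) a := forall v, on_curve F v -> eval_map f v != 0 ->
  exists2 k, k != 0 & eval_map f v = k *: homol a v.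

Lemma acts_as_hmap a : acts_as (hmap a) a.
Proof. by move=> v _ _; exists 1; rewrite ?oner_neq0 // scale1r eval_hmap. Qed.

Lemma acts_as_eq f g a : acts_as f a -> acts_as g a -> ratmap_eq F f g.
Proof.
move=> fa ga v Cv fv gv; have [k k0 ef] := fa v Cv fv; have [k' k'0 eg] := ga v Cv gv.
apply/(same_pt_scale fv gv); exists (k' / k); first by rewrite mulf_neq0 ?invr_eq0.
by rewrite ef eg scalerA divfK.
Qed.

(** Two homologies that agree where [f] and [g] are both defined agree at a
    point off the axis, which exists because the curve is integral. *)
Lemma acts_as_inj f g a b : is_ratmap F f -> is_ratmap F g -> ratmap_eq F f g ->
  acts_as f a -> acts_as g b -> a = b.
Proof.
move=> [[e1 hf] [v1 Cv1 fv1] _] [[e2 hg] [v2 Cv2 gv2] _] efg fa gb.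
apply/eqP; apply: contraT => /eqP ab.
have nz (v : 'rV[K]_3) : v != 0 -> exists i, v 0 i != 0.
  move=> v0; apply/existsP; apply: contraNT v0; rewrite negb_exists => /forallP h.
  by apply/eqP/rowP => i; apply/eqP; rewrite mxE; have := h i; rewrite negbK.
have [i fi] := nz _ fv1; have [j gj] := nz _ gv2; rewrite !mxE in fi gj.
pose L : {mpoly K[3]} := \sum_k pol k 0 *: 'X_k.
have evL (v : 'rV[K]_3) : L.@[v 0] = lf pol v.
  by rewrite raddf_sum /lf mxE; apply: eq_bigr => k _; rewrite /= mevalZ mevalXU mulrC.
have hL : L \is 1.-homog.
  apply: rpred_sum => k _; apply: rpredZ.
  by rewrite dhomogX; apply/eqP; exact: mdeg1.
have h0 v : on_curve F v -> (f i * g j).@[v 0] * L.@[v 0] = 0.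
  move=> Cv; rewrite mevalM evL; apply/eqP; apply: contraT.
  rewrite !mulf_eq0 !negb_or => /andP[/andP[fvi gvj] lv].
  have fv : eval_map f v != 0 by apply: contraNneq fvi => h; have := congr1 (fun u : 'rV[K]_3 => u 0 i) h; rewrite !mxE => ->.
  have gv : eval_map g v != 0 by apply: contraNneq gvj => h; have := congr1 (fun u : 'rV[K]_3 => u 0 j) h; rewrite !mxE => ->.
  have [k k0 ef] := fa v Cv fv; have [k' k'0 eg] := gb v Cv gv.
  have [c c0' ec] := (same_pt_scale fv gv).1 (efg v Cv fv gv).
  case: ab; apply: (@homol_inj a b v (k^-1 * (c^-1 * k')) Cv lv).
  by rewrite -2!scalerA -eg ec (scalerK c0') ef (scalerK k0).
have [h|h] := curve_domain_gen (dhomogM (hf i) (hg j)) hL h0; last first.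
  by have [v Cv] := polar_not_vanish; rewrite -evL h // eqxx.
have [] := curve_domain_gen (hf i) (hg j) => [v Cv|h1|h1].
- by rewrite -mevalM h.
- by move: fi; rewrite h1 // eqxx.
- by move: gj; rewrite h1 // eqxx.
Qed.

Lemma card_GP n : card_G F P n <-> card_mod eq (fun a => a != 0 /\ homology a) n.
Proof.
split=> -[e [eA einj ecov]].
  have [al hal] := fin_all_exists (fun i => in_G_homology (eA i)).
  exists al; split=> [i|i j eij|a [a0 ha]].
  - by have [] := hal i.
  - apply: einj; apply: (acts_as_eq (a := al i)); first by have [] := hal i.
    by rewrite eij; have [] := hal j.
  - have [i hi] := ecov _ (hmap_in_G a0 ha); exists i.
    have [_ _ hia] := hal i.
    exact: (acts_as_inj (hmap_is_ratmap ha) (proj1 (proj1 (eA i))) hi (@acts_as_hmap a) hia).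
exists (fun i => hmap (e i)); split=> [i|i j eij|f Gf].
- by have [? ?] := eA i; apply: hmap_in_G.
- apply: einj; have [? hi] := eA i; have [? hj] := eA j.
  exact: (acts_as_inj (hmap_is_ratmap hi) (hmap_is_ratmap hj) eij (@acts_as_hmap _) (@acts_as_hmap _)).
- have [a [a0 ha fa]] := in_G_homology Gf.
  have [i ai] := ecov a (conj a0 ha); exists i; rewrite -ai.
  exact: acts_as_eq fa (@acts_as_hmap a).
Qed.

End Center.
End Homologies.

(** * Counting up to an equivalence *)

Section CardMod.
Variables (T : Type) (E : T -> T -> Prop).

Lemma card_mod_fin (A : T -> Prop) (I : finType) (e : I -> T) :
  (forall i, A (e i)) -> (forall i j, E (e i) (e j) -> i = j) ->
  (forall x, A x -> exists i, E x (e i)) -> card_mod E A #|I|.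
Proof.
move=> eA einj ecov; exists (fun i => e (enum_val i)); split=> [i|i j|x /ecov[i xi]] //.
  by move/einj/enum_val_inj.
by exists (enum_rank i); rewrite enum_rankK.
Qed.

Lemma eq_card_mod (A B : T -> Prop) n : (forall x, A x <-> B x) -> card_mod E A n -> card_mod E B n.
Proof.
move=> AB [e [eA einj ecov]]; exists e; split=> // [i|x /AB]; last exact: ecov.
exact/AB.
Qed.

Hypotheses (Esym : forall x y, E x y -> E y x) (Etrans : forall x y z, E x y -> E y z -> E x z).

Lemma card_mod_leq A n m : card_mod E A n -> card_mod E A m -> (n <= m)%N.
Proof.
move=> [e [eA einj _]] [e' [_ _ ecov']].
have [f hf] := fin_all_exists (fun i => ecov' _ (eA i)).
have finj : injective f.
  by move=> i j ij; apply: einj; apply: (Etrans (hf i)); rewrite ij; exact: Esym.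
by have := leq_card f finj; rewrite !card_ord.
Qed.

Lemma card_mod_unique A n m : card_mod E A n -> card_mod E A m -> n = m.
Proof. by move=> h h'; apply/eqP; rewrite eqn_leq !(card_mod_leq (A := A)). Qed.

End CardMod.

(** * Centers of order three of a smooth sextic *)

Section Coefs.
Variable K : closedFieldType.

(** Polynomial identities below are compared coefficient by coefficient, the
    coefficients being listed in increasing degree. *)
Definition horner_seq (s : seq K) (u : K) := foldr (fun a r => a + r * u) 0 s.

Lemma horner_seq_eq0 s : (forall u, u != 0 -> horner_seq s u = 0) -> forall i, nth 0 s i = 0.
Proof.
move=> h i; rewrite -coef_Poly.
suff -> : Poly s = 0 by rewrite coef0.
apply: (@poly_eq0_cofin _ _ 'X); first by rewrite polyX_eq0.
move=> u; rewrite hornerX => /h <-; rewrite horner_Poly.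
by elim: s {h} => //= a s ->; rewrite addrC.
Qed.
End Coefs.

Section Sextic.
Variable K : closedFieldType.
Hypothesis charK0 : [pchar K] =i pred0.
Variable w : K.
Hypothesis hw : w ^+ 2 + w + 1 = 0.
Lemma nat_neq0 n : (0 < n)%N -> (n%:R : K) != 0.
Proof. by move=> n0; rewrite (pcharf0P K).1 // -lt0n. Qed.

Lemma w3 : w ^+ 3 = 1.
Proof.
have e : w ^+ 3 - 1 = (w - 1) * (w ^+ 2 + w + 1) by ring.
by apply/eqP; rewrite -subr_eq0 e hw mulr0.
Qed.
Lemma w_neq1 : w != 1.
Proof.
apply/eqP => w1; have := hw; rewrite w1 => /eqP; rewrite (_ : 1 ^+ 2 + 1 + 1 = 3); last by ring.
by rewrite (negPf (nat_neq0 _)).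
Qed.
Lemma w_neq0 : w != 0.
Proof. by apply: contraNneq w_neq1 => w0; have := w3; rewrite w0 expr0n => /eqP; rewrite eq_sym oner_eq0. Qed.
Lemma w2_neq1 : w ^+ 2 != 1.
Proof.
by apply: contraNneq w_neq1 => h; have := w3; rewrite exprS h mulr1 => ->.
Qed.
Lemma w2_neqw : w ^+ 2 != w.
Proof. by apply: contraNneq w_neq1 => h; apply/eqP/(mulfI w_neq0); rewrite mulr1 -expr2. Qed.
Lemma cube_root x : x ^+ 3 = 1 -> [\/ x = 1, x = w | x = w ^+ 2].
Proof.
move=> h; have : (x - 1) * (x - w) * (x - w ^+ 2) = 0.
  transitivity (x ^+ 3 - 1 + x * w ^+ 3 - w ^+ 3 + 1 - x + (x - x ^+ 2) * (w ^+ 2 + w + 1)).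
    by ring.
  by rewrite h w3 hw; ring.
move/eqP; rewrite !mulf_eq0 !subr_eq0 -orbA => /or3P[] /eqP; by [constructor 1|constructor 2|constructor 3].
Qed.

Variable F : {mpoly K[3]}.
Hypotheses (hF : F \is 6.-homog) (smF : smooth_curve F).
Implicit Types (P Q R O k v : 'rV[K]_3).
Notation ev v := (F.@[v 0]).
Notation lam P := (lf (pol 6 F P)).
Notation homology := (homology 6 F).

(** A homology of order three with this center preserves the curve; the group
    of the point may be larger. *)
Definition center3 P := ev P != 0 /\ homology P w.

Lemma lamP P : ev P != 0 -> lam P P = 1.
Proof. exact: lf_polP. Qed.

Lemma lamZ P c v : lam P (c *: v) = c * lam P v. Proof. exact: lfZ. Qed.
Lemma lamD P v v' : lam P (v + v') = lam P v + lam P v'. Proof. exact: lfD. Qed.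
Lemma evZ c v : ev (c *: v) = c ^+ 6 * ev v. Proof. exact: meval_homog. Qed.

(** The restriction of [F] to the line [v + t v'] has degree six, and its
    coefficient of degree one is the differential at [v]. *)
Lemma line_expand v v' : exists c1 c2 c3 c4 c5, forall t,
  ev (v + t *: v') = horner_seq [:: ev v; c1; c2; c3; c4; c5; ev v'] t /\ c1 = dform F v v'.
Proof.
pose q := line v v' F; have [sq q6] := line_top v v' hF.
exists q`_1, q`_2, q`_3, q`_4, q`_5 => t; split.
  rewrite -line_horner (horner_coef_wide _ sq) !big_ord_recl big_ord0 /= q6.
  have -> : ev v = q`_0 by rewrite -horner_coef0 line_horner scale0r addr0.
  by rewrite /bump /=; ring.
have := line_deriv v v' F 0; rewrite scale0r addr0 => <-.
by rewrite -/q horner_coef0 coef_deriv.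
Qed.

Lemma homology_line P a k u : ev P != 0 -> homology P a -> lam P k = 0 ->
  ev (k + (a * u) *: P) = a ^+ 6 * ev (k + u *: P).
Proof.
move=> P0 ha k0; rewrite -ha /homol lamD lamZ lamP // k0 add0r mulr1.
have -> // : k + u *: P + ((a - 1) * u) *: P = k + (a * u) *: P.
by apply/rowP => j; rewrite !mxE; ring.
Qed.

Lemma split_center P v : ev P != 0 -> exists2 k, lam P k = 0 & v = k + lam P v *: P.
Proof.
move=> P0; exists (v - lam P v *: P); last by rewrite subrK.
by rewrite -scaleNr lamD lamZ lamP // mulr1 subrr.
Qed.

(** Only the powers of [u] fixed by [u |-> w u] remain. *)
Lemma center3_line P k : center3 P -> lam P k = 0 -> exists b, forall u,
  ev (k + u *: P) = ev k + b * u ^+ 3 + ev P * u ^+ 6.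
Proof.
move=> [P0 hP] k0; have [c1 [c2 [c3 [c4 [c5 h]]]]] := line_expand k P.
have w6 : w ^+ 6 = 1 by rewrite (exprM w 3 2) w3 expr1n.
have /horner_seq_eq0 z : forall u, u != 0 -> horner_seq [:: 0; c1 * (w - 1); c2 * (w ^+ 2 - 1); 0; c4 * (w - 1); c5 * (w ^+ 2 - 1); 0] u = 0.
  move=> u _; have := homology_line u P0 hP k0; rewrite w6 mul1r (h _).1 (h _).1 /= => e.
  transitivity (horner_seq [:: ev k; c1; c2; c3; c4; c5; ev P] (w * u) - horner_seq [:: ev k; c1; c2; c3; c4; c5; ev P] u); last by rewrite /= e subrr.
  rewrite /=; transitivity (c1 * (w - 1) * u + c2 * (w ^+ 2 - 1) * u ^+ 2 + c3 * (w ^+ 3 - 1) * u ^+ 3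
    + c4 * (w ^+ 3 * w - 1) * u ^+ 4 + c5 * (w ^+ 3 * w ^+ 2 - 1) * u ^+ 5 + ev P * (w ^+ 6 - 1) * u ^+ 6); last by ring.
  by rewrite w3 w6; ring.
have w1 : w - 1 != 0 by rewrite subr_eq0 w_neq1.
have w2 : w ^+ 2 - 1 != 0 by rewrite subr_eq0 w2_neq1.
have cz i c e : nth 0 [:: 0; c1 * (w - 1); c2 * (w ^+ 2 - 1); 0; c4 * (w - 1); c5 * (w ^+ 2 - 1); 0] i = c * e -> e != 0 -> c = 0.
  by move=> e1 e0; have := z i; rewrite e1 => /eqP; rewrite mulf_eq0 (negPf e0) orbF => /eqP.
exists c3 => u; rewrite (h u).1 /= (cz 1%N _ _ erefl w1) (cz 2%N _ _ erefl w2) (cz 4%N _ _ erefl w1) (cz 5%N _ _ erefl w2).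
ring.
Qed.

(** To recognize a center it is enough to exhibit a linear form [m]; it is then
    the polar form. *)
Lemma center3_intro P (m : 'cV[K]_3) : ev P != 0 -> lf m P = 1 ->
  (forall v, ev (v + ((w - 1) * lf m v) *: P) = ev v) ->
  center3 P /\ forall v, lam P v = lf m v.
Proof.
move=> P0 mP h; have w6 : w ^+ 6 = 1 by rewrite (exprM w 3 2) w3 expr1n.
have lfs v : lf ((w - 1) *: m) v = (w - 1) * lf m v by rewrite /lf -scalemxAr [LHS]mxE.
have w1 : w - 1 != 0 by rewrite subr_eq0 w_neq1.
have e v : lam P v = lf m v.
  apply: (mulfI w1); rewrite -[RHS]lfs; symmetry.
  apply: (homology_form charK0 hF isT P0 w_neq0); first by rewrite lfs mP mulr1.
  by move=> v'; rewrite lfs h w6 mul1r.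
by split=> //; split=> // v; rewrite /homol e h w6 mul1r.
Qed.

(** The scalars of homologies form a group.  If it has three elements,
    multiplication by one of them permutes all, so comparing products their
    cubes are 1, and [w] is among them.  Conversely, if [w] is a scalar and [a]
    is a scalar with [a^3 != 1], the coefficient of [u^3] in [center3_line]
    vanishes on all lines, and then -1 is a scalar. *)
Lemma card3P P : ev P != 0 ->
  card_G F P 3 <-> (homology P w /\ ~ homology P (-1)).
Proof.
move=> P0; rewrite (card_GP charK0 hF smF isT P0); split.
  move=> [e [eA einj ecov]].
  have cube a : a != 0 -> homology P a -> a ^+ 3 = 1.
    move=> a0 ha; have /fin_all_exists[s hs] i : exists j, a * e i = e j.
      by have [ei0 hi] := eA i; apply: ecov; split; [rewrite mulf_neq0|exact: homologyM].
    have sinj : injective s.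
      by move=> i j eij; apply: einj; apply: (mulfI a0); rewrite !hs eij.
    have prod0 : \prod_i e i != 0 by apply/prodf_neq0 => i _; have [] := eA i.
    apply: (mulIf prod0); rewrite mul1r [RHS](reindex_inj sinj) /=.
    have -> : a ^+ 3 = \prod_(i < 3) a by rewrite prodr_const card_ord.
    rewrite -big_split /=; apply: eq_bigr => i _; exact: hs.
  have ecube i : e i ^+ 3 = 1 by have [? ?] := eA i; apply: cube.
  split; last first.
    move=> h; have := cube (-1); rewrite oppr_eq0 oner_eq0 => /(_ isT h)/eqP.
    rewrite -subr_eq0 (_ : (-1) ^+ 3 - 1 = - (2)); last by ring.
    by rewrite oppr_eq0 (negPf (nat_neq0 _)).
  have : exists i, e i = w.
    apply: NNPP => nex.
    have h i : e i = 1 \/ e i = w ^+ 2.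
      by case: (cube_root (ecube i)) => h; [left|case: nex; exists i|right].
    have d01 : e i0 <> e i1 by move=> /einj/(congr1 val).
    have d02 : e i0 <> e i2 by move=> /einj/(congr1 val).
    have d12 : e i1 <> e i2 by move=> /einj/(congr1 val).
    case: (h i0) => h0; case: (h i1) => h1; case: (h i2) => h2;
      by rewrite ?h0 ?h1 ?h2 in d01 d02 d12.
  by case=> i <-; have [] := eA i.
move=> [hw3 h2].
have cube a : a != 0 -> homology P a -> a ^+ 3 = 1.
  move=> a0 ha; apply/eqP; apply: contraT => a3; case: h2 => v.
  have [k k0 ek] := split_center v P0; set u := lam P v in ek.
  have [b hb] := center3_line (conj P0 hw3) k0.
  (* Invariance under [u |-> a u] multiplies the coefficient of [u^3] by [a^3]
     on one side and by [a^6] on the other. *)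
  have b0 : b = 0.
    have e1 t : a ^+ 6 * (ev k + b * t ^+ 3 + ev P * t ^+ 6) = ev k + b * (a * t) ^+ 3 + ev P * (a * t) ^+ 6.
      by rewrite -!hb homology_line.
    have /horner_seq_eq0/(_ 3%N)/= : forall t, t != 0 -> horner_seq [:: a ^+ 6 * ev k - ev k; 0; 0; b * (a ^+ 3 * (a ^+ 3 - 1))] t = 0.
      move=> t _; transitivity (a ^+ 6 * (ev k + b * t ^+ 3 + ev P * t ^+ 6) - (ev k + b * (a * t) ^+ 3 + ev P * (a * t) ^+ 6)).
        by rewrite /=; ring.
      by rewrite e1 subrr.
    have a30 : a ^+ 3 * (a ^+ 3 - 1) != 0 by rewrite mulf_neq0 ?expf_neq0 // subr_eq0.
    by move/eqP; rewrite mulf_eq0 (negPf a30) orbF => /eqP.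
  have -> : homol 6 F P (-1) v = k + (- u) *: P.
    rewrite /homol -/u {1}ek; apply/rowP => j; rewrite !mxE; ring.
  rewrite [in RHS]ek !hb b0; ring.
exists (fun i : 'I_3 => w ^+ i); split=> [i|i j|a [a0 ha]].
- split; first by rewrite expf_neq0 // w_neq0.
  by elim: (val i) => [|n IH]; [move=> v; rewrite homol1 expr1n mul1r|rewrite exprS; apply: homologyM].
- have p0 : w ^+ i0 = 1 by []. 
  have p1 : w ^+ i1 = w by [].
  have p2 : w ^+ i2 = w ^+ 2 by [].
  have n1 := negPf w_neq1; have n2 := negPf w2_neq1; have n3 := negPf w2_neqw.
  move: i j; apply: ord3_ind; apply: ord3_ind => //; rewrite ?p0 ?p1 ?p2 => /eqP;
    first [by rewrite n1 | by rewrite n2 | by rewrite n3 | by rewrite eq_sym n1 | by rewrite eq_sym n2 | by rewrite eq_sym n3].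
- case: (cube_root (cube a a0 ha)) => ->; [exists i0|exists i1|exists i2] => //=.
Qed.

(** * Two centers *)

Lemma center3Z P c : c != 0 -> center3 P -> center3 (c *: P) /\ forall v, lam (c *: P) v = c^-1 * lam P v.
Proof.
move=> c0 rP; have [P0 hP] := rP.
have lfs v : lf (c^-1 *: pol 6 F P) v = c^-1 * lam P v by rewrite /lf -scalemxAr [LHS]mxE.
have [] := @center3_intro (c *: P) (c^-1 *: pol 6 F P).
- by rewrite evZ mulf_neq0 // expf_neq0.
- by rewrite lfs lamZ lamP // mulr1 mulVf.
- move=> v; rewrite lfs scalerA.
  have -> : (w - 1) * (c^-1 * lam P v) * c = (w - 1) * lam P v by field.
  have w6 : w ^+ 6 = 1 by rewrite (exprM w 3 2) w3 expr1n.
  by have := hP v; rewrite /homol w6 mul1r.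
by move=> r1 r2; split=> // v; rewrite r2 lfs.
Qed.

(** This is [center3_line], homogenized. *)
Lemma center3_binary P R : center3 P -> lam P R = 0 -> exists a b, forall x y,
  ev (x *: P + y *: R) = ev P * (x ^+ 6 + a * x ^+ 3 * y ^+ 3 + b * y ^+ 6).
Proof.
move=> rP R0; have [P0 _] := rP; have [b hb] := center3_line rP R0.
exists (b / ev P), (ev R / ev P) => x y.
have [->|y0] := eqVneq y 0.
  by rewrite scale0r addr0 evZ !expr0n /= !mulr0 !addr0 mulrC.
have -> : x *: P + y *: R = y *: (R + (x / y) *: P).
  by apply/rowP => j; rewrite !mxE; field.
by rewrite evZ hb; field; rewrite P0 y0.
Qed.

(** Let [R = Q - P], which lies on the axis of [P], so that [F (x P + y R)] is
    a binary form in [x^3] and [y^3].  The vector [(1 - k) P - k R], where [k =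
    lambda_Q(P)], spans the axis of [Q] on this line, so the coefficients of
    [u^5], [u^4] and [u^2] in the direction of [Q] vanish.  These are linear
    equations in [a] and [b], whose compatibility is [(1 - k) (3 k - 1) (3 k -
    2) = 0]. *)
Lemma pair_line P Q : center3 P -> center3 Q -> lam P Q = 1 -> exists a b,
  (forall x y, ev (x *: P + y *: (Q - P)) = ev P * (x ^+ 6 + a * x ^+ 3 * y ^+ 3 + b * y ^+ 6))
  /\ [\/ [/\ 3 * lam Q P = 1, a = - 20 & b = - 8],
         [/\ 3 * lam Q P = 2, 2 * a = 5 & 8 * b = -1]
       | [/\ lam Q P = 1, a = 0 & b = 0]].
Proof.
move=> rP rQ PQ1; have [P0 _] := rP; have [Q0 _] := rQ; pose R := Q - P.
have R0 : lam P R = 0 by rewrite /R -scaleN1r lamD lamZ PQ1 lamP // mulN1r subrr.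
have [a [b hab]] := center3_binary rP R0; exists a, b; split=> //.
set k := lam Q P.
have QR : lam Q R = 1 - k by rewrite /R -scaleN1r lamD lamZ lamP // mulN1r.
have k0 : lam Q ((1 - k) *: P + (- k) *: R) = 0 by rewrite lamD !lamZ QR -/k; ring.
have [c hc] := center3_line rQ k0.
have eq u : ev P * ((u + (1 - k)) ^+ 6 + a * (u + (1 - k)) ^+ 3 * (u - k) ^+ 3 + b * (u - k) ^+ 6)
   = ev ((1 - k) *: P + (- k) *: R) + c * u ^+ 3 + ev Q * u ^+ 6.
  rewrite -hc -hab; have -> // : (u + (1 - k)) *: P + (u - k) *: (Q - P) = (1 - k) *: P + (- k) *: R + u *: Q.
  by apply/rowP => j; rewrite !mxE; ring.
(* The list holds the coefficients in [u] of the difference of the two sides of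
   [eq]. *)
pose r1 := 1 - k; pose r2 := - k.
have /horner_seq_eq0 z : forall u, u != 0 -> horner_seq [::
   ev P * (r1 ^+ 6 + a * r1 ^+ 3 * r2 ^+ 3 + b * r2 ^+ 6) - ev (r1 *: P + r2 *: R);
   ev P * (6 * r1 ^+ 5 + a * (3 * r1 ^+ 2 * r2 ^+ 3 + 3 * r1 ^+ 3 * r2 ^+ 2) + 6 * b * r2 ^+ 5);
   ev P * (15 * r1 ^+ 4 + a * (3 * r1 * r2 ^+ 3 + 9 * r1 ^+ 2 * r2 ^+ 2 + 3 * r1 ^+ 3 * r2) + 15 * b * r2 ^+ 4);
   ev P * (20 * r1 ^+ 3 + a * (r1 ^+ 3 + 9 * r1 ^+ 2 * r2 + 9 * r1 * r2 ^+ 2 + r2 ^+ 3) + 20 * b * r2 ^+ 3) - c;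
   ev P * (15 * r1 ^+ 2 + a * (3 * r1 ^+ 2 + 9 * r1 * r2 + 3 * r2 ^+ 2) + 15 * b * r2 ^+ 2);
   ev P * (6 * r1 + a * (3 * r1 + 3 * r2) + 6 * b * r2);
   ev P * (1 + a + b) - ev Q] u = 0.
  move=> u _; transitivity (ev P * ((u + r1) ^+ 6 + a * (u + r1) ^+ 3 * (u + r2) ^+ 3 + b * (u + r2) ^+ 6)
   - (ev (r1 *: P + r2 *: R) + c * u ^+ 3 + ev Q * u ^+ 6)).
    by rewrite /horner_seq /=; ring.
  by rewrite /r1 /r2 eq subrr.
have dv x : ev P * x = 0 -> x = 0 by move/eqP; rewrite mulf_eq0 (negPf P0) => /eqP.
have z5 := dv _ (z 5%N); have z4 := dv _ (z 4%N); have z2 := dv _ (z 2%N).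
rewrite /r1 /r2 in z5 z4 z2.
have n3 := nat_neq0 (isT : 0 < 3)%N; have n2 := nat_neq0 (isT : 0 < 2)%N.
have dvn n x : (0 < n)%N -> n%:R * x = 0 -> x = 0 :> K.
  by move=> n0 /eqP; rewrite mulf_eq0 (negPf (nat_neq0 n0)) => /eqP.
have e5 : 2 * (1 - k) + a * (1 - 2 * k) - 2 * b * k = 0.
  apply: (dvn 3%N) => //; rewrite -z5; ring.
have e4 : 10 * (1 - k) + a * (2 - 5 * k) = 0.
  apply: (dvn 3%N) => //; transitivity (2 * (0 : K) + 15 * k * 0); last by ring.
  rewrite -{1}z4 -e5; ring.
have e2 : (1 - k) * ((3 * k - 1) * (3 * k - 2)) = 0.
  apply: (dvn 30%N) => //.
  transitivity ((2 - 5 * k) * (2 * (0 : K) + 15 * k ^+ 3 * 0)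
     - (15 * k ^+ 3 * (1 - 2 * k) - 6 * k * (1 - k) * (1 - 5 * k + 5 * k ^+ 2)) * 0); last by ring.
  rewrite -{1}z2 -{1}e5 -e4; ring.
have kb : k = 0 -> False.
  move=> kz; rewrite kz in e4 e5.
  have a2 : a = - 2 by apply/eqP; rewrite -addr_eq0; apply/eqP; rewrite -e5; ring.
  have : 6 = 0 :> K by rewrite -e4 a2; ring.
  by apply/eqP; exact: nat_neq0.
have kn : k != 0 by apply/eqP.
move/eqP: e2; rewrite !mulf_eq0 !subr_eq0 => /or3P[/eqP k1|/eqP k1|/eqP k1].
- constructor 3; rewrite -k1 in e4 e5; split=> //.
    by apply: (dvn 3%N) => //; apply/eqP; rewrite -oppr_eq0; apply/eqP; rewrite -e4; ring.
  have az : a = 0 by apply: (dvn 3%N) => //; apply/eqP; rewrite -oppr_eq0; apply/eqP; rewrite -e4; ring.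
  by apply: (dvn 2%N) => //; apply/eqP; rewrite -oppr_eq0; apply/eqP; rewrite -e5 az; ring.
- constructor 1.
  have ea : a = - 20.
    apply/eqP; rewrite -addr_eq0; apply/eqP.
    transitivity (3 * (10 * (1 - k) + a * (2 - 5 * k)) + (3 * k - 1) * (10 + 5 * a)).
      by ring.
    by rewrite e4 k1 subrr; ring.
  split=> //; apply/eqP; rewrite -addr_eq0; apply/eqP; apply: (dvn 2%N) => //.
  transitivity (- 3 * (2 * (1 - k) + a * (1 - 2 * k) - 2 * b * k)
     - (3 * k - 1) * (2 + 2 * a + 2 * b) + 20 + a); first by ring.
  by rewrite e5 k1 ea; ring.
- constructor 2.
  have ea : 2 * a = 5.
    apply/eqP; rewrite -subr_eq0; apply/eqP; apply: (dvn 2%N) => //.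
    transitivity (- 3 * (10 * (1 - k) + a * (2 - 5 * k)) - (3 * k - 2) * (10 + 5 * a)).
      by ring.
    by rewrite e4 k1 subrr; ring.
  split=> //; apply/eqP; rewrite -addr_eq0; apply/eqP.
  transitivity (- 6 * (2 * (1 - k) + a * (1 - 2 * k) - 2 * b * k)
     - (3 * k - 2) * (4 + 4 * a + 4 * b) + 5 - 2 * a); first by ring.
  by rewrite e5 k1 ea; ring.
Qed.

(** * Normal forms *)

Lemma natM_eq0 n (x : K) : (0 < n)%N -> n%:R * x = 0 -> x = 0.
Proof. by move=> n0 /eqP; rewrite mulf_eq0 (negPf (nat_neq0 n0)) => /eqP. Qed.

Lemma lamB P v v' : lam P (v - v') = lam P v - lam P v'.
Proof. by rewrite -scaleN1r lamD lamZ mulN1r. Qed.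

Lemma ev0 : ev (0 : 'rV[K]_3) = 0.
Proof. by rewrite -(scale0r (0 : 'rV[K]_3)) evZ expr0n mul0r. Qed.

(** The coefficient of [x^3] in [center3_line], expressed by values of [F]. *)
Lemma center3_cubic P k x : center3 P -> lam P k = 0 ->
  ev (k + x *: P) = ev k + (ev (k + P) - ev k - ev P) * x ^+ 3 + ev P * x ^+ 6.
Proof.
move=> rP k0; have [b hb] := center3_line rP k0.
by have := hb 1; rewrite scale1r => ->; rewrite hb; ring.
Qed.

(** The coefficient of [x^3] is homogeneous of degree three in [(y, z)], and
    polynomial in [z] for [y = 1] and in [y] for [z = 1]; hence it is a cubic
    form. *)
Lemma normal_form P R O : center3 P -> lam P R = 0 -> lam P O = 0 ->
  exists b0 b1 b2 b3 c0 c1 c2 c3 c4 c5 c6, forall x y z,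
  ev (x *: P + y *: R + z *: O) = ev P * x ^+ 6
    + x ^+ 3 * (b0 * y ^+ 3 + b1 * y ^+ 2 * z + b2 * y * z ^+ 2 + b3 * z ^+ 3)
    + (c0 * y ^+ 6 + c1 * y ^+ 5 * z + c2 * y ^+ 4 * z ^+ 2 + c3 * y ^+ 3 * z ^+ 3
       + c4 * y ^+ 2 * z ^+ 4 + c5 * y * z ^+ 5 + c6 * z ^+ 6).
Proof.
move=> rP R0 O0; pose B k := ev (k + P) - ev k - ev P.
have [c1 [c2 [c3 [c4 [c5 hc]]]]] := line_expand R O.
have {}hc t := (hc t).1.
(* The restriction to the axis, homogenized. *)
have hc' y z : ev (y *: R + z *: O) = ev R * y ^+ 6 + c1 * y ^+ 5 * z + c2 * y ^+ 4 * z ^+ 2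
    + c3 * y ^+ 3 * z ^+ 3 + c4 * y ^+ 2 * z ^+ 4 + c5 * y * z ^+ 5 + ev O * z ^+ 6.
  have [->|y0] := eqVneq y 0.
    by rewrite scale0r add0r evZ !expr0n /=; ring.
  have -> : y *: R + z *: O = y *: (R + (z / y) *: O).
    by apply/rowP => j; rewrite !mxE; field.
  by rewrite evZ hc /horner_seq /=; field.
have Bhom t k : lam P k = 0 -> t != 0 -> B (t *: k) = t ^+ 3 * B k.
  move=> k0 t0; rewrite /B; have -> : t *: k + P = t *: (k + t^-1 *: P).
    by apply/rowP => j; rewrite !mxE; field.
  by rewrite !evZ (center3_cubic _ rP k0) -/(B k); field.
have [d1 [d2 [d3 [d4 [d5 hd]]]]] := line_expand (P + R) O; have {}hd t := (hd t).1.
have [e1 [e2 [e3 [e4 [e5 he]]]]] := line_expand (P + O) R; have {}he t := (he t).1.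
have [f1 [f2 [f3 [f4 [f5 hf]]]]] := line_expand O R; have {}hf t := (hf t).1.
have B1 z : B (R + z *: O) = horner_seq [:: B R; d1 - c1; d2 - c2; d3 - c3; d4 - c4; d5 - c5] z.
  rewrite /B hc; have -> : R + z *: O + P = P + R + z *: O by rewrite addrC addrA.
  by rewrite hd /horner_seq /= [P + R]addrC; ring.
have B2 y : B (O + y *: R) = horner_seq [:: B O; e1 - f1; e2 - f2; e3 - f3; e4 - f4; e5 - f5] y.
  rewrite /B hf; have -> : O + y *: R + P = P + O + y *: R by rewrite addrC addrA.
  by rewrite he /horner_seq /= [P + O]addrC; ring.
have lRO z : lam P (R + z *: O) = 0 by rewrite lamD lamZ R0 O0 mulr0 addr0.
have /horner_seq_eq0 z : forall y, y != 0 -> horner_seq [:: d5 - c5; d4 - c4; d3 - c3 - B O; d2 - c2 - (e1 - f1);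
   d1 - c1 - (e2 - f2); B R - (e3 - f3); - (e4 - f4); - (e5 - f5)] y = 0.
  move=> y y0; have := Bhom y _ (lRO y^-1) y0.
  have -> : y *: (R + y^-1 *: O) = O + y *: R by apply/rowP => j; rewrite !mxE; field.
  rewrite B1 B2 /horner_seq /= => e.
  transitivity (y ^+ 2 * (y ^+ 3 * horner_seq [:: B R; d1 - c1; d2 - c2; d3 - c3; d4 - c4; d5 - c5] y^-1
    - horner_seq [:: B O; e1 - f1; e2 - f2; e3 - f3; e4 - f4; e5 - f5] y)).
    by rewrite /horner_seq /=; field.
  by rewrite /horner_seq /= -e subrr mulr0.
exists (B R), (d1 - c1), (d2 - c2), (d3 - c3), (ev R), c1, c2, c3, c4, c5, (ev O) => x y t.
have hB : B (y *: R + t *: O) = B R * y ^+ 3 + (d1 - c1) * y ^+ 2 * t + (d2 - c2) * y * t ^+ 2 + (d3 - c3) * t ^+ 3.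
  have z5 : d5 - c5 = 0 := z 0%N; have z4 : d4 - c4 = 0 := z 1%N.
  have z3 : d3 - c3 = B O by apply/eqP; rewrite -subr_eq0; apply/eqP; exact: (z 2%N).
  have [->|y0] := eqVneq y 0.
    rewrite scale0r add0r; have [->|t0] := eqVneq t 0.
      by rewrite scale0r /B add0r ev0; ring.
    by rewrite Bhom // z3; ring.
  have -> : y *: R + t *: O = y *: (R + (t / y) *: O).
    by apply/rowP => j; rewrite !mxE; field.
  by rewrite Bhom ?lRO // B1 z5 z4 /horner_seq /=; field.
have l0 : lam P (y *: R + t *: O) = 0 by rewrite lamD !lamZ R0 O0 !mulr0 addr0.
have -> : x *: P + y *: R + t *: O = (y *: R + t *: O) + x *: P by rewrite -addrA addrC.
by rewrite (center3_cubic _ rP l0) -/(B _) hB hc'; ring.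
Qed.

Lemma dform_coef v v' a0 a1 a2 a3 a4 a5 a6 :
  (forall t, ev (v + t *: v') = horner_seq [:: a0; a1; a2; a3; a4; a5; a6] t) -> dform F v v' = a1.
Proof.
move=> h; have [c1 [c2 [c3 [c4 [c5 hc]]]]] := line_expand v v'.
have [_ <-] := hc 0.
have /horner_seq_eq0/(_ 1%N)/= : forall t, t != 0 ->
    horner_seq [:: ev v - a0; c1 - a1; c2 - a2; c3 - a3; c4 - a4; c5 - a5; ev v' - a6] t = 0.
  move=> t _; have := h t; rewrite (hc t).1 => e.
  transitivity (horner_seq [:: ev v; c1; c2; c3; c4; c5; ev v'] t - horner_seq [:: a0; a1; a2; a3; a4; a5; a6] t).
    by rewrite /horner_seq /=; ring.
  by rewrite e subrr.
by move/eqP; rewrite subr_eq0 => /eqP.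
Qed.

Lemma singular_absurd P R O v : mx3 P R O \in unitmx -> v != 0 -> ev v = 0 ->
  dform F v P = 0 -> dform F v R = 0 -> dform F v O = 0 -> False.
Proof.
move=> Mu v0 Fv h0 h1 h2; apply: (dform_basis_eq0 smF Mu v0 Fv).
by rewrite mx3_row0 mx3_row1 mx3_row2.
Qed.

Lemma axis_basis P R : ev P != 0 -> R != 0 -> lam P R = 0 ->
  exists2 O, lam P O = 0 & mx3 P R O \in unitmx.
Proof.
move=> P0 R0 PR; have Pn0 : P != 0 by apply: contraNneq P0 => ->; rewrite ev0.
have nR : ~ exists c, R = c *: P.
  move=> [c e]; move: PR; rewrite e lamZ lamP // mulr1 => c0.
  by move: R0; rewrite e c0 scale0r eqxx.
have [M [Mu M1 M2]] := basis_ex Pn0 nR; set O1 := row i0 M.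
exists (O1 - lam P O1 *: P); first by rewrite lamB lamZ lamP // mulr1 subrr.
apply: mx3_unit => x y z e.
have : pt z y (x - z * lam P O1) *m M == 0.
  rewrite pt_mulmx M1 M2 -/O1 -[X in _ == X]e; apply/eqP/rowP => j; rewrite !mxE; ring.
rewrite mulmx_unit_eq0 // pt_eq0 => /and3P[/eqP z0 /eqP y0].
by rewrite z0 mul0r subr0 => /eqP x0.
Qed.

(** When both polar forms agree on the line [PQ], [pair_line] gives [F (x P + y
    R) = F(P) x^6].  In the normal form of [F] at [P] the coefficients of [y^6]
    and [x^3 y^3] are then zero.  Write [e = lambda_Q(O)].  Comparing the
    coefficients of [t^2] and [t^3] in the direction of [Q] shows that the
    coefficient [c1] of [y^5 z] vanishes.  So [R], a point of the curve, is
    singular. *)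
Lemma no_parallel_axes P Q : center3 P -> center3 Q -> lam P Q = 1 -> lam Q P = 1 -> Q = P.
Proof.
move=> rP rQ PQ QP; apply/eqP; apply: contraT; rewrite -subr_eq0 => R0; exfalso.
have [P0 _] := rP; have [Q0 _] := rQ; set R := Q - P in R0.
have [a [b [hab cases]]] := pair_line rP rQ PQ.
(* In the other cases of [pair_line], 3 would be equal to 1 or 2. *)
have [a0 b0'] : a = 0 /\ b = 0.
  case: cases; rewrite ?QP => -[] //; rewrite mulr1 => /eqP; rewrite -subr_eq0.
    by rewrite (_ : 3 - 1 = 2); [rewrite (negPf (nat_neq0 _))|ring].
  by rewrite (_ : 3 - 2 = 1); [rewrite oner_eq0|ring].
have PR : lam P R = 0 by rewrite lamB PQ lamP // subrr.
have QR : lam Q R = 0 by rewrite lamB QP lamP // subrr.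
have [O PO Mu] := axis_basis P0 R0 PR.
have [b0 [b1 [b2 [b3 [c0 [c1 [c2 [c3 [c4 [c5 [c6 nf]]]]]]]]]]] := normal_form rP PR PO.
have evR : ev R = 0.
  by have := hab 0 1; rewrite a0 b0' -/R scale0r add0r scale1r => ->; ring.
have c00 : c0 = 0.
  by have := nf 0 1 0; rewrite !scale0r add0r addr0 scale1r evR => h; rewrite [RHS]h; ring.
have b00 : b0 = 0.
  have := hab 1 1; rewrite a0 b0' -/R; have := nf 1 1 0; rewrite scale0r addr0 => -> e.
  apply/eqP; rewrite -subr_eq0; apply/eqP.
  rewrite c00 in e; move/eqP: e; rewrite -subr_eq0 => /eqP e; rewrite -[RHS]e; ring.
set e := lam Q O.
have c10 : c1 = 0.
  apply: (natM_eq0 (n := 10%N)) => //.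
  have /horner_seq_eq0/(_ 1%N)/= // : forall z, z != 0 -> horner_seq [:: 0; 10 * c1; 6 * c2 - 3 * e * (b1 + 10 * c1);
      3 * c3 - 3 * e * (b2 + 4 * c2);
      c4 - 15 * ev Q * e ^+ 4 - 3 * e * (b3 + c3 - 20 * ev Q * e ^+ 3)] z = 0.
  move=> z _; pose k := R + z *: (O - e *: Q).
  have kO : lam Q (O - e *: Q) = 0 by rewrite lamB lamZ lamP // mulr1 subrr.
  have k0 : lam Q k = 0 by rewrite /k lamD lamZ kO QR mulr0 addr0.
  have [B hB] := center3_line rQ k0.
  (* The parameter on the line is shifted by [f] so that [F] appears in the
     normal form at [P]. *)
  pose f := z * e.
  have /horner_seq_eq0 zt : forall t, t != 0 -> horner_seq [::
     c1 * z + c2 * z ^+ 2 + c3 * z ^+ 3 + c4 * z ^+ 4 + c5 * z ^+ 5 + c6 * z ^+ 6 - (ev k + B * f ^+ 3 + ev Q * f ^+ 6);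
     5 * c1 * z + 4 * c2 * z ^+ 2 + 3 * c3 * z ^+ 3 + 2 * c4 * z ^+ 4 + c5 * z ^+ 5 - (3 * B * f ^+ 2 + 6 * ev Q * f ^+ 5);
     10 * c1 * z + 6 * c2 * z ^+ 2 + 3 * c3 * z ^+ 3 + c4 * z ^+ 4 - (3 * B * f + 15 * ev Q * f ^+ 4);
     z * b1 + z ^+ 2 * b2 + z ^+ 3 * b3 + 10 * c1 * z + 4 * c2 * z ^+ 2 + c3 * z ^+ 3 - (B + 20 * ev Q * f ^+ 3);
     2 * b1 * z + b2 * z ^+ 2 + 5 * c1 * z + c2 * z ^+ 2 - 15 * ev Q * f ^+ 2;
     b1 * z + c1 * z - 6 * ev Q * f;
     ev P - ev Q] t = 0.
    move=> t _; have := hB (t + f).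
    have -> : k + (t + f) *: Q = t *: P + (t + 1) *: R + z *: O.
      by apply/rowP => j; rewrite /k /f /R !mxE; ring.
    rewrite nf c00 b00 => /eqP; rewrite -subr_eq0 => /eqP h; rewrite -[RHS]h /horner_seq /=; ring.
  have z2 := zt 2%N; have z3 := zt 3%N; rewrite /= in z2 z3.
  transitivity ((10 * c1 * z + 6 * c2 * z ^+ 2 + 3 * c3 * z ^+ 3 + c4 * z ^+ 4 - (3 * B * f + 15 * ev Q * f ^+ 4))
    - 3 * f * (z * b1 + z ^+ 2 * b2 + z ^+ 3 * b3 + 10 * c1 * z + 4 * c2 * z ^+ 2 + c3 * z ^+ 3 - (B + 20 * ev Q * f ^+ 3))).
    by rewrite /horner_seq /= /f; ring.
  by rewrite z2 z3; ring.
apply: (singular_absurd Mu R0 evR).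
- apply: (@dform_coef R P 0 0 0 0 0 0 (ev P)) => t.
  by have := nf t 1 0; rewrite scale0r addr0 scale1r addrC => ->; rewrite c00 b00 /horner_seq /=; ring.
- by rewrite (euler _ hF) evR mulr0.
- rewrite -c10; apply: (@dform_coef R O 0 c1 c2 c3 c4 c5 c6) => t.
  by have := nf 0 1 t; rewrite scale0r add0r scale1r => ->; rewrite c00 /horner_seq /=; ring.
Qed.

(** * The pencil of a noncommuting pair *)

(** The binary sextic is the form of an octahedron and [x^3 y + y^4] that of a
    tetrahedron; the homologies of order three of the plane centered at the
    vertices of the tetrahedron preserve both. *)
Definition pencil (a x y z : K) := z ^+ 6 + a * ((x ^+ 3 * y + y ^+ 4) * z ^+ 2)
  + (x ^+ 6 + 20 * x ^+ 3 * y ^+ 3 - 8 * y ^+ 6).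

Definition in_pencil a := exists M p, [/\ M \in unitmx, p != 0 &
  forall x y z, ev (pt x y z *m M) = p * pencil a x y z].

(** If [c] were zero, [O] would be a singular point; otherwise [O] can be
    scaled to make the coefficients of [x^6] and [z^6] equal. *)
Lemma in_pencil_from P R O (p s c : K) : mx3 P R O \in unitmx -> p != 0 ->
  (forall x y z, ev (x *: P + y *: R + z *: O) =
    p * (x ^+ 6 + 20 * x ^+ 3 * y ^+ 3 - 8 * y ^+ 6) + s * z ^+ 2 * (x ^+ 3 * y + y ^+ 4)
     + c * z ^+ 6) ->
  exists r, in_pencil (s * r ^+ 2 / p).
Proof.
move=> Mu p0 h; have indep x y z : x *: P + y *: R + z *: O = 0 -> [/\ x = 0, y = 0 & z = 0].
  rewrite -pt_mx3 => /eqP; rewrite mulmx_unit_eq0 // pt_eq0.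
  by case/and3P => /eqP -> /eqP -> /eqP ->.
have O0 : O != 0.
  apply/eqP => O0; have [] := indep 0 0 1; first by rewrite O0 !scale0r scaler0 !addr0.
  by move=> _ _ /eqP; rewrite oner_eq0.
have evO t : ev (t *: O) = c * t ^+ 6 by have := h 0 0 t; rewrite !scale0r !add0r => ->; ring.
have c0 : c != 0.
  apply/eqP => c0; have eO : ev O = 0 by have := evO 1; rewrite scale1r c0 mul0r.
  apply: (singular_absurd Mu O0 eO).
  - apply: (@dform_coef O P 0 0 0 0 0 0 p) => t.
    by have := h t 0 1; rewrite scale0r addr0 scale1r addrC => ->; rewrite c0 /horner_seq /=; ring.
  - apply: (@dform_coef O R 0 0 0 0 s 0 (- (8 * p))) => t.
    by have := h 0 t 1; rewrite scale0r add0r scale1r addrC => ->; rewrite c0 /horner_seq /=; ring.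
  - by rewrite (euler _ hF) eO mulr0.
have [r hr] : exists r, r ^+ 6 = p / c.
  have /closed_rootP[r] : size ('X^6 - (p / c)%:P : {poly K}) != 1%N by rewrite size_XnsubC.
  by rewrite rootE !hornerE subr_eq0 => /eqP; exists r.
have r0 : r != 0.
  by apply/eqP => r0; move/esym/eqP: hr; rewrite r0 expr0n mulf_eq0 invr_eq0 (negPf c0) (negPf p0).
exists r, (mx3 P R (r *: O)), p; split=> // [|x y z].
  apply: mx3_unit => x y z; rewrite scalerA => /indep[-> -> /eqP].
  by rewrite mulf_eq0 (negPf r0) orbF => /eqP.
rewrite pt_mx3 scalerA h /pencil !exprMn hr; field; by rewrite c0 p0.
Qed.

(** The lines from the points [al P + be R + z O] of the axis of [Q] to [Q],
    with [R = Q - P]: the coefficients of [u], [u^2], [u^4] and [u^5] vanish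
    identically in [z], which gives linear equations between the coefficients
    of the normal form of [F] at [P]. *)
Lemma axis_coefficients P Q O al be b0 b1 b2 b3 c0 c1 c2 c3 c4 c5 c6 :
  center3 Q -> al != 0 -> be != 0 -> al != be ->
  lam Q (al *: P + be *: (Q - P)) = 0 -> lam Q O = 0 ->
  (forall x y z, ev (x *: P + y *: (Q - P) + z *: O) = ev P * x ^+ 6
    + x ^+ 3 * (b0 * y ^+ 3 + b1 * y ^+ 2 * z + b2 * y * z ^+ 2 + b3 * z ^+ 3)
    + (c0 * y ^+ 6 + c1 * y ^+ 5 * z + c2 * y ^+ 4 * z ^+ 2 + c3 * y ^+ 3 * z ^+ 3
       + c4 * y ^+ 2 * z ^+ 4 + c5 * y * z ^+ 5 + c6 * z ^+ 6)) ->
  [/\ b1 = 0 /\ c1 = 0, b3 = 0 /\ c3 = 0, c4 = 0 /\ c5 = 0, c2 = - b2 & (al + 2 * be) * b2 = 0].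
Proof.
move=> rQ al0 be0 ab hk QO nf; have ab0 : al - be != 0 by rewrite subr_eq0.
pose C5 z := 6 * al * ev P + 3 * (al + be) * b0 + b1 * z + 6 * be * c0 + c1 * z.
pose C4 z := 15 * al ^+ 2 * ev P + 3 * (al ^+ 2 + 3 * al * be + be ^+ 2) * b0 + (3 * al + 2 * be) * b1 * z
  + b2 * z ^+ 2 + 15 * be ^+ 2 * c0 + 5 * be * c1 * z + c2 * z ^+ 2.
pose C2 z := 15 * al ^+ 4 * ev P + 3 * al * be * (al ^+ 2 + 3 * al * be + be ^+ 2) * b0
  + al * (al ^+ 2 + 6 * al * be + 3 * be ^+ 2) * b1 * z + 3 * al * (al + be) * b2 * z ^+ 2 + 3 * al * b3 * z ^+ 3
  + 15 * be ^+ 4 * c0 + 10 * be ^+ 3 * c1 * z + 6 * be ^+ 2 * c2 * z ^+ 2 + 3 * be * c3 * z ^+ 3 + c4 * z ^+ 4.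
pose C1 z := 6 * al ^+ 5 * ev P + 3 * al ^+ 2 * be ^+ 2 * (al + be) * b0 + al ^+ 2 * be * (2 * al + 3 * be) * b1 * z
  + al ^+ 2 * (al + 3 * be) * b2 * z ^+ 2 + 3 * al ^+ 2 * b3 * z ^+ 3
  + 6 * be ^+ 5 * c0 + 5 * be ^+ 4 * c1 * z + 4 * be ^+ 3 * c2 * z ^+ 2 + 3 * be ^+ 2 * c3 * z ^+ 3 + 2 * be * c4 * z ^+ 4 + c5 * z ^+ 5.
have hu z : [/\ C5 z = 0, C4 z = 0, C2 z = 0 & C1 z = 0].
  pose v := (al *: P + be *: (Q - P)) + z *: O.
  have v0 : lam Q v = 0 by rewrite /v lamD lamZ hk QO mulr0 addr0.
  have [B hB] := center3_line rQ v0.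
  pose D0 := ev (al *: P + be *: (Q - P) + z *: O) - ev v.
  pose D3 := 20 * al ^+ 3 * ev P + (al ^+ 3 + 9 * al ^+ 2 * be + 9 * al * be ^+ 2 + be ^+ 3) * b0
    + (3 * al ^+ 2 + 6 * al * be + be ^+ 2) * b1 * z + (3 * al + be) * b2 * z ^+ 2 + b3 * z ^+ 3
    + 20 * be ^+ 3 * c0 + 10 * be ^+ 2 * c1 * z + 4 * be * c2 * z ^+ 2 + c3 * z ^+ 3 - B.
  have /horner_seq_eq0 zt : forall u, u != 0 -> horner_seq [:: D0; C1 z; C2 z; D3; C4 z; C5 z; ev P + b0 + c0 - ev Q] u = 0.
    move=> u _; have := hB u.
    have -> : v + u *: Q = (u + al) *: P + (u + be) *: (Q - P) + z *: O.
      by apply/rowP => j; rewrite /v !mxE; ring.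
    by rewrite nf => /eqP; rewrite -subr_eq0 => /eqP h; rewrite -[RHS]h /D0 nf /C1 /C2 /D3 /C4 /C5 /horner_seq /=; ring.
  by split; [exact: (zt 5%N)|exact: (zt 4%N)|exact: (zt 2%N)|exact: (zt 1%N)].
have /horner_seq_eq0 v5 : forall z, z != 0 -> horner_seq [:: 6 * al * ev P + 3 * (al + be) * b0 + 6 * be * c0; b1 + c1] z = 0.
  by move=> z _; have [h5 _ _ _] := hu z; rewrite -[RHS]h5 /C5 /horner_seq /=; ring.
have /horner_seq_eq0 v4 : forall z, z != 0 -> horner_seq [:: C4 0; (3 * al + 2 * be) * b1 + 5 * be * c1; b2 + c2] z = 0.
  by move=> z _; have [_ h4 _ _] := hu z; rewrite -[RHS]h4 /C4 /horner_seq /=; ring.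
have /horner_seq_eq0 v2 : forall z, z != 0 -> horner_seq [:: C2 0; al * (al ^+ 2 + 6 * al * be + 3 * be ^+ 2) * b1 + 10 * be ^+ 3 * c1;
    3 * al * (al + be) * b2 + 6 * be ^+ 2 * c2; 3 * al * b3 + 3 * be * c3; c4] z = 0.
  by move=> z _; have [_ _ h2 _] := hu z; rewrite -[RHS]h2 /C2 /horner_seq /=; ring.
have /horner_seq_eq0 v1 : forall z, z != 0 -> horner_seq [:: C1 0; al ^+ 2 * be * (2 * al + 3 * be) * b1 + 5 * be ^+ 4 * c1;
    al ^+ 2 * (al + 3 * be) * b2 + 4 * be ^+ 3 * c2; 3 * al ^+ 2 * b3 + 3 * be ^+ 2 * c3; 2 * be * c4; c5] z = 0.
  by move=> z _; have [_ _ _ h1] := hu z; rewrite -[RHS]h1 /C1 /horner_seq /=; ring.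
have e51 : b1 + c1 = 0 := v5 1%N.
have e41 : (3 * al + 2 * be) * b1 + 5 * be * c1 = 0 := v4 1%N.
have e42 : b2 + c2 = 0 := v4 2%N.
have e22 : 3 * al * (al + be) * b2 + 6 * be ^+ 2 * c2 = 0 := v2 2%N.
have e23 : 3 * al * b3 + 3 * be * c3 = 0 := v2 3%N.
have e13 : 3 * al ^+ 2 * b3 + 3 * be ^+ 2 * c3 = 0 := v1 3%N.
have cancel (x y : K) : x != 0 -> x * y = 0 -> y = 0.
  by move=> x0 /eqP; rewrite mulf_eq0 (negPf x0) => /eqP.
have b1z : b1 = 0.
  apply: (cancel (al - be)) => //; apply: (natM_eq0 (n := 3%N)) => //.
  transitivity (((3 * al + 2 * be) * b1 + 5 * be * c1) - 5 * be * (b1 + c1)); first by ring.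
  by rewrite e41 e51; ring.
have b3z : b3 = 0.
  apply: (cancel _ _ (mulf_neq0 al0 ab0)); apply: (natM_eq0 (n := 3%N)) => //.
  transitivity ((3 * al ^+ 2 * b3 + 3 * be ^+ 2 * c3) - be * (3 * al * b3 + 3 * be * c3)); first by ring.
  by rewrite e13 e23; ring.
have c2z : c2 = - b2 by apply/eqP; rewrite -addr_eq0 addrC e42.
split=> //.
- by split=> //; rewrite -[RHS]e51 b1z add0r.
- by split=> //; apply: (cancel _ _ be0); apply: (natM_eq0 (n := 3%N)) => //; rewrite -[RHS]e23 b3z; ring.
- by split; [exact: (v2 4%N)|exact: (v1 5%N)].
apply: (cancel (al - be)) => //; apply: (natM_eq0 (n := 3%N)) => //.
by rewrite -[RHS]e22 c2z; ring.
Qed.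

(** Choose [O] on both axes and take the normal form of [F] at [P].  The axis
    of [Q] meets the line [PQ] in [2 P - R] or in [P - 2 R], according to the
    value of [lambda_Q(P)]; in the second case [al + 2 be] is nonzero in
    [axis_coefficients], so that no coefficient of [z^2] remains. *)
Lemma pair_in_pencil P Q : center3 P -> center3 Q -> lam P Q = 1 -> Q != P ->
  (3 * lam Q P = 1 /\ exists a, in_pencil a) \/ (3 * lam Q P = 2 /\ in_pencil 0).
Proof.
move=> rP rQ PQ neq; have [P0 _] := rP; have [Q0 _] := rQ; set R := Q - P; set k := lam Q P.
have R0 : R != 0 by rewrite subr_eq0.
have k1 : k != 1 by apply/eqP => k1; move/eqP: neq; apply; exact: (no_parallel_axes rP rQ PQ k1).
have PR : lam P R = 0 by rewrite lamB PQ lamP // subrr.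
have QR : lam Q R = 1 - k by rewrite lamB lamP.
have [O1 PO1 Mu1] := axis_basis P0 R0 PR.
have k1' : 1 - k != 0 by rewrite subr_eq0 eq_sym.
(* [O] is moved along [R], which lies on the axis of [P], until it lies on the
   axis of [Q] too. *)
pose s := lam Q O1 / (1 - k); pose O := O1 - s *: R.
have PO : lam P O = 0 by rewrite lamB lamZ PO1 PR mulr0 subr0.
have QO : lam Q O = 0 by rewrite lamB lamZ QR divfK // subrr.
have Mu c : c != 0 -> mx3 P (c *: R) O \in unitmx.
  move=> c0; apply: mx3_unit => x y z; rewrite scalerA => e.
  have : pt x (y * c - z * s) z *m mx3 P R O1 == 0.
    rewrite pt_mx3 -[X in _ == X]e; apply/eqP/rowP => j; rewrite !mxE; ring.
  rewrite mulmx_unit_eq0 // pt_eq0 => /and3P[/eqP x0 /eqP y0 /eqP z0].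
  by split=> //; move/eqP: y0; rewrite z0 mul0r subr0 mulf_eq0 (negPf c0) orbF => /eqP.
have [a [b [hab cases]]] := pair_line rP rQ PQ; rewrite -/R -/k in hab cases.
have [b0 [b1 [b2 [b3 [c0 [c1 [c2 [c3 [c4 [c5 [c6 nf]]]]]]]]]]] := normal_form rP PR PO.
have ec0 : c0 = ev P * b.
  have := nf 0 1 0; have := hab 0 1; rewrite [0 *: O]scale0r addr0 => -> e.
  by apply/eqP; rewrite -subr_eq0; apply/eqP; move/eqP: e; rewrite -subr_eq0 => /eqP e; rewrite -oppr0 -[in RHS]e; ring.
have eb0 : b0 = ev P * a.
  have := nf 1 1 0; have := hab 1 1; rewrite [0 *: O]scale0r addr0 => -> e.
  by apply/eqP; rewrite -subr_eq0; apply/eqP; move/eqP: e; rewrite -subr_eq0 ec0 => /eqP e; rewrite -oppr0 -[in RHS]e; ring.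
have n2 : 2 != 0 :> K by exact: nat_neq0.
have coef al be : al != 0 -> be != 0 -> al - be = 3 -> lam Q (al *: P + be *: R) = 0 ->
    forall x y z, (al + 2 * be) * b2 = 0 /\ ev (x *: P + y *: R + z *: O) =
      ev P * (x ^+ 6 + a * x ^+ 3 * y ^+ 3 + b * y ^+ 6) + b2 * z ^+ 2 * (x ^+ 3 * y - y ^+ 4) + c6 * z ^+ 6.
  move=> al0 be0 ab hk; have ab' : al != be by rewrite -subr_eq0 ab nat_neq0.
  have [[b1z c1z] [b3z c3z] [c4z c5z] c2z e] := axis_coefficients rQ al0 be0 ab' hk QO nf.
  by move=> x y z; split=> //; rewrite nf ec0 eb0 b1z c1z b3z c3z c4z c5z c2z; ring.
case: cases => [[k3 ea eb]|[k3 ea eb]|[k3 _ _]]; [left|right|by rewrite k3 eqxx in k1].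
  split=> //.
  have hk : lam Q (2 *: P + (-1) *: R) = 0.
    by rewrite lamD !lamZ -/k QR; transitivity (3 * k - 1); [ring|rewrite k3 subrr].
  have n1 : -1 != 0 :> K by rewrite oppr_eq0 oner_eq0.
  have [|r hr] := in_pencil_from (p := ev P) (s := - b2) (c := c6) (Mu _ n1) P0; last by eexists; exact: hr.
  have h2 : 2 - -1 = 3 :> K by ring.
  move=> x y z; rewrite scalerA (coef _ _ n2 n1 h2 hk x _ z).2 ea eb; ring.
split=> //.
have hk : lam Q (1 *: P + (- 2) *: R) = 0.
  by rewrite lamD !lamZ -/k QR; transitivity (3 * k - 2); [ring|rewrite k3 subrr].
have h2 : 1 - - 2 = 3 :> K by ring.
have n2' : - 2 != 0 :> K by rewrite oppr_eq0.
have hc := coef _ _ (oner_neq0 K) n2' h2 hk.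
have b2z : b2 = 0.
  apply: (natM_eq0 (n := 3%N)) => //; apply: oppr_inj; rewrite oppr0 -[RHS](hc 0 0 0).1; ring.
have [|r] := in_pencil_from (p := ev P) (s := 0) (c := c6) (Mu _ n2) P0; last by rewrite !mul0r.
move=> x y z; rewrite scalerA (hc _ _ _).2 b2z.
transitivity (ev P * (x ^+ 6 + 4 * (2 * a) * x ^+ 3 * y ^+ 3 + 8 * (8 * b) * y ^+ 6) + c6 * z ^+ 6).
  by ring.
by rewrite ea eb; ring.
Qed.

(** * Centers of the members of the pencil *)

Notation goodpt P := [/\ P != 0, ~ on_curve F P, quasi_galois F P & card_G F P 3].

(** A cyclic group of order three is already quasi-Galois, so only the
    homologies matter. *)
Lemma good_pointP P : goodpt P <-> center3 P /\ ~ homology P (-1).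
Proof.
split=> [[P0 nP _ c3]|[[P0 hP] h2]].
  have FP : ev P != 0 by apply/eqP => FP; apply: nP.
  by have [h1 h2] := (card3P FP).1 c3; split.
have c3 := (card3P P0).2 (conj hP h2); split=> //.
- by apply: contraNneq P0 => ->; rewrite ev0.
- by case=> _ FP; rewrite FP eqxx in P0.
- have [e [eA einj _]] := c3; exists (e i0), (e i1); split=> //.
  by move/einj.
Qed.

(** Scaling [Q] makes [lambda_P(Q) = 1], as the results on pairs require.  The
    mutual value [lambda_P(Q) lambda_Q(P)] of two centers does not depend on
    the scaling. *)
Lemma scale_lam P Q : center3 P -> center3 Q -> lam P Q != 0 ->
  let Q' := (lam P Q)^-1 *: Q in
  [/\ center3 Q', lam P Q' = 1 & lam Q' P = lam P Q * lam Q P].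
Proof.
move=> rP rQ c0 Q'; have [|rQ' h] := center3Z (c := (lam P Q)^-1) _ rQ.
  by rewrite invr_eq0.
by split=> //; rewrite ?h ?invrK // lamZ mulVf.
Qed.

(** Two homologies commute when the center of each lies on the axis of the
    other.  One incidence implies the other, since [lambda_Q(P)] is never zero
    in [pair_line]. *)
Lemma lam_sym P Q : center3 P -> center3 Q -> lam P Q = 0 -> lam Q P = 0.
Proof.
move=> rP rQ PQ; apply/eqP; apply: contraT => QP0; exfalso.
have [rP' QP' P'Q] := scale_lam rQ rP QP0.
have [a [b [_ cases]]] := pair_line rQ rP' QP'.
move: cases; rewrite P'Q PQ !mulr0.
case=> -[] /esym/eqP; by rewrite ?oner_eq0 ?(negPf (nat_neq0 (isT : 0 < 2)%N)).
Qed.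

(** The form of [pair_in_pencil] which does not depend on the scalings of [P]
    and [Q]. *)
Lemma noncommuting P Q : center3 P -> center3 Q -> lam P Q != 0 -> ~ (exists c, Q = c *: P) ->
  (3 * (lam P Q * lam Q P) = 1 /\ exists a, in_pencil a) \/
  (3 * (lam P Q * lam Q P) = 2 /\ in_pencil 0).
Proof.
move=> rP rQ PQ0 ns; have [rQ' PQ' Q'P] := scale_lam rP rQ PQ0.
have neq : (lam P Q)^-1 *: Q != P.
  apply/eqP => e; apply: ns; exists (lam P Q).
  by rewrite -[X in _ *: X]e scalerA divff // scale1r.
by have := pair_in_pencil rP rQ' PQ' neq; rewrite Q'P.
Qed.

(** A center of order six commutes with all other centers: with [O] fixed by -1
    too, only the powers [u^0] and [u^6] occur on lines through [O], so [a = 0]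
    in [pair_line], which leaves the case excluded by [no_parallel_axes]. *)
Lemma order6_center O R : center3 O -> homology O (-1) -> center3 R -> lam O R != 0 ->
  exists2 c, c != 0 & R = c *: O.
Proof.
move=> rO h2 rR OR0; have [rR' OR' R'O] := scale_lam rO rR OR0; set R' := _ *: R in rR' OR' R'O.
have [O0 _] := rO.
suff e : R' = O by exists (lam O R) => //; rewrite -[X in _ *: X]e /R' scalerA divff // scale1r.
have [a [b [hab cases]]] := pair_line rO rR' OR'.
have k0 : lam O (1 *: (R' - O)) = 0.
  by rewrite lamZ lamB OR' lamP // subrr mulr0.
have := homology_line 1 O0 h2 k0; rewrite mulr1.
have -> : 1 *: (R' - O) + -1 *: O = (-1) *: O + 1 *: (R' - O) by rewrite addrC.
have -> : 1 *: (R' - O) + 1 *: O = 1 *: O + 1 *: (R' - O) by rewrite addrC.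
rewrite !hab => h; have a0 : a = 0.
  apply: (natM_eq0 (n := 2%N)) => //; apply: (mulfI O0); rewrite mulr0.
  apply/eqP; rewrite -oppr_eq0; apply/eqP; move/eqP: h; rewrite -subr_eq0 => /eqP h; rewrite -[RHS]h; ring.
move: cases; rewrite a0 mulr0 => -[[_ /esym/eqP]|[_ /esym/eqP]|[k1 _ _]].
- by rewrite oppr_eq0 (negPf (nat_neq0 _)).
- by rewrite (negPf (nat_neq0 _)).
- exact: (no_parallel_axes rO rR' OR' k1).
Qed.

Section Coordinates.
Variables (a p : K) (M : 'M[K]_3).
Hypotheses (Mu : M \in unitmx) (p0 : p != 0).
Hypothesis hg : forall x y z, ev (pt x y z *m M) = p * pencil a x y z.
Notation co x y z := (pt x y z *m M).

Lemma co_scale c x y z : c *: co x y z = co (c * x) (c * y) (c * z).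
Proof. by rewrite scalemxAl pt_scale. Qed.
Lemma co_add x y z x' y' z' : co x y z + co x' y' z' = co (x + x') (y + y') (z + z').
Proof. by rewrite -mulmxDl pt_add. Qed.
Lemma co_inj x y z x' y' z' : co x y z = co x' y' z' -> [/\ x = x', y = y' & z = z'].
Proof.
move=> e; have := mulmxK Mu (pt x y z); rewrite e mulmxK // => h.
have h0 := congr1 (fun v : 'rV[K]_3 => v 0 i0) h.
have h1 := congr1 (fun v : 'rV[K]_3 => v 0 i1) h.
have h2 := congr1 (fun v : 'rV[K]_3 => v 0 i2) h.
by move: h0 h1 h2; rewrite /= !pt0 !pt1 !pt2.
Qed.

Lemma lam_co Q x y z : lam Q (co x y z) =
  x * lam Q (row i0 M) + y * lam Q (row i1 M) + z * lam Q (row i2 M).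
Proof. by rewrite pt_mulmx !lamD !lamZ. Qed.

Lemma center3_co q1 q2 q3 m1 m2 m3 : q1 * m1 + q2 * m2 + q3 * m3 = 1 ->
  pencil a q1 q2 q3 != 0 ->
  (forall x y z, let l := x * m1 + y * m2 + z * m3 in
     pencil a (x + (w - 1) * l * q1) (y + (w - 1) * l * q2) (z + (w - 1) * l * q3) = pencil a x y z) ->
  center3 (co q1 q2 q3) /\ forall x y z, lam (co q1 q2 q3) (co x y z) = x * m1 + y * m2 + z * m3.
Proof.
move=> mq gq inv; pose m : 'cV[K]_3 := invmx M *m (pt m1 m2 m3)^T.
have lfm x y z : lf m (co x y z) = x * m1 + y * m2 + z * m3.
  by rewrite /lf /m mulmxA mulmxK // mxE sum3 !mxE.
have [||v|r h] := center3_intro (P := co q1 q2 q3) (m := m).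
- by rewrite hg mulf_neq0.
- by rewrite lfm.
- have [x [y [z ->]]] := coord_ex v Mu.
  by rewrite lfm co_scale co_add !hg inv.
- by split=> // x y z; rewrite h lfm.
Qed.

Lemma co_line q1 q2 q3 (k1 k2 k3 : K) : center3 (co q1 q2 q3) -> lam (co q1 q2 q3) (co k1 k2 k3) = 0 ->
  exists A B C, forall u, pencil a (k1 + u * q1) (k2 + u * q2) (k3 + u * q3) = A + B * u ^+ 3 + C * u ^+ 6.
Proof.
move=> rq k0; have [b hb] := center3_line rq k0.
exists (ev (co k1 k2 k3) / p), (b / p), (ev (co q1 q2 q3) / p) => u.
apply: (mulfI p0); rewrite -hg -co_add -co_scale hb; field; exact: p0.
Qed.

(** The vertices of a tetrahedron on the line z = 0: the roots of [y (x^3 +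
    y^3)]. *)
Definition inline_center (o : option 'I_3) := if o is Some i then co 1 (- w ^+ i) 0 else co 1 0 0.

Lemma cube_w u : (w * u) ^+ 3 = u ^+ 3.
Proof. by rewrite exprMn w3 mul1r. Qed.

Lemma w3i (i : 'I_3) : (w ^+ i) ^+ 3 = 1.
Proof. by rewrite exprAC w3 expr1n. Qed.

Lemma center3_P0 : center3 (co 1 0 0) /\ forall x y z, lam (co 1 0 0) (co x y z) = x.
Proof.
have [|||r h] := @center3_co 1 0 0 1 0 0; first by ring.
- by rewrite /pencil; rewrite (_ : _ + _ = 1) ?oner_eq0 //; ring.
- move=> x y z l; rewrite /l; transitivity (z ^+ 6 + a * ((w ^+ 3 * x ^+ 3 * y + y ^+ 4) * z ^+ 2)
    + ((w ^+ 3) ^+ 2 * x ^+ 6 + 20 * (w ^+ 3 * x ^+ 3) * y ^+ 3 - 8 * y ^+ 6)).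
    by rewrite /pencil; ring.
  by rewrite w3 /pencil; ring.
by split=> // x y z; rewrite h; ring.
Qed.

(** In the coordinates [u] along the center and [v] on its axis, the two forms
    of the pencil are polynomials in [u^3]. *)
Lemma center3_P n : n ^+ 3 = 1 -> center3 (co 1 (- n) 0) /\
  forall x y z, lam (co 1 (- n) 0) (co x y z) = (x - 2 * n ^+ 2 * y) / 3.
Proof.
move=> n3; have t0 := nat_neq0 (isT : 0 < 3)%N.
have e (u v z : K) : pencil a (u + 2 * v) (n * (v - u)) z =
   z ^+ 6 + a * (9 * n * v * (v ^+ 3 - u ^+ 3) * z ^+ 2)
    + (- 27 * (u ^+ 3) ^+ 2 + 540 * u ^+ 3 * v ^+ 3 + 216 * v ^+ 6).
  transitivity (z ^+ 6 + a * (n * (v - u) * ((u + 2 * v) ^+ 3 + n ^+ 3 * (v - u) ^+ 3) * z ^+ 2)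
    + ((u + 2 * v) ^+ 6 + 20 * (u + 2 * v) ^+ 3 * n ^+ 3 * (v - u) ^+ 3
       - 8 * (n ^+ 3) ^+ 2 * (v - u) ^+ 6)).
    by rewrite /pencil; ring.
  by rewrite n3; ring.
have [|||r h] := @center3_co 1 (- n) 0 (1 / 3) (- (2 * n ^+ 2 / 3)) 0.
- transitivity ((1 + 2 * n ^+ 3) / 3); first by field.
  by rewrite n3; field.
- have -> : pencil a 1 (- n) 0 = pencil a (1 + 2 * 0) (n * (0 - 1)) 0 by congr pencil; ring.
  rewrite e (_ : _ + _ = - 27); last by ring.
  by rewrite oppr_eq0 nat_neq0.
- move=> x y z l; pose u := l; pose v := (x + n ^+ 2 * y) / 3.
  have ex : x = u + 2 * v by rewrite /u /l /v; field.
  have ey : y = n * (v - u).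
    transitivity (n ^+ 3 * y); first by rewrite n3 mul1r.
    by rewrite /u /l /v; field.
  rewrite -/u [in RHS]ex [in RHS]ey e.
  have -> : x + (w - 1) * u * 1 = w * u + 2 * v by rewrite {1}ex; ring.
  have -> : y + (w - 1) * u * (- n) = n * (v - w * u) by rewrite {1}ey; ring.
  by rewrite mulr0 addr0 e cube_w.
by split=> // x y z; rewrite h; field.
Qed.

(** The centers off the line z = 0 project from (0, 0, 1) onto the roots of [x
    (x^3 - 8 y^3)], two on each; the sign distinguishes them. *)
Definition offline_center (r0 r1 : K) (ob : option 'I_3 * bool) :=
  let sg := if ob.2 then 1 else - 1 in
  if ob.1 is Some i then co (2 * (w ^+ i) ^+ 2) 1 (sg * r1) else co 0 1 (sg * r0).

(** In the coordinates [u] along the center and [v] on its axis, the two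
    conditions on [r] turn the equation of the curve into a polynomial in
    [u^3]. *)
Lemma center3_Q0 r : a * r ^+ 2 = 60 -> r ^+ 6 = 12 -> center3 (co 0 1 r) /\
  forall x y z, lam (co 0 1 r) (co x y z) = y / 2 + z / (2 * r).
Proof.
move=> ar r6; have t0 := nat_neq0 (isT : 0 < 2)%N.
have r0 : r != 0.
  by apply/eqP => r0; move/eqP: r6; rewrite r0 expr0n /= eq_sym (negPf (nat_neq0 _)).
have e (x u v : K) : pencil a x (u + v) (r * (u - v)) =
   x ^+ 6 + 80 * x ^+ 3 * (u ^+ 3 + v ^+ 3) + 64 * (u ^+ 3) ^+ 2 - 640 * u ^+ 3 * v ^+ 3 + 64 * v ^+ 6.
  transitivity (r ^+ 6 * (u - v) ^+ 6 + (a * r ^+ 2) * ((x ^+ 3 * (u + v) + (u + v) ^+ 4) * (u - v) ^+ 2)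
    + (x ^+ 6 + 20 * x ^+ 3 * (u + v) ^+ 3 - 8 * (u + v) ^+ 6)).
    by rewrite /pencil; ring.
  by rewrite ar r6; ring.
have [|||h1 h] := @center3_co 0 1 r 0 (1 / 2) (1 / (2 * r)).
- by field; rewrite t0 r0.
- have -> : pencil a 0 1 r = pencil a 0 (1 + 0) (r * (1 - 0)) by congr pencil; ring.
  by rewrite e (_ : _ + _ = 64) ?nat_neq0 //; ring.
- move=> x y z l; pose u := l; pose v := y / 2 - z / (2 * r).
  have ey : y = u + v by rewrite /u /l /v; field; rewrite t0 r0.
  have ez : z = r * (u - v) by rewrite /u /l /v; field; rewrite t0 r0.
  rewrite -/u [in RHS]ey [in RHS]ez e.
  have -> : y + (w - 1) * u * 1 = w * u + v by rewrite {1}ey; ring.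
  have -> : z + (w - 1) * u * r = r * (w * u - v) by rewrite {1}ez; ring.
  by rewrite mulr0 addr0 e cube_w.
by split=> // x y z; rewrite h; field; rewrite t0 r0.
Qed.

(** The variables [u], [v] and [t] are coordinates along the center and on its
    axis; the form obtained is the one of [center3_Q0] up to a constant. *)
Lemma center3_Q n r : n ^+ 3 = 1 -> a * r ^+ 2 = - 180 -> r ^+ 6 = - 324 ->
  center3 (co (2 * n ^+ 2) 1 r) /\
  forall x y z, lam (co (2 * n ^+ 2) 1 r) (co x y z) = x * (n / 6) + y / 6 + z / (2 * r).
Proof.
move=> n3 ar r6; have t2 := nat_neq0 (isT : 0 < 2)%N; have t6 := nat_neq0 (isT : 0 < 6)%N.
have r0 : r != 0.
  by apply/eqP => r0; move/eqP: r6; rewrite r0 expr0n /= eq_sym oppr_eq0 (negPf (nat_neq0 _)).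
have e (t u v : K) : pencil a (n ^+ 2 * (2 * (u + v) + t)) (u + v - t) (r * (u - v)) =
   - 27 * (t ^+ 6 - 80 * t ^+ 3 * (u ^+ 3 + v ^+ 3) + 64 * (u ^+ 3) ^+ 2 - 640 * u ^+ 3 * v ^+ 3 + 64 * v ^+ 6).
  transitivity (r ^+ 6 * (u - v) ^+ 6
    + (a * r ^+ 2) * (((n ^+ 3) ^+ 2 * (2 * (u + v) + t) ^+ 3 * (u + v - t) + (u + v - t) ^+ 4) * (u - v) ^+ 2)
    + ((n ^+ 3) ^+ 4 * (2 * (u + v) + t) ^+ 6
       + 20 * ((n ^+ 3) ^+ 2 * (2 * (u + v) + t) ^+ 3) * (u + v - t) ^+ 3 - 8 * (u + v - t) ^+ 6)).
    by rewrite /pencil; ring.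
  by rewrite ar r6 n3; ring.
have [|||h1 h] := @center3_co (2 * n ^+ 2) 1 r (n / 6) (1 / 6) (1 / (2 * r)).
- transitivity ((2 * n ^+ 3 + 1) / 6 + 1 / 2); first by field; rewrite t2 t6 r0.
  by rewrite n3; field; rewrite t2 t6.
- have -> : pencil a (2 * n ^+ 2) 1 r = pencil a (n ^+ 2 * (2 * (1 + 0) + 0)) (1 + 0 - 0) (r * (1 - 0)) by congr pencil; ring.
  rewrite e mulf_neq0 ?oppr_eq0 ?nat_neq0 // (_ : _ + _ = 64) ?nat_neq0 //; ring.
- move=> x y z l; pose u := l; pose v := x * (n / 6) + y / 6 - z / (2 * r).
  pose t := (n * x - 2 * y) / 3.
  have t3 := nat_neq0 (isT : 0 < 3)%N.
  have ex : x = n ^+ 2 * (2 * (u + v) + t).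
    transitivity (n ^+ 3 * x); first by rewrite n3 mul1r.
    by rewrite /u /l /v /t; field; rewrite t2 t6 t3 r0.
  have ey : y = u + v - t by rewrite /u /l /v /t; field; rewrite t2 t6 t3 r0.
  have ez : z = r * (u - v) by rewrite /u /l /v; field; rewrite t2 t6 r0.
  rewrite -/u [in RHS]ex [in RHS]ey [in RHS]ez e.
  have -> : x + (w - 1) * u * (2 * n ^+ 2) = n ^+ 2 * (2 * (w * u + v) + t) by rewrite {1}ex; ring.
  have -> : y + (w - 1) * u * 1 = w * u + v - t by rewrite {1}ey; ring.
  have -> : z + (w - 1) * u * r = r * (w * u - v) by rewrite {1}ez; ring.
  by rewrite e cube_w.
by split=> // x y z; rewrite h; field; rewrite t2 t6 r0.
Qed.

Lemma center3_A0 : a = 0 -> center3 (co 0 1 0) /\ forall x y z, lam (co 0 1 0) (co x y z) = y.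
Proof.
move=> a0; have [|||h1 h] := @center3_co 0 1 0 0 1 0; first by ring.
- by rewrite /pencil (_ : _ + _ = - 8) ?oppr_eq0 ?nat_neq0 //; ring.
- move=> x y z l; rewrite /l a0; transitivity (z ^+ 6 
    + (x ^+ 6 + 20 * x ^+ 3 * (w ^+ 3 * y ^+ 3) - 8 * (w ^+ 3) ^+ 2 * y ^+ 6)).
    by rewrite /pencil; ring.
  by rewrite w3 /pencil; ring.
by split=> // x y z; rewrite h; ring.
Qed.

(** The octahedral form is symmetric in the two dual tetrahedra, but the form
    [x^3 y + y^4] is not. *)
Lemma center3_A n : a = 0 -> n ^+ 3 = 1 -> center3 (co (2 * n ^+ 2) 1 0) /\
  forall x y z, lam (co (2 * n ^+ 2) 1 0) (co x y z) = (n * x + y) / 3.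
Proof.
move=> a0 n3; have t3 := nat_neq0 (isT : 0 < 3)%N.
have e (u v z : K) : pencil a (n ^+ 2 * (2 * u + v)) (u - v) z =
   z ^+ 6 + 216 * (u ^+ 3) ^+ 2 + 540 * u ^+ 3 * v ^+ 3 - 27 * v ^+ 6.
  transitivity (z ^+ 6 + ((n ^+ 3) ^+ 4 * (2 * u + v) ^+ 6
     + 20 * ((n ^+ 3) ^+ 2 * (2 * u + v) ^+ 3) * (u - v) ^+ 3 - 8 * (u - v) ^+ 6)).
    by rewrite /pencil a0; ring.
  by rewrite n3; ring.
have [|||h1 h] := @center3_co (2 * n ^+ 2) 1 0 (n / 3) (1 / 3) 0.
- transitivity ((2 * n ^+ 3 + 1) / 3); first by field.
  by rewrite n3; field.
- have -> : pencil a (2 * n ^+ 2) 1 0 = pencil a (n ^+ 2 * (2 * 1 + 0)) (1 - 0) 0 by congr pencil; ring.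
  by rewrite e (_ : _ - _ = 216) ?nat_neq0 //; ring.
- move=> x y z l; pose u := l; pose v := (n * x - 2 * y) / 3.
  have ex : x = n ^+ 2 * (2 * u + v).
    transitivity (n ^+ 3 * x); first by rewrite n3 mul1r.
    by rewrite /u /l /v; field.
  have ey : y = u - v by rewrite /u /l /v; field.
  rewrite -/u [in RHS]ex [in RHS]ey e.
  have -> : x + (w - 1) * u * (2 * n ^+ 2) = n ^+ 2 * (2 * (w * u) + v) by rewrite {1}ex; ring.
  have -> : y + (w - 1) * u * 1 = w * u - v by rewrite {1}ey; ring.
  by rewrite mulr0 addr0 e cube_w.
by split=> // x y z; rewrite h; field.
Qed.

End Coordinates.

(** * Necessary conditions on the line z = 0 *)

Lemma homologyZ P c b : c != 0 -> center3 P -> homology P b -> homology (c *: P) b.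
Proof.
move=> c0 rP hb v; rewrite -hb /homol (center3Z c0 rP).2 scalerA.
by have -> // : (b - 1) * (c^-1 * lam P v) * c = (b - 1) * lam P v by field.
Qed.

Section Coordinates.
Variables (a p : K) (M : 'M[K]_3).
Hypotheses (Mu : M \in unitmx) (p0 : p != 0).
Hypothesis hg : forall x y z, ev (pt x y z *m M) = p * pencil a x y z.
Notation co x y z := (pt x y z *m M).
Let P0 := center3_P0 Mu p0 hg.
Let Pi := center3_P Mu p0 hg.

(** For [a = 0] the variable [z] occurs only as [z^6]. *)
Lemma center6_O : a = 0 -> [/\ center3 (co 0 0 1), homology (co 0 0 1) (-1) &
  forall x y z, lam (co 0 0 1) (co x y z) = z].
Proof.
move=> a0; have [|||r h] := @center3_co a p M Mu p0 hg 0 0 1 0 0 1; first by ring.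
- by rewrite /pencil (_ : _ + _ = 1) ?oner_eq0 //; ring.
- move=> x y z l; rewrite /l a0; transitivity ((w ^+ 3) ^+ 2 * z ^+ 6
    + (x ^+ 6 + 20 * x ^+ 3 * y ^+ 3 - 8 * y ^+ 6)).
    by rewrite /pencil; ring.
  by rewrite w3 /pencil; ring.
have {}h x y z : lam (co 0 0 1) (co x y z) = z by rewrite h; ring.
split=> // v; have [x [y [z ->]]] := coord_ex v Mu.
rewrite /homol h co_scale co_add !hg /pencil a0; ring.
Qed.

(** On the line joining (0, 1, 0) to the center the coefficient of [u] is [- 48
    q2], so [q2 = 0]; the coefficient of [u^2] is then [a q3^2]. *)
Lemma axis_z0 q1 q2 q3 : center3 (co q1 q2 q3) ->
  lam (co q1 q2 q3) (row i0 M) = 0 -> lam (co q1 q2 q3) (row i1 M) = 0 -> a = 0.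
Proof.
set Q := co _ _ _ => rQ m0 m1; have [Q0 _] := rQ.
have k0 : lam Q (co 0 1 0) = 0 by rewrite lam_co m0 m1; ring.
have h3 : q3 * lam Q (row i2 M) = 1.
  by rewrite -(lamP Q0) {2}/Q lam_co m0 m1; ring.
have q30 : q3 != 0 by apply: contra_eqN h3 => /eqP ->; rewrite mul0r eq_sym oner_eq0.
have [A [B [C hl]]] := co_line p0 hg rQ k0.
have /horner_seq_eq0 zt : forall u, u != 0 -> horner_seq [:: - 8 - A; - 48 * q2; a * q3 ^+ 2 - 120 * q2 ^+ 2;
   a * (q1 ^+ 3 * 0 + 4 * q2) * q3 ^+ 2 + 20 * q1 ^+ 3 - 160 * q2 ^+ 3 - B;
   a * 6 * q2 ^+ 2 * q3 ^+ 2 - 120 * q2 ^+ 4 + 60 * q1 ^+ 3 * q2;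
   a * (q1 ^+ 3 + 4 * q2 ^+ 3) * q3 ^+ 2 - 48 * q2 ^+ 5 + 60 * q1 ^+ 3 * q2 ^+ 2;
   pencil a q1 q2 q3 - C] u = 0.
  move=> u _; have /eqP := hl u; rewrite -subr_eq0 => /eqP e; rewrite -[RHS]e /horner_seq /pencil /=; ring.
have q20 : q2 = 0.
  apply: (natM_eq0 (n := 48%N)) => //; apply/eqP; rewrite -oppr_eq0 -mulNr; apply/eqP; exact: (zt 1%N).
have e2 : a * q3 ^+ 2 - 120 * q2 ^+ 2 = 0 := zt 2%N.
move: e2; rewrite q20 expr0n mulr0 subr0 => /eqP.
by rewrite mulf_eq0 expf_eq0 (negPf q30) andbF orbF => /eqP.
Qed.

(** A point with homologies of order six would have the inline centers on its
    axis, since it commutes with them and they are not of order six; its axis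
    would then be z = 0, contrary to [axis_z0]. *)
Lemma no_order6 O : a != 0 -> center3 O -> homology O (-1) -> False.
Proof.
move=> a0 rO h6; have [o1 [o2 [o3 eO]]] := coord_ex O Mu.
have n1 : 1 ^+ 3 = 1 :> K by rewrite expr1n.
have [rP1 lP1] := Pi n1; have [rP0 lP0] := P0.
have l0 : lam O (co 1 0 0) = 0.
  apply/eqP; apply: contraT => l0; have [c c0 e] := order6_center rO h6 rP0 l0.
  have := homologyZ c0 rO h6; rewrite -e => /(_ (co 1 1 0)).
  rewrite /homol lP0 co_scale co_add !hg => /eqP; rewrite -subr_eq0.
  rewrite (_ : _ - _ = p * - 40); last by rewrite /pencil; ring.
  by rewrite mulf_eq0 oppr_eq0 (negPf p0) (negPf (nat_neq0 _)).
have l1 : lam O (co 1 (-1) 0) = 0.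
  apply/eqP; apply: contraT => l1; have [c c0 e] := order6_center rO h6 rP1 l1.
  have := homologyZ c0 rO h6; rewrite -e => /(_ (co 3 0 0)).
  have t3 := nat_neq0 (isT : 0 < 3)%N.
  rewrite /homol lP1 co_scale co_add !hg => /eqP; rewrite -subr_eq0.
  rewrite (_ : _ - _ = p * - 1080); last by rewrite /pencil; field.
  by rewrite mulf_eq0 oppr_eq0 (negPf p0) (negPf (nat_neq0 _)).
move: l0 l1; rewrite !lam_co !(mul0r, mul1r, addr0, mulN1r) => l0.
rewrite l0 add0r => /eqP; rewrite oppr_eq0 => /eqP l1.
by rewrite eO in l0 l1 rO; move/eqP: a0; apply; exact: (axis_z0 rO l0 l1).
Qed.

End Coordinates.

(** The member with [a = 0] has a center of order six. *)
Lemma in_pencil_neq0 a : a != 0 -> in_pencil a -> ~ in_pencil 0.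
Proof.
move=> a0 [M [p [Mu p0 hg]]] [M' [p' [Mu' p'0 hg']]].
have [rO h6 _] := center6_O Mu' p'0 hg' erefl.
exact: (no_order6 Mu p0 hg a0 rO h6).
Qed.

Section Coordinates.
Variables (a p : K) (M : 'M[K]_3).
Hypotheses (Mu : M \in unitmx) (p0 : p != 0).
Hypothesis hg : forall x y z, ev (pt x y z *m M) = p * pencil a x y z.
Notation co x y z := (pt x y z *m M).
Let P0 := center3_P0 Mu p0 hg.
Let Pi := center3_P Mu p0 hg.
Let in_pencil_a : in_pencil a. Proof. by exists M, p. Qed.

(** [pair_line] for the center (1, 0, 0) and the point (1, t, 0), where the
    restriction of [F] to the line is known. *)
Lemma center3_slope t : center3 (co 1 t 0) -> [\/ t = 0, t ^+ 3 = -1 | 8 * t ^+ 3 = 1 /\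
  3 * lam (co 1 t 0) (co 1 0 0) = 2].
Proof.
move=> rQ; have [rP lP] := P0.
have [a' [b' [hab cases]]] := pair_line rP rQ (lP _ _ _).
have ePQ : co 1 t 0 - co 1 0 0 = co 0 t 0.
  by rewrite -scaleN1r co_scale co_add; congr (co _ _ _); ring.
have hab' x y : p * (x ^+ 6 + 20 * t ^+ 3 * x ^+ 3 * y ^+ 3 - 8 * t ^+ 6 * y ^+ 6)
     = p * (x ^+ 6 + a' * x ^+ 3 * y ^+ 3 + b' * y ^+ 6).
  have := hab x y; rewrite ePQ !co_scale co_add !hg => e.
  transitivity (p * pencil a (x * 1 + y * 0) (x * 0 + y * t) (x * 0 + y * 0)); first by rewrite /pencil; ring.
  by rewrite e /pencil; ring.
have eb : b' = - (8 * t ^+ 6).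
  by apply: (mulfI p0); transitivity (p * (0 ^+ 6 + a' * 0 ^+ 3 * 1 ^+ 3 + b' * 1 ^+ 6)); [ring|rewrite -hab'; ring].
have ea : a' = 20 * t ^+ 3.
  apply: (mulfI p0); transitivity (p * (1 ^+ 6 + a' * 1 ^+ 3 * 1 ^+ 3 + b' * 1 ^+ 6) - p * (1 + b')); first by ring.
  by rewrite -hab' eb; ring.
move: cases; rewrite ea eb => -[[_ e _]|[k2 e _]|[_ e _]].
- constructor 2; apply/eqP; rewrite -subr_eq0; apply/eqP; apply: (natM_eq0 (n := 20%N)) => //.
  by transitivity (20 * t ^+ 3 + 20); [ring|rewrite e; ring].
- constructor 3; split=> //; apply/eqP; rewrite -subr_eq0; apply/eqP; apply: (natM_eq0 (n := 5%N)) => //.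
  by transitivity (2 * (20 * t ^+ 3) - 5); [ring|rewrite e subrr].
- constructor 1; have /eqP : t ^+ 3 = 0 by apply: (natM_eq0 (n := 20%N)).
  by rewrite expf_eq0 => /eqP.
Qed.

Lemma pow_w_ex n : n ^+ 3 = 1 -> exists i : 'I_3, n = w ^+ i.
Proof. by case/(cube_root) => ->; [exists i0|exists i1|exists i2]. Qed.

Lemma inline_center_form t : t = 0 \/ t ^+ 3 = -1 -> exists o, co 1 t 0 = inline_center M o.
Proof.
case=> [->|t3]; first by exists None.
have [|i e] := @pow_w_ex (- t); first by rewrite exprNn t3; ring.
by exists (Some i); rewrite /inline_center -e opprK.
Qed.

(** The value 2/3 would place [F] in the member of parameter 0. *)
Lemma noncommuting_lam P Q : a != 0 -> center3 P -> center3 Q -> lam P Q != 0 ->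
  ~ (exists c, Q = c *: P) -> 3 * (lam P Q * lam Q P) = 1.
Proof.
move=> a0 rP rQ h ns; have [[-> //]|[_ s0]] := noncommuting rP rQ h ns.
by case: (in_pencil_neq0 a0 in_pencil_a s0).
Qed.

(** A center (1, t, 0) with [8 t^3 = 1], or (0, 1, 0), would have mutual value
    2/3 with one of the inline centers, contrary to [noncommuting_lam]. *)
Lemma center3_inline q1 q2 : a != 0 -> center3 (co q1 q2 0) ->
  exists o, exists2 c, c != 0 & co q1 q2 0 = c *: inline_center M o.
Proof.
move=> a0 rQ; have [Q0 _] := rQ; have [q10|q10] := eqVneq q1 0.
  exfalso; have [|rP lP] := Pi (n := 1); first by rewrite expr1n.
  have [_ lP0] := P0; rewrite q10 in rQ Q0.
  have q20 : q2 != 0 by apply: contraNneq Q0 => ->; rewrite hg /pencil; apply/eqP; ring.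
  have l0 : lam (co 0 q2 0) (row i0 M) = 0.
    by rewrite -pt100; apply: (lam_sym P0.1 rQ); rewrite lP0.
  have l1 : q2 * lam (co 0 q2 0) (row i1 M) = 1.
    by rewrite -[RHS](lamP Q0) lam_co; ring.
  have t3 := nat_neq0 (isT : 0 < 3)%N; have t2 := nat_neq0 (isT : 0 < 2)%N.
  have := noncommuting_lam a0 rP rQ; rewrite lP lam_co l0 => h.
  have : 3 * ((0 - 2 * 1 ^+ 2 * q2) / 3 * (1 * 0 + - (1) * lam (co 0 q2 0) (row i1 M) + 0 * lam (co 0 q2 0) (row i2 M))) = 1.
    apply: h.
      by rewrite expr1n mulr1 sub0r mulf_neq0 ?invr_eq0 // oppr_eq0 mulf_neq0.
    move=> [c]; rewrite co_scale => /(co_inj Mu)[e1 e2 _].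
    by move: e1 e2; rewrite mulr1 => <-; rewrite mul0r => /eqP; rewrite (negPf q20).
  rewrite (_ : 3 * _ = 2 * (q2 * lam (co 0 q2 0) (row i1 M))); last by field.
  by rewrite l1 => /eqP; rewrite -subr_eq0 (_ : _ - _ = 1); [rewrite oner_eq0|ring].
have eQ : co q1 q2 0 = q1 *: co 1 (q2 / q1) 0 by rewrite co_scale; congr (co _ _ _); field.
have rQ' : center3 (co 1 (q2 / q1) 0).
  have q10' : q1^-1 != 0 by rewrite invr_eq0.
  have := (center3Z q10' rQ).1.
  by rewrite eQ scalerA mulVf // scale1r.
case: (center3_slope rQ') => [t0|t0|[t0 k2]].
- by have [o e] := inline_center_form (or_introl t0); exists o, q1; rewrite // -e.
- by have [o e] := inline_center_form (or_intror t0); exists o, q1; rewrite // -e.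
exfalso; set t := q2 / q1 in rQ' t0 k2.
have tn0 : t != 0 by apply: contra_eqN t0 => /eqP ->; rewrite expr0n mulr0 eq_sym oner_eq0.
have [rP lP] := P0; have := noncommuting_lam a0 rP rQ'; rewrite lP mul1r k2 oner_eq0 => /(_ isT) h.
have : 2 = 1 :> K.
  apply: h => -[c]; rewrite co_scale => /(co_inj Mu)[_ e _].
  by move: e; rewrite mulr0 => /eqP; rewrite (negPf tn0).
by move/eqP; rewrite -subr_eq0 (_ : _ - _ = 1); [rewrite oner_eq0|ring].
Qed.

Lemma center3_inline0 q1 q2 : a = 0 -> center3 (co q1 q2 0) ->
  [\/ exists o, exists2 c, c != 0 & co q1 q2 0 = c *: inline_center M o,
      exists2 c, c != 0 & co q1 q2 0 = c *: co 0 1 0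
    | exists i : 'I_3, exists2 c, c != 0 & co q1 q2 0 = c *: co (2 * (w ^+ i) ^+ 2) 1 0].
Proof.
move=> a0 rQ; have [Q0 _] := rQ; have [q10|q10] := eqVneq q1 0.
  constructor 2; exists q2; last by rewrite q10 co_scale; congr (co _ _ _); ring.
  by apply: contraNneq Q0 => ->; rewrite q10 hg /pencil; apply/eqP; ring.
have eQ : co q1 q2 0 = q1 *: co 1 (q2 / q1) 0 by rewrite co_scale; congr (co _ _ _); field.
have rQ' : center3 (co 1 (q2 / q1) 0).
  have q10' : q1^-1 != 0 by rewrite invr_eq0.
  have := (center3Z q10' rQ).1.
  by rewrite eQ scalerA mulVf // scale1r.
case: (center3_slope rQ') => [t0|t0|[t0 k2]].
- by constructor 1; have [o e] := inline_center_form (or_introl t0); exists o, q1; rewrite // -e.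
- by constructor 1; have [o e] := inline_center_form (or_intror t0); exists o, q1; rewrite // -e.
constructor 3; set t := q2 / q1 in eQ rQ' t0 k2.
have [|i e] := @pow_w_ex (2 * t); first by rewrite -[RHS]t0; ring.
have tn0 : t != 0 by apply: contra_eqN t0 => /eqP ->; rewrite expr0n mulr0 eq_sym oner_eq0.
exists i, (q1 * t); first by rewrite mulf_neq0.
rewrite eQ -scalerA -e; congr (_ *: _); rewrite co_scale; congr (co _ _ _); rewrite ?mulr0 ?mulr1 //.
by rewrite -[LHS]t0; ring.
Qed.

Lemma center3_dichotomy P Q : a != 0 -> center3 P -> center3 Q -> ~ (exists c, Q = c *: P) ->
  (lam P Q = 0 /\ lam Q P = 0) \/ 3 * (lam P Q * lam Q P) = 1.
Proof.
move=> a0 rP rQ ns; have [h|h] := eqVneq (lam P Q) 0.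
  by left; split=> //; exact: (lam_sym rP rQ h).
by right; apply: noncommuting_lam.
Qed.

End Coordinates.

(** * Necessary conditions off the line z = 0 *)

(** Here [q] are the first two coordinates of a center and [m] the first two
    coefficients of its polar form.  The hypotheses say that with each of the
    four inline centers it either commutes or has mutual value 1/3.  The sum of
    the latter equations over the cube roots of unity [n], weighted by the
    powers of [n], shows that not all four can hold; each of the commuting
    cases gives one of the conclusions. *)
Lemma tetrahedral_incidence (q1 q2 m1 m2 : K) :
  (q1 = 0 /\ m1 = 0) \/ 3 * (q1 * m1) = 1 ->
  (forall n, n ^+ 3 = 1 -> (q1 = 2 * n ^+ 2 * q2 /\ m1 = n * m2) \/
     (q1 - 2 * n ^+ 2 * q2) * (m1 - n * m2) = 1) ->
  [\/ [/\ q1 = 0, m1 = 0 & 2 * (q2 * m2) = 1],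
      exists2 n, n ^+ 3 = 1 & [/\ q1 = 2 * n ^+ 2 * q2, m1 = n * m2 & 6 * (q2 * m2) = 1]
    | m1 = 0 /\ m2 = 0].
Proof.
move=> h0 hn; have c1 : 1 ^+ 3 = 1 :> K by rewrite expr1n.
case: h0 => [[q10 m10]|hA].
  case: (hn 1 c1); rewrite q10 m10 => -[].
    by rewrite mul1r => _ <-; constructor 3.
  by move=> e; constructor 1; split=> //; rewrite -[RHS]e; ring.
have [[n n3 [e1 e2]]|none] := classic (exists2 n, n ^+ 3 = 1 & q1 = 2 * n ^+ 2 * q2 /\ m1 = n * m2).
  constructor 2; exists n => //; split=> //; rewrite -[RHS]hA e1 e2.
  by transitivity (n ^+ 3 * (6 * (q2 * m2))); [rewrite n3 mul1r|ring].
exfalso; pose e n := q1 * m1 + 2 * (q2 * m2) - n * (q1 * m2) - 2 * n ^+ 2 * (q2 * m1).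
have {}hn n : n ^+ 3 = 1 -> e n = 1.
  move=> n3; case: (hn n n3) => [h|<-]; first by case: none; exists n.
  rewrite /e; transitivity (q1 * m1 + 2 * n ^+ 3 * (q2 * m2) - n * (q1 * m2) - 2 * n ^+ 2 * (q2 * m1)); last by ring.
  by rewrite n3 mulr1.
have w23 : (w ^+ 2) ^+ 3 = 1 by rewrite exprAC w3 expr1n.
have h1 := hn 1 c1; have h2 := hn w w3; have h3 := hn _ w23.
have eC : q1 * m2 = 0.
  apply: (natM_eq0 (n := 3%N)) => //.
  transitivity ((q1 * m1 + 2 * (q2 * m2)) * (w ^+ 2 + w + 1) - 2 * (q2 * m1) * (1 + w ^+ 3 * w + w ^+ 3 * w ^+ 2)
     - (e 1 + w ^+ 2 * e w + w * e (w ^+ 2)) + 2 * (1 - w ^+ 3) * (q1 * m2)); first by rewrite /e; ring.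
  rewrite h1 h2 h3 w3; transitivity ((w ^+ 2 + w + 1) * (q1 * m1 + 2 * (q2 * m2) - 2 * (q2 * m1) - 1)); first by ring.
  by rewrite hw mul0r.
have eD : q2 * m1 = 0.
  apply: (natM_eq0 (n := 6%N)) => //.
  transitivity ((q1 * m1 + 2 * (q2 * m2)) * (w ^+ 2 + w + 1) - (q1 * m2) * (1 + w ^+ 2 + w ^+ 3 * w)
     - (e 1 + w * e w + w ^+ 2 * e (w ^+ 2)) + 2 * (1 - w ^+ 3 + 1 - (w ^+ 3) ^+ 2) * (q2 * m1)); first by rewrite /e; ring.
  rewrite h1 h2 h3 w3; transitivity ((w ^+ 2 + w + 1) * (q1 * m1 + 2 * (q2 * m2) - q1 * m2 - 1)); first by ring.
  by rewrite hw mul0r.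
have eB : 6 * (q2 * m2) = 2.
  transitivity (3 * e 1 - 3 * (q1 * m1) + 3 * (q1 * m2) + 6 * (q2 * m1)); first by rewrite /e; ring.
  by rewrite h1 hA eC eD; ring.
have : 2 = 0 :> K.
  transitivity ((3 * (q1 * m1)) * (6 * (q2 * m2))); first by rewrite hA eB mul1r.
  by transitivity (18 * (q1 * m2) * (q2 * m1)); [ring|rewrite eC; ring].
by apply/eqP; exact: nat_neq0.
Qed.

Section Coordinates.
Variables (a p : K) (M : 'M[K]_3).
Hypotheses (Mu : M \in unitmx) (p0 : p != 0).
Hypothesis hg : forall x y z, ev (pt x y z *m M) = p * pencil a x y z.
Notation co x y z := (pt x y z *m M).

(** The vector [(s, 1, - r)] is on the axis of the center [(s, 1, r)], so the
    coefficients of [u] and [u^2] vanish on the line joining them. *)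
Lemma offline_radius s r (e1 e2 : K) : center3 (co s 1 r) ->
  lam (co s 1 r) (row i0 M) * s + lam (co s 1 r) (row i1 M) = 1 / 2 ->
  s ^+ 3 + 1 = e1 -> s ^+ 6 + 20 * s ^+ 3 - 8 = e2 ->
  - 6 * r ^+ 6 + 2 * (a * r ^+ 2) * e1 + 6 * e2 = 0 /\
  15 * r ^+ 6 - (a * r ^+ 2) * e1 + 15 * e2 = 0.
Proof.
set R := co s 1 r => rR hm h1 h2; have [R0 _] := rR; have t2 := nat_neq0 (isT : 0 < 2)%N.
have h3 : r * lam R (row i2 M) = 1 / 2.
  transitivity (lam R R - (lam R (row i0 M) * s + lam R (row i1 M))); first by rewrite {4}/R lam_co; ring.
  by rewrite hm lamP //; field.
have k0 : lam R (co s 1 (- r)) = 0.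
  rewrite lam_co; transitivity ((lam R (row i0 M) * s + lam R (row i1 M)) - r * lam R (row i2 M)); first by ring.
  by rewrite hm h3 subrr.
have [A [B [C hl]]] := co_line p0 hg rR k0.
have /horner_seq_eq0 zt : forall u, u != 0 -> horner_seq [:: r ^+ 6 + a * r ^+ 2 * e1 + e2 - A;
   - 6 * r ^+ 6 + 2 * (a * r ^+ 2) * e1 + 6 * e2;
   15 * r ^+ 6 - (a * r ^+ 2) * e1 + 15 * e2;
   - 20 * r ^+ 6 - 4 * (a * r ^+ 2) * e1 + 20 * e2 - B;
   15 * r ^+ 6 - (a * r ^+ 2) * e1 + 15 * e2;
   - 6 * r ^+ 6 + 2 * (a * r ^+ 2) * e1 + 6 * e2;
   r ^+ 6 + a * r ^+ 2 * e1 + e2 - C] u = 0.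
  by move=> u _; have /eqP := hl u; rewrite -subr_eq0 => /eqP e; rewrite -[RHS]e -h1 -h2 /horner_seq /pencil /=; ring.
by split; [exact: (zt 1%N)|exact: (zt 2%N)].
Qed.

Let P0 := center3_P0 Mu p0 hg.
Let Pi := center3_P Mu p0 hg.

(** [tetrahedral_incidence] gives the line through (0, 0, 1) on which the
    center lies, and [offline_radius] its position on this line.  A center with
    [m1 = m2 = 0] has z = 0 as axis, which [axis_z0] excludes. *)
Lemma center3_offline q1 q2 q3 : a != 0 -> q3 != 0 -> center3 (co q1 q2 q3) ->
  exists c r, c != 0 /\
    ([/\ a * r ^+ 2 = 60, r ^+ 6 = 12 & co q1 q2 q3 = c *: co 0 1 r] \/
     exists i : 'I_3, [/\ a * r ^+ 2 = - 180, r ^+ 6 = - 324 &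
        co q1 q2 q3 = c *: co (2 * (w ^+ i) ^+ 2) 1 r]).
Proof.
move=> a0 q30 rR; set R := co q1 q2 q3 in rR *; set m1 := lam R (row i0 M); set m2 := lam R (row i1 M).
have t2 := nat_neq0 (isT : 0 < 2)%N; have t3 := nat_neq0 (isT : 0 < 3)%N; have t6 := nat_neq0 (isT : 0 < 6)%N.
have ns x y : ~ exists c, R = c *: co x y 0.
  by move=> [c]; rewrite co_scale mulr0 => /(co_inj Mu)[_ _ /eqP]; rewrite (negPf q30).
have scaled s (q20 : q2 != 0) : q1 = s * q2 -> R = q2 *: co s 1 (q3 / q2) /\ center3 (co s 1 (q3 / q2)).
  move=> e1; have eR : R = q2 *: co s 1 (q3 / q2).
    by rewrite /R co_scale e1; congr (co _ _ _); field.
  split=> //; have q20' : q2^-1 != 0 by rewrite invr_eq0.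
  by have := (center3Z q20' rR).1; rewrite {1}eR scalerA mulVf // scale1r.
have q2_neq0 (n : nat) : n%:R * (q2 * m2) = 1 -> q2 != 0.
  by move=> e; apply: contra_eqN e => /eqP ->; rewrite mul0r mulr0 eq_sym oner_eq0.
have scaled_lam s (q20 : q2 != 0) i : q1 = s * q2 ->
    lam (co s 1 (q3 / q2)) (row i M) = q2 * lam R (row i M).
  by move=> /(scaled _ q20)[eR rR']; rewrite eR (center3Z q20 rR').2 mulVKf.
case: (@tetrahedral_incidence q1 q2 m1 m2).
- have [rP lP] := P0; case: (center3_dichotomy Mu p0 hg a0 rP rR (ns _ _)).
    by rewrite lP lam_co -/m1 => -[-> e]; left; split=> //; rewrite -[RHS]e; ring.
  by rewrite lP lam_co -/m1 => e; right; rewrite -[RHS]e; ring.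
- move=> n n3; have [rP lP] := Pi n3.
  case: (center3_dichotomy Mu p0 hg a0 rP rR (ns _ _)); rewrite lP lam_co -/m1 -/m2.
    move=> [e1 e2]; left; split.
      transitivity (3 * ((q1 - 2 * n ^+ 2 * q2) / 3) + 2 * n ^+ 2 * q2); first by field.
      by rewrite e1; ring.
    by transitivity (1 * m1 + - n * m2 + 0 * lam R (row i2 M) + n * m2); [ring|rewrite e2; ring].
  by move=> e; right; rewrite -[RHS]e; field.
- move=> [q10 m10 hB]; have q20 := q2_neq0 _ hB.
  have e1 : q1 = 0 * q2 by rewrite mul0r.
  have [eR rR'] := scaled _ q20 e1; set r := q3 / q2 in eR rR'.
  exists q2, r; split=> //; left.
  have [|||h5 h4] := @offline_radius 0 r 1 (- 8) rR'; try by ring.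
    rewrite !(scaled_lam _ q20) // -/m1 -/m2 m10; transitivity (2 * (q2 * m2) / 2); first by field.
    by rewrite hB.
  have r6 : r ^+ 6 = 12.
    apply/eqP; rewrite -subr_eq0; apply/eqP; apply: (natM_eq0 (n := 24%N)) => //.
    transitivity ((- 6 * r ^+ 6 + 2 * (a * r ^+ 2) * 1 + 6 * - 8) +
       2 * (15 * r ^+ 6 - (a * r ^+ 2) * 1 + 15 * - 8)); first by ring.
    by rewrite h5 h4; ring.
  split=> //; apply/eqP; rewrite -subr_eq0; apply/eqP.
  transitivity (15 * (r ^+ 6 - 12) - (15 * r ^+ 6 - (a * r ^+ 2) * 1 + 15 * - 8)); first by ring.
  by rewrite h4 r6; ring.
- move=> [n n3 [e1 em hB]]; have q20 := q2_neq0 _ hB.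
  have [i ei] := pow_w_ex n3.
  have [eR rR'] := scaled _ q20 e1; set r := q3 / q2 in eR rR'.
  exists q2, r; split=> //; right; exists i; rewrite -ei.
  have [|||h5 h4] := @offline_radius (2 * n ^+ 2) r 9 216 rR'.
  - rewrite !(scaled_lam _ q20) // -/m1 -/m2 em; transitivity (6 * (q2 * m2) * (2 * n ^+ 3 + 1) / 6); first by field.
    by rewrite hB n3; field; rewrite t2 t6.
  - by transitivity (8 * (n ^+ 3) ^+ 2 + 1); [ring|rewrite n3; ring].
  - by transitivity (64 * (n ^+ 3) ^+ 4 + 160 * (n ^+ 3) ^+ 2 - 8); [ring|rewrite n3; ring].
  have r6 : r ^+ 6 = - 324.
    apply/eqP; rewrite -subr_eq0; apply/eqP; apply: (natM_eq0 (n := 24%N)) => //.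
    transitivity ((- 6 * r ^+ 6 + 2 * (a * r ^+ 2) * 9 + 6 * 216) +
       2 * (15 * r ^+ 6 - (a * r ^+ 2) * 9 + 15 * 216)); first by ring.
    by rewrite h5 h4; ring.
  split=> //; apply/eqP; rewrite -subr_eq0; apply/eqP; apply: (natM_eq0 (n := 9%N)) => //.
  transitivity (15 * (r ^+ 6 + 324) - (15 * r ^+ 6 - (a * r ^+ 2) * 9 + 15 * 216)); first by ring.
  by rewrite h4 r6; ring.
- by move=> [m10 m20]; rewrite (axis_z0 p0 hg rR m10 m20) eqxx in a0.
Qed.

Lemma cube18000 r : a != 0 -> (a * r ^+ 2 = 60 /\ r ^+ 6 = 12) \/
  (a * r ^+ 2 = - 180 /\ r ^+ 6 = - 324) -> a ^+ 3 = 18000.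
Proof.
have t12 : 12 != 0 :> K by exact: nat_neq0.
have t324 : 324 != 0 :> K by exact: nat_neq0.
move=> a0 [[e r6]|[e r6]].
  apply: (mulIf t12); rewrite -[in LHS]r6; transitivity ((a * r ^+ 2) ^+ 3); first by ring.
  by rewrite e; ring.
apply: (mulIf t324); apply: oppr_inj; rewrite -mulrN -[in LHS]r6; transitivity ((a * r ^+ 2) ^+ 3); first by ring.
by rewrite e; ring.
Qed.

End Coordinates.

(** * Counting centers *)

Lemma delta'_unique n m : delta' F 3 n -> delta' F 3 m -> n = m.
Proof. by apply: card_mod_unique => [x y|x y z]; rewrite /same_pt => ->. Qed.

Definition good P := center3 P /\ ~ homology P (-1).

Lemma good_neq0 P : good P -> P != 0.
Proof. by case=> -[P0 _] _; apply: contraNneq P0 => ->; rewrite ev0. Qed.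

(** A center with a homology of order six commutes with all others. *)
Lemma good_partner P Q : center3 P -> center3 Q -> lam P Q != 0 -> ~ (exists c, Q = c *: P) -> good P.
Proof.
move=> rP rQ h ns; split=> // h6.
by have [c _ e] := order6_center rP h6 rQ h; apply: ns; exists c.
Qed.

Lemma delta'_of (I : finType) (e : I -> 'rV[K]_3) : (forall i, good (e i)) ->
  (forall i j c, c != 0 -> e i = c *: e j -> i = j) ->
  (forall R, good R -> exists i, exists2 c, c != 0 & R = c *: e i) -> delta' F 3 #|I|.
Proof.
move=> gd einj ecov; apply: (@eq_card_mod _ _ good).
  by move=> P; rewrite (good_pointP).
apply: (card_mod_fin (e := e)) => // [i j|R gR].
  move/(same_pt_scale (good_neq0 (gd i)) (good_neq0 (gd j))) => [c c0 h].
  by apply/esym/(einj _ _ _ c0).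
have [i [c c0 eR]] := ecov R gR; exists i.
apply/(same_pt_scale (good_neq0 gR) (good_neq0 (gd i))); exists c^-1; first by rewrite invr_eq0.
by rewrite eR scalerA mulVf // scale1r.
Qed.

Lemma delta'_of_sum (I1 I2 : finType) (e1 : I1 -> 'rV[K]_3) (e2 : I2 -> 'rV[K]_3) :
  (forall i, good (e1 i)) -> (forall i, good (e2 i)) ->
  (forall i j c, c != 0 -> e1 i = c *: e1 j -> i = j) ->
  (forall i j c, c != 0 -> e2 i = c *: e2 j -> i = j) ->
  (forall i j c, c != 0 -> e1 i = c *: e2 j -> False) ->
  (forall R, good R -> (exists i, exists2 c, c != 0 & R = c *: e1 i) \/
                       (exists i, exists2 c, c != 0 & R = c *: e2 i)) ->
  delta' F 3 (#|I1| + #|I2|).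
Proof.
move=> g1 g2 j1 j2 j12 cov; rewrite -card_sum.
apply: (delta'_of (e := fun i => match i with inl i => e1 i | inr i => e2 i end)).
- by case.
- move=> [i|i] [j|j] c c0 h.
  + by rewrite (j1 _ _ _ c0 h).
  + by case: (j12 _ _ _ c0 h).
  + have c0' : c^-1 != 0 by rewrite invr_eq0.
    by case: (j12 j i _ c0'); rewrite h scalerA mulVf // scale1r.
  + by rewrite (j2 _ _ _ c0 h).
- by move=> R /cov[[i h]|[i h]]; [exists (inl i)|exists (inr i)].
Qed.

(** A family of centers with vanishing mutual values is linearly independent,
    since the polar forms are dual to the points.  So a maximal one has at most
    three members, and by hypothesis it contains all centers up to scalars. *)
Lemma few_commuting : (forall P Q, good P -> good Q -> lam P Q = 0 \/ exists2 c, c != 0 & Q = c *: P) ->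
  exists2 n, (n <= 3)%N & delta' F 3 n.
Proof.
move=> comm; apply: NNPP => none.
have step (n : nat) : (exists (I : finType) (e : I -> 'rV[K]_3), [/\ #|I| = n, forall i, good (e i) &
     forall i j, i != j -> lam (e i) (e j) = 0]) /\ (n <= 3)%N ->
   (exists (I : finType) (e : I -> 'rV[K]_3), [/\ #|I| = n.+1, forall i, good (e i) &
     forall i j, i != j -> lam (e i) (e j) = 0]) /\ (n.+1 <= 3)%N.
  move=> [[I [e [In ge orth]]] n3].
  have [[R gR hR]|cov] := classic (exists2 R, good R & forall i, ~ exists2 c, c != 0 & R = c *: e i); last first.
    case: none; exists n => //; rewrite -In; apply: (delta'_of ge).
      move=> i j c c0 h; apply/eqP; apply: contraT => ij; have := orth i j ij.
      have [[e0 _] _] := ge i; have [re _] := ge j; rewrite h (center3Z c0 re).2 lamP; last by case: re.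
      by rewrite mulr1 => /eqP; rewrite invr_eq0 (negPf c0).
    by move=> R gR; apply: NNPP => h; apply: cov; exists R => // i hi; apply: h; exists i.
  pose e' (o : option I) := if o is Some i then e i else R.
  have ge' o : good (e' o) by case: o.
  have orth' i j : i != j -> lam (e' i) (e' j) = 0.
    case: i j => [i|] [j|] //= ij; first exact: orth.
      by case: (comm _ _ (ge i) gR) => // h; case: (hR i).
    apply: (lam_sym); [by case: (ge j)|by case: gR|].
    by case: (comm _ _ (ge j) gR) => // h; case: (hR j).
  have cI : #|{: option I}| = n.+1 by rewrite card_option In.
  split; first by exists (option I : finType), e'.
  rewrite -cI; apply: (@mulmx1_min K _ _ (\matrix_(i, j) e' (enum_val i) 0 j)
    (\matrix_(i, j) pol 6 F (e' (enum_val j)) i 0)).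
  apply/matrixP => i j; rewrite !mxE.
  transitivity (lam (e' (enum_val j)) (e' (enum_val i))).
    by rewrite /lf mxE; apply: eq_bigr => k _; rewrite !mxE.
  have [->|ij] := eqVneq i j; first by rewrite lamP //; have [[]] := ge' (enum_val j).
  by rewrite orth' //; apply: contra_neq ij => /enum_val_inj.
have h0 : (exists (I : finType) (e : I -> 'rV[K]_3), [/\ #|I| = 0%N, forall i, good (e i) &
     forall i j, i != j -> lam (e i) (e j) = 0]) /\ (0 <= 3)%N.
  by split=> //; exists (void : finType), (fun i : void => 0); split=> [|[]|[]] //; rewrite card_void.
by have [] := step _ (step _ (step _ (step _ h0))).
Qed.

(** * The number of centers of a member of the pencil *)

Lemma pow_w_inj (i j : 'I_3) : w ^+ i = w ^+ j -> i = j.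
Proof.
have p0 : w ^+ i0 = 1 by [].
have p1 : w ^+ i1 = w by [].
have p2 : w ^+ i2 = w ^+ 2 by [].
have n1 := negPf w_neq1; have n2 := negPf w2_neq1; have n3 := negPf w2_neqw.
move: i j; apply: ord3_ind; apply: ord3_ind => //; rewrite ?p0 ?p1 ?p2 => /eqP;
  first [by rewrite n1 | by rewrite n2 | by rewrite n3 | by rewrite eq_sym n1 | by rewrite eq_sym n2 | by rewrite eq_sym n3].
Qed.

Lemma pow_w2_inj (i j : 'I_3) : (w ^+ i) ^+ 2 = (w ^+ j) ^+ 2 -> i = j.
Proof.
move=> h; apply: pow_w_inj; have hi := w3i i; have hj := w3i j.
transitivity ((w ^+ i) ^+ 3 * w ^+ i); first by rewrite hi mul1r.
transitivity (((w ^+ i) ^+ 2) ^+ 2); first by ring.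
by rewrite h; transitivity ((w ^+ j) ^+ 3 * w ^+ j); [ring|rewrite hj mul1r].
Qed.

Section Coordinates.
Variables (a p : K) (M : 'M[K]_3).
Hypotheses (Mu : M \in unitmx) (p0 : p != 0).
Hypothesis hg : forall x y z, ev (pt x y z *m M) = p * pencil a x y z.
Notation co x y z := (pt x y z *m M).
Let P0 := center3_P0 Mu p0 hg.
Let Pi := center3_P Mu p0 hg.
Let P1 : center3 (co 1 (- 1) 0) /\ forall x y z, lam (co 1 (- 1) 0) (co x y z) = (x - 2 * 1 ^+ 2 * y) / 3.
Proof. by apply: Pi; rewrite expr1n. Qed.
Let t2 : 2 != 0 :> K. Proof. exact: nat_neq0. Qed.
Let t3 : 3 != 0 :> K. Proof. exact: nat_neq0. Qed.
Let wi0 (i : 'I_3) : w ^+ i != 0. Proof. by rewrite expf_neq0 // w_neq0. Qed.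

Let q0 (i : 'I_3) : 2 * (w ^+ i) ^+ 2 != 0. Proof. by rewrite mulf_neq0 // expf_neq0. Qed.

Lemma co_neq x y z x' y' z' (c : K) : co x y z = c *: co x' y' z' ->
  [/\ x = c * x', y = c * y' & z = c * z'].
Proof. by rewrite co_scale => /(co_inj Mu). Qed.

Lemma good_inline_center o : good (inline_center M o).
Proof.
case: o => [i|]; rewrite /inline_center.
  have [rP lP] := Pi (w3i i); have [rQ _] := P0.
  apply: (good_partner rP rQ).
    by rewrite lP mulr0 subr0 mul1r invr_eq0.
  by move=> [c /co_neq[e1 e2 _]]; move: e1 e2; rewrite mulr1 => <-; rewrite mul1r => /esym/eqP; rewrite oppr_eq0 (negPf (wi0 i)).
have [rP lP] := P0; have [rQ _] := P1.
apply: (good_partner rP rQ); first by rewrite lP oner_eq0.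
by move=> [c /co_neq[_ /eqP]]; rewrite mulr0 oppr_eq0 oner_eq0.
Qed.

Lemma inline_center_inj o o' (c : K) : c != 0 -> inline_center M o = c *: inline_center M o' -> o = o'.
Proof.
move=> c0; case: o o' => [i|] [j|] //= /co_neq[e1 e2 _].
- rewrite mulr1 in e1; rewrite -e1 mul1r in e2.
  by rewrite (pow_w_inj (oppr_inj e2)).
- by move/eqP: e2; rewrite mulr0 oppr_eq0 (negPf (wi0 i)).
- by move/esym/eqP: e2; rewrite mulrN oppr_eq0 mulf_eq0 (negPf c0) (negPf (wi0 j)).
Qed.

Lemma delta'_4 : a != 0 -> a ^+ 3 != 18000 -> delta' F 3 4.
Proof.
move=> a0 a3; have -> : 4%N = #|{: option 'I_3}| by rewrite card_option card_ord.
apply: (delta'_of (e := inline_center M)) => [||R [rR _]]; [exact: good_inline_center|exact: inline_center_inj|].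
have [q1 [q2 [q3 eR]]] := coord_ex R Mu; rewrite eR in rR *.
have [q30|q30] := eqVneq q3 0.
  by rewrite q30 in rR *; exact: (center3_inline Mu p0 hg a0 rR).
have [c [r [_ [[h1 h2 _]|[i [h1 h2 _]]]]]] := center3_offline Mu p0 hg a0 q30 rR.
  by move/eqP: a3; case; apply: (cube18000 (r := r) a0); left.
by move/eqP: a3; case; apply: (cube18000 (r := r) a0); right.
Qed.

(** The vertices of the dual tetrahedron: the roots of [x (x^3 - 8 y^3)]. *)
Definition dual_center (o : option 'I_3) := if o is Some i then co (2 * (w ^+ i) ^+ 2) 1 0 else co 0 1 0.

Lemma delta'_8 : a = 0 -> delta' F 3 8.
Proof.
move=> a0; have A0 := center3_A0 Mu p0 hg a0; have Ai := center3_A Mu p0 hg a0.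
have -> : 8%N = (#|{: option 'I_3}| + #|{: option 'I_3}|)%N by rewrite card_option card_ord.
apply: (delta'_of_sum (e1 := inline_center M) (e2 := dual_center)).
- exact: good_inline_center.
- case=> [i|]; rewrite /dual_center.
    have [rP lP] := Ai _ (w3i i); have [rQ _] := P0.
    apply: (good_partner rP rQ).
      by rewrite lP mulr1 addr0 mulf_neq0 ?invr_eq0.
    by move=> [c /co_neq[e1 e2 _]]; move: e2 e1; rewrite mulr1 => <-; rewrite mul0r => /eqP; rewrite oner_eq0.
  have [rP lP] := A0; have [rQ _] := P1.
  apply: (good_partner rP rQ); first by rewrite lP oppr_eq0 oner_eq0.
  by move=> [c /co_neq[/eqP]]; rewrite mulr0 oner_eq0.
- exact: inline_center_inj.
- move=> [i|] [j|] c c0 //= /co_neq[e1 e2 _]; rewrite mulr1 in e2.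
  + by rewrite -e2 mul1r in e1; move/(mulfI t2)/pow_w2_inj: e1 => ->.
  + by move/eqP: e1; rewrite mulr0 (negPf (q0 i)).
  + by move/esym/eqP: e1; rewrite mulf_eq0 (negPf c0) (negPf (q0 j)).
- move=> [i|] [j|] c c0 /= /co_neq[e1 e2 _]; rewrite mulr1 in e2.
  + rewrite -e2 in e1; have : 9 = 0 :> K.
      transitivity (1 ^+ 3 - (- w ^+ i * (2 * (w ^+ j) ^+ 2)) ^+ 3); last by rewrite -e1 subrr.
      transitivity (1 + 8 * ((w ^+ i) ^+ 3 * ((w ^+ j) ^+ 3) ^+ 2)); last by ring.
      by rewrite !(w3i); ring.
    by apply/eqP; exact: nat_neq0.
  + by move/eqP: e1; rewrite mulr0 oner_eq0.
  + by rewrite -e2 eqxx in c0.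
  + by rewrite -e2 eqxx in c0.
- move=> R [rR h6]; have [q1 [q2 [q3 eR]]] := coord_ex R Mu; rewrite eR in rR h6 *.
  have [rO hO lO] := center6_O Mu p0 hg a0.
  have [q30|q30] := eqVneq q3 0; last first.
    have [|c c0 e] := order6_center rO hO rR; first by rewrite lO.
    by case: h6; rewrite e; exact: (homologyZ c0 rO hO).
  rewrite q30 in rR *.
  case: (center3_inline0 Mu p0 hg a0 rR) => [[o h]|h|[i h]].
  + by left; exists o.
  + by right; exists None.
  + by right; exists (Some i).
Qed.

Lemma delta'_12 : a != 0 -> a ^+ 3 = 18000 -> delta' F 3 12.
Proof.
move=> a0 a3.
have [r0 hr0] : exists r, r ^+ 2 = 60 / a.
  have /closed_rootP[r] : size ('X^2 - (60 / a)%:P : {poly K}) != 1%N by rewrite size_XnsubC.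
  by rewrite rootE !hornerE subr_eq0 => /eqP; exists r.
(* The square of [1 + 2 w] is -3, the ratio of -180 and 60. *)
pose r1 := (1 + 2 * w) * r0.
have ar0 : a * r0 ^+ 2 = 60 by rewrite hr0; field.
have r06 : r0 ^+ 6 = 12.
  have a30 : a ^+ 3 != 0 by rewrite expf_neq0.
  by apply: (mulfI a30); transitivity ((a * r0 ^+ 2) ^+ 3); [ring|rewrite ar0 a3; ring].
have w3E : (1 + 2 * w) ^+ 2 = - 3.
  by transitivity (4 * (w ^+ 2 + w + 1) - 3); [ring|rewrite hw; ring].
have ar1 : a * r1 ^+ 2 = - 180.
  by transitivity ((1 + 2 * w) ^+ 2 * (a * r0 ^+ 2)); [rewrite /r1; ring|rewrite w3E ar0; ring].
have r16 : r1 ^+ 6 = - 324.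
  by transitivity (((1 + 2 * w) ^+ 2) ^+ 3 * r0 ^+ 6); [rewrite /r1; ring|rewrite w3E r06; ring].
pose sg (b : bool) : K := if b then 1 else - 1.
have sg2 b : sg b ^+ 2 = 1 by rewrite /sg; case: b; ring.
have sg6 b : sg b ^+ 6 = 1 by rewrite /sg; case: b; ring.
have sginj r b b' : r != 0 -> sg b * r = sg b' * r -> b = b'.
  move=> rn0 /(mulIf rn0); have n11 : 1 != -1 :> K.
    by rewrite -addr_eq0 (_ : 1 + 1 = 2).
  by case: b b' => -[] //= /eqP; [rewrite (negPf n11)|rewrite eq_sym (negPf n11)].
have r0n : r0 != 0.
  by apply: contra_eqN r06 => /eqP ->; rewrite expr0n eq_sym nat_neq0.
have r1n : r1 != 0.
  by apply: contra_eqN r16 => /eqP ->; rewrite expr0n eq_sym oppr_eq0 nat_neq0.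
have sgroot r s : r != 0 -> s ^+ 2 = r ^+ 2 -> exists b, s = sg b * r.
  move=> rn0 /eqP; rewrite eqf_sqr => /orP[] /eqP ->; [exists true|exists false].
    by rewrite mul1r.
  by rewrite mulN1r.
have Q0 b : center3 (co 0 1 (sg b * r0)) /\
    forall x y z, lam (co 0 1 (sg b * r0)) (co x y z) = y / 2 + z / (2 * (sg b * r0)).
  by apply: (center3_Q0 Mu p0 hg); rewrite exprMn ?sg2 ?sg6 mul1r.
have Qi (i : 'I_3) b : center3 (co (2 * (w ^+ i) ^+ 2) 1 (sg b * r1)) /\
    forall x y z, lam (co (2 * (w ^+ i) ^+ 2) 1 (sg b * r1)) (co x y z) = x * (w ^+ i / 6) + y / 6 + z / (2 * (sg b * r1)).
  by apply: (center3_Q Mu p0 hg) => //; [exact: (w3i i)|rewrite exprMn sg2 mul1r|rewrite exprMn sg6 mul1r].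
have t6 : 6 != 0 :> K by exact: nat_neq0.
have sgn b : sg b != 0 by case: b; rewrite /sg ?oppr_eq0 oner_eq0.
have zP o x y z c : c != 0 -> inline_center M o = c *: co x y z -> z = 0.
  by case: o => [i|] c0 /co_neq[_ _ /esym/eqP]; rewrite mulf_eq0 (negPf c0) => /eqP.
have -> : 12%N = (#|{: option 'I_3}| + #|{: option 'I_3 * bool}|)%N.
  by rewrite card_prod card_option card_ord card_bool.
apply: (delta'_of_sum (e1 := inline_center M) (e2 := offline_center M r0 r1)).
- exact: good_inline_center.
- case=> [[i|] b]; rewrite /offline_center /= -/(sg b).
    have [rP lP] := Qi i b; have [rQ _] := P0.
    apply: (good_partner rP rQ).
      by rewrite lP !mul0r !addr0 mul1r mulf_neq0 ?invr_eq0.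
    by move=> [c /co_neq[e1 e2 _]]; move: e2 e1; rewrite mulr1 => <-; rewrite mul0r => /eqP; rewrite oner_eq0.
  have [rP lP] := Q0 b; have [rQ _] := P1.
  apply: (good_partner rP rQ).
    by rewrite lP mul0r addr0 mulf_neq0 ?invr_eq0 // oppr_eq0 oner_eq0.
  by move=> [c /co_neq[/eqP]]; rewrite mulr0 oner_eq0.
- exact: inline_center_inj.
- move=> [[i|] b] [[j|] b'] c c0; rewrite /offline_center /= -/(sg b) -/(sg b') => /co_neq[e1 e2 e3]; rewrite mulr1 in e2; rewrite -e2 ?mul1r in e1 e3.
  + by move/(mulfI t2)/pow_w2_inj: e1 => ->; move/(sginj _ _ _ r1n): e3 => ->.
  + by move/eqP: e1; rewrite (negPf (q0 i)).
  + by move/esym/eqP: e1; rewrite (negPf (q0 j)).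
  + by move/(sginj _ _ _ r0n): e3 => ->.
- move=> o [[j|] b] c c0; rewrite /offline_center /= -/(sg b) => /(zP _ _ _ _ _ c0)/eqP;
    by rewrite mulf_eq0 (negPf (sgn b)) ?(negPf r0n) ?(negPf r1n).
- move=> R [rR _]; have [q1 [q2 [q3 eR]]] := coord_ex R Mu; rewrite eR in rR *.
  have [q30|q30] := eqVneq q3 0.
    by left; rewrite q30 in rR *; exact: (center3_inline Mu p0 hg a0 rR).
  right; have [c [r [c0 [[h1 _ e]|[i [h1 _ e]]]]]] := center3_offline Mu p0 hg a0 q30 rR.
    have [|b eb] := sgroot r0 r r0n; first by apply: (mulfI a0); rewrite h1 ar0.
    by exists (None, b), c; rewrite // /offline_center /= -/(sg b) -eb.
  have [|b eb] := sgroot r1 r r1n; first by apply: (mulfI a0); rewrite h1 ar1.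
  by exists (Some i, b), c; rewrite // /offline_center /= -/(sg b) -eb.
Qed.

End Coordinates.

End Sextic.

(** * The three curves *)

Section CurveForms.
Variable K : closedFieldType.

Lemma curve4_eval (a : K) (v : 'rV[K]_3) : (curve4 a).@[v 0] = pencil a (v 0 i0) (v 0 i1) (v 0 i2).
Proof.
rewrite /curve4 /pencil !(mevalD, mevalB, mevalM, mevalN, mevalZ, rmorphXn, rmorph_nat) /= !mevalXU.
ring.
Qed.

Lemma curve8_eval (v : 'rV[K]_3) : (curve8 K).@[v 0] = pencil 0 (v 0 i0) (v 0 i1) (v 0 i2).
Proof.
rewrite /curve8 /pencil !(mevalD, mevalB, mevalM, mevalN, mevalZ, rmorphXn, rmorph_nat) /= !mevalXU.
ring.
Qed.

Lemma curve12_eval (v : 'rV[K]_3) : (curve12 K).@[v 0] =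
  let x := v 0 i0 in let y := v 0 i1 in let z := v 0 i2 in
  x ^+ 6 + y ^+ 6 + z ^+ 6 - 10 * (x ^+ 3 * y ^+ 3 + y ^+ 3 * z ^+ 3 + z ^+ 3 * x ^+ 3).
Proof.
rewrite /curve12 /= !(mevalD, mevalB, mevalM, mevalN, mevalZ, rmorphXn, rmorph_nat) /= !mevalXU.
ring.
Qed.

Lemma homog_pow n (i : 'I_3) : ('X_i : {mpoly K[3]}) ^+ n \is n.-homog.
Proof.
by rewrite -[X in X.-homog]mul1n; apply: dhomogMn; rewrite dhomogX; apply/eqP; exact: mdeg1.
Qed.

Lemma homog_pow2 n m (i j : 'I_3) : ('X_i : {mpoly K[3]}) ^+ n * 'X_j ^+ m \is (n + m).-homog.
Proof. by apply: dhomogM; exact: homog_pow. Qed.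

Lemma curve4_homog (a : K) : curve4 a \is 6.-homog.
Proof.
rewrite /curve4 -[20 * _ * _]mulrA !mulr_natl; apply: rpredD.
  apply: rpredD; first exact: homog_pow.
  apply: rpredZ; rewrite -[6%N]/(4 + 2)%N; apply: dhomogM; last exact: homog_pow.
  by apply: rpredD; [exact: (homog_pow2 3 1 0 1)|exact: homog_pow].
apply: rpredB; last by apply: rpredMn; exact: homog_pow.
by apply: rpredD; [exact: homog_pow|apply: rpredMn; exact: (homog_pow2 3 3)].
Qed.

Lemma curve8_homog : curve8 K \is 6.-homog.
Proof.
rewrite /curve8 -[20 * _ * _]mulrA !mulr_natl; apply: rpredD; last exact: homog_pow.
apply: rpredB; last by apply: rpredMn; exact: homog_pow.
by apply: rpredD; [exact: homog_pow|apply: rpredMn; exact: (homog_pow2 3 3)].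
Qed.

Lemma curve12_homog : curve12 K \is 6.-homog.
Proof.
rewrite /curve12 !mulr_natl; apply: rpredB.
  by do 2?apply: rpredD; exact: homog_pow.
by apply: rpredMn; do 2?apply: rpredD; exact: (homog_pow2 3 3).
Qed.
End CurveForms.

Section Final.
Variable K : closedFieldType.
Hypothesis charK0 : [pchar K] =i pred0.
Variable F : {mpoly K[3]}.
Hypotheses (hF : F \is 6.-homog) (smF : smooth_curve F).
Implicit Types (P Q v : 'rV[K]_3).
Notation ev v := (F.@[v 0]).
Notation in_pencil := (in_pencil F).
Let nz n := @nat_neq0 K charK0 n.

(** If [F] vanished everywhere, so would its differential, and no point would
    be smooth. *)
Lemma off_curve_ex : exists P, ev P != 0.
Proof.
apply: NNPP => none; have F0 P : ev P = 0.
  by apply/eqP; apply: contraT => h; case: none; exists P.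
have v0 : pt 1 0 0 != 0 :> 'rV[K]_3 by rewrite pt_eq0 oner_eq0.
have d0 v v' : dform F v v' = 0.
  apply: (@dform_coef _ _ hF _ _ 0 0 0 0 0 0 0) => t; rewrite F0 /horner_seq /=; ring.
by case: (dform_basis_eq0 smF (unitmx1 _ _) v0 (F0 _)); split.
Qed.

(** Projective equivalence only compares the points of the curves; by
    [form_ratio] it compares the equations up to a constant. *)
Lemma pe_formP (G : {mpoly K[3]}) : G \is 6.-homog -> projectively_equivalent F G <->
  exists M p, [/\ M \in unitmx, p != 0 & forall x y z, ev (pt x y z *m M) = p * G.@[(pt x y z) 0]].
Proof.
move=> hG; split=> [[M Mu h]|[M [p [Mu p0 h]]]]; last first.
  exists (invmx M); first by rewrite unitmx_inv.
  move=> v; have e : ev v = p * G.@[(v *m invmx M) 0].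
    by rewrite [v *m invmx M]pt_eta -h -pt_eta mulmxKV.
  rewrite /on_curve mulmx_unit_eq0 ?unitmx_inv //; split=> -[v0 h0]; split=> //; last by rewrite e h0 mulr0.
  by move/eqP: h0; rewrite e mulf_eq0 (negPf p0) => /eqP.
have [P FP] := off_curve_ex.
have P0 := off_curve_neq0 hF isT FP.
have GP : G.@[(P *m M) 0] != 0.
  apply: contraNneq FP => GP; apply/eqP; have [_] := h P; rewrite /on_curve mulmx_unit_eq0 //.
  by case.
have r := form_ratio charK0 hF smF isT FP hG (fun v Cv => proj2 ((h v).1 Cv)).
exists (invmx M), (ev P / G.@[(P *m M) 0]); split; first by rewrite unitmx_inv.
  by rewrite mulf_neq0 ?invr_eq0.
by move=> x y z; have := r (pt x y z *m invmx M); rewrite mulmxKV // mulrAC => ->; rewrite mulrAC divff // mul1r.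
Qed.

Lemma pe_curve4 a : projectively_equivalent F (curve4 a) <-> in_pencil a.
Proof.
rewrite (pe_formP (curve4_homog a)); split=> -[M [p [Mu p0 h]]]; exists M, p; split=> // x y z;
  by rewrite h curve4_eval pt0 pt1 pt2.
Qed.

Lemma pe_curve8 : projectively_equivalent F (curve8 K) <-> in_pencil 0.
Proof.
rewrite (pe_formP (curve8_homog K)); split=> -[M [p [Mu p0 h]]]; exists M, p; split=> // x y z;
  by rewrite h curve8_eval pt0 pt1 pt2.
Qed.

Let twelve (r : K) := mx3 (pt 1 0 0) (pt 0 (-1) (-1)) (pt 0 r^-1 (- r^-1)).

Lemma twelveE r x y z : pt x y z *m twelve r = pt x (- y + z / r) (- y - z / r).
Proof. by rewrite pt_mx3 !pt_scale !pt_add; congr pt; ring. Qed.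

Lemma twelve_unit r : r != 0 -> twelve r \in unitmx.
Proof.
move=> r0; have t2 := nz (isT : 0 < 2)%N; apply: mx3_unit => x y z; rewrite -pt_mx3 -/(twelve r) twelveE => /eqP.
rewrite pt_eq0 => /and3P[/eqP -> /eqP e1 /eqP e2]; split=> //.
  apply: (mulfI t2); transitivity (- ((- y + z / r) + (- y - z / r))); first by ring.
  by rewrite e1 e2; ring.
apply: (mulfI t2); transitivity (r * ((- y + z / r) - (- y - z / r))); first by field.
by rewrite e1 e2; ring.
Qed.

(** With [t = z / r], the value of the curve at [(x, - y + t, - y - t)] is [12
    t^6 + 60 (x^3 y + y^4) t^2] plus the octahedral form. *)
Lemma twelve_eval r a x y z : r != 0 -> r ^+ 6 = 12 -> a * r ^+ 2 = 60 ->
  (curve12 K).@[(pt x y z *m twelve r) 0] = pencil a x y z.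
Proof.
move=> r0 r6 ar; rewrite twelveE curve12_eval pt0 pt1 pt2 /=.
pose t := z / r; have ez : z = r * t by rewrite /t; field.
rewrite -/t [in RHS]ez; transitivity (r ^+ 6 * t ^+ 6 + (a * r ^+ 2) * ((x ^+ 3 * y + y ^+ 4) * t ^+ 2)
  + (x ^+ 6 + 20 * x ^+ 3 * y ^+ 3 - 8 * y ^+ 6)); last by rewrite /pencil; ring.
by rewrite r6 ar; ring.
Qed.

Lemma pe_curve12 : projectively_equivalent F (curve12 K) <-> exists2 a, a ^+ 3 = 18000 & in_pencil a.
Proof.
rewrite (pe_formP (curve12_homog K)); split=> [[M [p [Mu p0 h]]]|[a a3 [M [p [Mu p0 h]]]]].
  have [r r6] : exists r : K, r ^+ 6 = 12.
    have /closed_rootP[r] : size ('X^6 - 12%:P : {poly K}) != 1%N by rewrite size_XnsubC.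
    by rewrite rootE !hornerE subr_eq0 => /eqP; exists r.
  have r0 : r != 0 by apply: contra_eqN r6 => /eqP ->; rewrite expr0n eq_sym nz.
  have ar : 60 / r ^+ 2 * r ^+ 2 = 60 by rewrite divfK // expf_neq0.
  exists (60 / r ^+ 2).
    have r60 : r ^+ 6 != 0 by rewrite expf_neq0.
    apply: (mulIf r60); transitivity ((60 / r ^+ 2 * r ^+ 2) ^+ 3); first by ring.
    by rewrite ar r6; ring.
  exists (twelve r *m M), p; split=> // [|x y z]; first by rewrite unitmx_mul twelve_unit.
  by rewrite mulmxA [pt x y z *m twelve r]pt_eta h -pt_eta (twelve_eval _ _ _ r0 r6 ar).
have a0 : a != 0 by apply: contra_eqN a3 => /eqP ->; rewrite expr0n eq_sym nz.
have [r hr] : exists r, r ^+ 2 = 60 / a.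
  have /closed_rootP[r] : size ('X^2 - (60 / a)%:P : {poly K}) != 1%N by rewrite size_XnsubC.
  by rewrite rootE !hornerE subr_eq0 => /eqP; exists r.
have ar : a * r ^+ 2 = 60 by rewrite hr; field.
have r6 : r ^+ 6 = 12.
  have a30 : a ^+ 3 != 0 by rewrite expf_neq0.
  by apply: (mulfI a30); transitivity ((a * r ^+ 2) ^+ 3); [ring|rewrite ar a3; ring].
have r0 : r != 0 by apply: contra_eqN r6 => /eqP ->; rewrite expr0n eq_sym nz.
exists (invmx (twelve r) *m M), p; split=> // [|x y z].
  by rewrite unitmx_mul unitmx_inv twelve_unit.
rewrite mulmxA [pt x y z *m invmx _]pt_eta h -(twelve_eval _ _ _ r0 r6 ar) -pt_eta mulmxKV //.
exact: twelve_unit.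
Qed.

Lemma cube_root_of_unity : exists w : K, w ^+ 2 + w + 1 = 0.
Proof.
have sz : size ('X + 1 : {poly K}) = 2%N by rewrite -[1]opprK -polyCN size_XsubC.
have /closed_rootP[w] : size ('X^2 + ('X + 1) : {poly K}) != 1%N.
  by rewrite size_polyDl ?size_polyXn ?sz.
by rewrite rootE !hornerD hornerXn hornerX -[1]polyC1 hornerC addrA => /eqP; exists w.
Qed.

Lemma cube18000_neq0 a : a ^+ 3 = 18000 -> a != 0 :> K.
Proof. by move=> a3; apply: contra_eqN a3 => /eqP ->; rewrite expr0n eq_sym nz. Qed.

Lemma delta'_pencil a : in_pencil a -> delta' F 3
  (if a == 0 then 8%N else if a ^+ 3 == 18000 then 12%N else 4%N).
Proof.
have [w hw] := cube_root_of_unity; move=> [M [p [Mu p0 h]]]; case: eqVneq => a0.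
  exact: (delta'_8 charK0 hw hF smF Mu p0 h a0).
case: eqVneq => a3; first exact: (delta'_12 charK0 hw hF smF Mu p0 h a0 a3).
exact: (delta'_4 charK0 hw hF smF Mu p0 h a0 a3).
Qed.

(** Either all pairs of centers commute, or some pair does not and puts [F] in
    the pencil. *)
Lemma few_or_pencil : (exists2 n, (n <= 3)%N & delta' F 3 n) \/ exists a, in_pencil a.
Proof.
have [w hw] := cube_root_of_unity; apply: NNPP => /not_or_and[few none]; apply: few.
apply: (few_commuting charK0 hw hF smF) => P Q gP gQ; have Q0 := good_neq0 hF gQ.
have [PQ|PQ] := eqVneq (lf (pol 6 F P) Q) 0; [by left|right; apply: NNPP => ns].
have [|[_ h]|[_ h]] := noncommuting charK0 hw hF smF gP.1 gQ.1 PQ; last by apply: none; exists 0.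
  move=> [c e]; case: ns; exists c => //; apply: contraNneq Q0 => c0.
  by rewrite e c0 scale0r.
exact: none.
Qed.

Lemma delta'_cases n : delta' F 3 n -> (n <= 3)%N \/ exists2 a, in_pencil a &
  n = (if a == 0 then 8%N else if a ^+ 3 == 18000 then 12%N else 4%N).
Proof.
move=> hn; case: few_or_pencil => [[m m3 hm]|[a sa]]; [left|right].
  by rewrite (delta'_unique hn hm).
by exists a => //; exact: delta'_unique hn (delta'_pencil sa).
Qed.

End Final.

Theorem theorem4p1 (K : closedFieldType) (charK0 : [pchar K] =i pred0)
    (F : {mpoly K[3]}) (F_deg6 : F \is 6.-homog) (F_smooth : smooth_curve F) :
  [/\ exists2 n : nat, n \in [:: 0; 1; 2; 3; 4; 8; 12]%N & delta' F 3 n,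
      delta' F 3 12 <-> projectively_equivalent F (curve12 K),
      delta' F 3 8 <-> projectively_equivalent F (curve8 K)
    & delta' F 3 4 <->
        (exists2 a : K, a != 0 & projectively_equivalent F (curve4 a))
        /\ ~ projectively_equivalent F (curve12 K)].
Proof.
have cases := delta'_cases charK0 F_deg6 F_smooth.
have dpencil := delta'_pencil charK0 F_deg6 F_smooth.
have a12 := cube18000_neq0 charK0.
have pe12 := pe_curve12 charK0 F_deg6 F_smooth.
have pe8 := pe_curve8 charK0 F_deg6 F_smooth.
have pe4 := pe_curve4 charK0 F_deg6 F_smooth.
split.
- case: (few_or_pencil charK0 F_deg6 F_smooth) => [[n n3 hn]|[a /dpencil hn]]; eexists; try exact: hn.
    by move: n n3 {hn} => [|[|[|[|n]]]].
  by case: ifP => // _; case: ifP.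
- split=> [/cases[//|[a sa]]|/pe12[a a3 /dpencil]].
    by case: eqVneq => // _; case: eqVneq => // a3 _; apply/pe12; exists a.
  by rewrite (negPf (a12 a a3)) a3 eqxx.
- split=> [/cases[//|[a sa]]|/pe8/dpencil]; last by rewrite eqxx.
  by case: eqVneq => [a0 _|_]; [apply/pe8; rewrite -a0|case: eqVneq].
- split=> [h4|[[a a0 /pe4 sa] n12]].
    case: (cases _ h4) => [//|[a sa]]; case: eqVneq => // a0; case: eqVneq => // a3 _.
    split; first by exists a => //; apply/pe4.
    move=> /pe12[b b3 /dpencil]; rewrite (negPf (a12 b b3)) b3 eqxx.
    by move/(delta'_unique h4).
  have := dpencil a sa; rewrite (negPf a0); case: eqVneq => // a3.
  by case: n12; apply/pe12; exists a.
Qed.
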